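(* Let $\mathbb F=\mathbb C$ and $\mu>\rho-1$, and let $\tau:\Pi_q\to\Pi_q$, $\tau(x)=x^t$ (transposition, equivalently entrywise complex conjugation on Hermitian matrices). Then the group of all hypergroup automorphisms of $X_{q,\mu}$ is $\mathrm{Aut}(X_{q,\mu})=\{\sigma\circ T_a:\ a\in GL(q,\mathbb C),\ \sigma\in\{\mathrm{Id},\tau\}\}.$
   Context: Let $\mathbb F\in\{\mathbb R,\mathbb C,\mathbb H\}$ with real dimension $d\in\{1,2,4\}$ and fix $q\in\mathbb N$. $M_q$ denotes the $q\times q$ matrices over $\mathbb F$, $x^*=\bar x^t$, $H_q=\{x\in M_q:x=x^*\}$ with the real scalar product $(x|y)=\mathrm{Re}\,\mathrm{tr}(x^*y)$ and norm $\|x\|=(x|x)^{1/2}$; $\Pi_q\subset H_q$ is the cone of positive semidefinite matrices, $\Omega_q$ its interior, $U_q$ the unitary group, $GL(q)=GL(q,\mathbb F)$. For $r\in\Pi_q$, $\sqrt r$ is its unique positive semidefinite square root. $\Delta$ is the determinant function of the symmetric cone $\Omega_q$ (the usual determinant for $\mathbb F=\mathbb R,\mathbb C$). Put $\rho=d(q-\frac12)+1$. For $\mu>\rho-1$ let $D=\{v\in M_q: v^*v<I\}$, $\kappa_\mu=\int_D\Delta(I-v^*v)^{\mu-\rho}dv$ (Lebesgue measure on $M_q\cong\mathbb R^{dq^2}$). The matrix Bessel hypergroup $X_{q,\mu}=(\Pi_q,*_\mu)$ is $\Pi_q$ with the convolution of bounded Borel measures obtained by bilinear, weakly continuous extension of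 $(\delta_r*_\mu\delta_s)(f)=\kappa_\mu^{-1}\int_D f\big(\sqrt{r^2+s^2+svr+rv^*s}\big)\Delta(I-vv^* )^{\mu-\rho}dv$ ($f\in C_c(\Pi_q)$). It is a commutative hypergroup with neutral element $0$ and identity involution. A hypergroup automorphism of $X_{q,\mu}$ is a homeomorphism $T:\Pi_q\to\Pi_q$ with $T(\delta_x*_\mu\delta_y)=\delta_{T(x)}*_\mu\delta_{T(y)}$ for all $x,y$ (image measures). For $a\in M_q$ define $T_a:\Pi_q\to\Pi_q$, $T_a(r)=\sqrt{ar^2a^*}$. *)

(* Defs.v *)
From HB Require Import structures.
From mathcomp Require Import all_boot all_order all_algebra.
From mathcomp Require Import all_classical all_reals.
From mathcomp Require Import ereal exp measure lebesgue_measure lebesgue_integral.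
From mathcomp Require Import complex.

Set Implicit Arguments.
Unset Strict Implicit.
Unset Printing Implicit Defensive.

Import Order.TTheory GRing.Theory Num.Theory.
Local Open Scope ring_scope.

Section MatrixBessel.
Variable R : realType.
Local Notation C := (R[i]).
Variable q : nat.
Local Notation M := ('M[C]_q).

Definition mxadj m n (x : 'M[C]_(m, n)) : 'M[C]_(n, m) := (map_mx Num.conj x)^T.

Definition mnorm (x : M) : R := Num.sqrt (complex.Re (\tr (mxadj x *m x))).

(* Pi_q : positive semidefinite (Hermitian) matrices.  For complex numbers,
   [0 <= z] means that z is real and nonnegative. *)
Definition psd (x : M) : Prop :=
  mxadj x = x /\ forall u : 'cV[C]_q, 0 <= (mxadj u *m x *m u) 0 0.

Definition pd (x : M) : Prop :=
  mxadj x = x /\ forall u : 'cV[C]_q, u != 0 -> 0 < (mxadj u *m x *m u) 0 0.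

(* the unique positive semidefinite square root (chosen by xget; for
   r in Pi_q the set below is a singleton) *)
Definition msqrt (r : M) : M := xget 0 [set s | psd s /\ s *m s = r].

(* Delta : determinant of the symmetric cone Omega_q (F = C: usual det,
   real on Hermitian matrices) *)
Definition Delta (x : M) : R := complex.Re (\det x).

(* rho = d (q - 1/2) + 1 with d = 2 *)
Definition rho : R := 2 * (q%:R - 2^-1) + 1.

Definition inD (v : M) : Prop := pd (1%:M - mxadj v *m v).

(* Identification M_q(C) = R^(2 q^2): coordinates c 0 .. c (2q^2 - 1) *)
Definition vmat (c : nat -> R) : M :=
  \matrix_(i, j) (Complex (c (2 * (i * q + j))%N) (c (2 * (i * q + j)).+1)).

(* Lebesgue integral on R^N, computed as the iterated Lebesgue integral
   over the N real coordinates (Fubini/Tonelli). *)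
Fixpoint itint (N : nat) (f : (nat -> R) -> \bar R) : \bar R :=
  match N with
  | 0 => f (fun _ => 0)
  | N'.+1 => (\int[@lebesgue_measure R]_(x in [set: R])
                itint N' (fun c => f (fun k => if k is k'.+1 then c k' else x)))%E
  end.

Definition intD (g : M -> R) : \bar R :=
  itint (2 * q * q) (fun c => if `[< inD (vmat c) >] then (g (vmat c))%:E else 0%E).

Definition kappa (mu : R) : \bar R :=
  intD (fun v => Delta (1%:M - mxadj v *m v) `^ (mu - rho)).

Definition conv (mu : R) (r s : M) (f : M -> R) : R :=
  (fine (kappa mu))^-1 *
  fine (intD (fun v => f (msqrt (r *m r + s *m s + s *m v *m r + r *m mxadj v *m s))
                        * Delta (1%:M - v *m mxadj v) `^ (mu - rho))).

Definition contPi (T : M -> M) : Prop :=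
  forall x, psd x -> forall e : R, 0 < e -> exists2 d : R, 0 < d &
    forall y, psd y -> mnorm (y - x) < d -> mnorm (T y - T x) < e.

Definition contPiR (f : M -> R) : Prop :=
  forall x, psd x -> forall e : R, 0 < e -> exists2 d : R, 0 < d &
    forall y, psd y -> mnorm (y - x) < d -> `|f y - f x| < e.

(* C_c(Pi_q): continuous, with compact support in Pi_q (Pi_q is closed in
   the finite-dimensional space H_q, so compact support = bounded support) *)
Definition Cc (f : M -> R) : Prop :=
  contPiR f /\ exists K : R, forall x, psd x -> K < mnorm x -> f x = 0.

Definition homeoPi (T : M -> M) : Prop :=
  (forall x, psd x -> psd (T x)) /\ contPi T /\
  exists S : M -> M, [/\ (forall x, psd x -> psd (S x)), contPi S,
     (forall x, psd x -> S (T x) = x) & (forall x, psd x -> T (S x) = x)].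

(* hypergroup automorphism: T(delta_x * delta_y) = delta_(T x) * delta_(T y)
   as measures on Pi_q, i.e. tested against all f in C_c(Pi_q). *)
Definition hypergroup_aut (mu : R) (T : M -> M) : Prop :=
  homeoPi T /\
  forall x y, psd x -> psd y -> forall f, Cc f ->
    conv mu x y (f \o T) = conv mu (T x) (T y) f.

Definition Ta (a : M) (r : M) : M := msqrt (a *m (r *m r) *m mxadj a).

Definition tau (x : M) : M := x^T.

End MatrixBessel.

(* Main.v *)
(** An automorphism [T] is studied through [S x = (T (sqrt x))^2], which turns the
    support of [delta_(sqrt x) * delta_(sqrt y)] into the closure of
    [{x + y + sqrt y v sqrt x + sqrt x v^* sqrt y : v in D}].  Testing against bump
    functions shows that [S] respects these sets.  For [x = y] the closure is the
    order interval [[0, 4x]], so [S] and its inverse preserve the Loewner order; the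
    largest and smallest elements for arguments [a^2 x], [b^2 x] are [(a+b)^2 x] and
    [(a-b)^2 x], and central symmetry gives [g(a+b) + g(a-b) = 2 g(a) + 2 g(b)] for
    [g t = S (t^2 x)], hence [S] is homogeneous.  Rank one elements are those with
    totally ordered intervals [[0, z]]; comparing increments of [S] along them yields
    additivity, and an additive map of the cone preserving rank one elements is
    [x |-> a x a^*] or [x |-> a x^t a^*].

    Conversely, with polar decompositions [a r = T_a(r) u_r] and [a s = T_a(s) u_s],
    the substitution [v |-> u_s v u_r^*] carries one convolution integral to the
    other.  Such a substitution preserves the iterated integral because a
    translation-invariant integral is unique up to a factor, and the factor is
    determined by the weight itself once [0 < kappa < oo].  Finiteness of [kappa] is
    proved by integrating out, for the growing corner blocks of [v], first the
    diagonal entry and then the bordering entries. *)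
Require Import Defs.
From HB Require Import structures.
From mathcomp Require Import all_boot all_order all_algebra spectral.
From mathcomp Require Import all_classical all_reals.
From mathcomp Require Import ereal topology normedtype sequences exp measure derive realfun ftc.
From mathcomp Require Import lebesgue_measure lebesgue_integral measurable_realfun numfun.
From mathcomp Require Import complex ring lra zify.

Set Implicit Arguments.
Unset Strict Implicit.
Unset Printing Implicit Defensive.

Import Order.TTheory GRing.Theory Num.Theory.
Import numFieldNormedType.Exports.
Local Open Scope classical_set_scope.
Local Open Scope ring_scope.

(** * Iterated integrals over finitely many coordinates *)

Section Shift.
Variable R : realType.
Local Notation leb := (@lebesgue_measure R).

(** In squared coordinates [Ta a] becomes the linear map x -> a x a^*, and the squared support point
    is real-affine in v; hence the passage from T to S. Since D is open, the extremes v = 1 and v =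
    -1 are never attained: every support statement holds only up to e and passes to the limit
    because the cone is closed. Test functions have compact support, so the inverse U of T is not at
    once known to respect convolution: f \o U must vanish outside a bounded set. The bound on T over
    bounded sets comes from the one order statement that uses T alone, namely that S maps [0, 4x]
    into [0, 4 S x]; full monotonicity needs both directions. [fine] sends infinite values to 0, so
    an infinite kappa would make every convolution vanish; its finiteness is where mu - rho > -1
    enters. Integrating out a diagonal entry raises the exponent of the radius by two halves and
    leaves the exponent of the smaller determinant unchanged, so the same condition serves at every
    corner size. *)

Lemma lebesgue_shift (a : R) (A : set R) : measurable A ->
  pushforward leb ((fun x => x + a) : measurableTypeR R -> measurableTypeR R) A = leb A.
Proof.
have ms : measurable_fun setT ((fun x => x + a) : measurableTypeR R -> measurableTypeR R).
  by apply: measurable_funD => //.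
move=> mA; apply/esym/lebesgue_measure_unique => //= _ [[b c]] _ <-.
rewrite /pushforward.
have -> : (fun x : R => x + a) @^-1` `]b, c]%classic = `]b - a, c - a]%classic.
  by apply/seteqP; split=> x /=; rewrite !in_itv /= ltrBlDr lerBrDr.
rewrite !lebesgue_measure_itv/= !lte_fin ltrD2r.
by rewrite -!EFinB; congr (if _ then _%:E else _); rewrite opprB addrA subrK.
Qed.

Lemma ge0_integral_shift (a : R) (f : R -> \bar R) :
  measurable_fun [set: R] f -> (forall r, 0 <= f r)%E ->
  (\int[leb]_(x in [set: R]) f (x + a)%R = \int[leb]_(x in [set: R]) f x)%E.
Proof.
move=> mf f0.
pose sh : measurableTypeR R -> measurableTypeR R := fun x : R => x + a.
have ms : measurable_fun setT sh by apply: measurable_funD.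
rewrite [LHS](_ : _ = \int[leb]_(x in sh @^-1` setT) (f \o sh) x)%E //.
rewrite -ge0_integral_pushforward//=.
apply: eq_measure_integral => //= A mA AS.
exact: lebesgue_shift.
Qed.
End Shift.

Section CoordSpace.
Variable R : realType.
Local Notation leb := (@lebesgue_measure R).

(** Infinite sequences are used so that integrating out one coordinate gives a function on the same
    space; coordinates can then be integrated in any order without a change of type. *)
Definition cylinders : set (set (nat -> R)) :=
  [set A | exists k, exists2 B : set R, measurable B & A = (fun c => c k) @^-1` B].
Definition coords := g_sigma_algebraType cylinders.

Lemma measurable_coord k : measurable_fun [set: coords] (fun c : coords => (c k : R)).
Proof.
move=> _ B mB; rewrite setTI; apply: sub_sigma_algebra.
by exists k, B.
Qed.

Lemma measurable_to_coords d (T : measurableType d) (f : T -> coords) :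
  (forall k, measurable_fun [set: T] (fun t => (f t k : R))) -> measurable_fun [set: T] f.
Proof.
move=> mf; apply: (@measurability _ _ _ _ setT f cylinders) => //.
move=> _ [_ [k [B mB ->]] <-].
exact: (mf k measurableT B mB).
Qed.

Definition upd (c : nat -> R) (k : nat) (x : R) : nat -> R :=
  fun j => if j == k then x else c j.

Lemma measurable_upd d (T : measurableType d) (f : T -> coords) k (g : T -> R) :
  measurable_fun setT f -> measurable_fun setT g ->
  measurable_fun setT (fun t => upd (f t) k (g t) : coords).
Proof.
move=> mf mg; apply: measurable_to_coords => j; rewrite /upd.
case: (j == k) => //.
exact: (measurableT_comp (@measurable_coord j) mf).
Qed.

Definition E1 (k : nat) (f : (nat -> R) -> \bar R) (c : nat -> R) : \bar R :=
  (\int[leb]_(x in [set: R]) f (upd c k x))%E.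

Lemma E1_ge0 k f c : (forall c, 0 <= f c)%E -> (0 <= E1 k f c)%E.
Proof. by move=> f0; apply: integral_ge0. Qed.

Lemma measurable_upd_section (f : coords -> \bar R) k (c : coords) : measurable_fun setT f ->
  measurable_fun setT (fun x : R => f (upd c k x)).
Proof.
move=> mf; apply: (measurableT_comp mf).
apply: measurable_upd => //; exact: measurable_cst.
Qed.

Lemma measurable_E1_param d (T : measurableType d) k (f : T * coords -> \bar R) :
  (forall c, 0 <= f c)%E -> measurable_fun setT f ->
  measurable_fun setT (fun p : T * coords => E1 k (fun c => f (p.1, c)) p.2).
Proof.
move=> f0 mf.
pose g (p : (T * coords) * R) := f (p.1.1, upd p.1.2 k p.2 : coords).
have mg : measurable_fun setT g.
  apply: (measurableT_comp mf); apply/measurable_fun_pairP; split => /=.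
    exact: (measurableT_comp measurable_fst measurable_fst).
  apply: measurable_upd => //.
  exact: (measurableT_comp measurable_snd measurable_fst).
have := @measurable_fun_fubini_tonelli_F _ _ _ _ R leb g mg (fun x => f0 _).
by [].
Qed.

Lemma measurable_E1 k (f : coords -> \bar R) :
  (forall c, 0 <= f c)%E -> measurable_fun setT f -> measurable_fun setT (E1 k f : coords -> _).
Proof.
move=> f0 mf.
have m2 : measurable_fun setT (fun p : unit * coords => f p.2).
  exact: (measurableT_comp mf measurable_snd).
have := measurable_E1_param k (fun c => f0 _) m2.
move=> h; have := measurableT_comp h (g := fun c : coords => (tt, c)).
apply; exact: pair1_measurable.
Qed.

Lemma E1_comm j k (f : coords -> \bar R) c :
  (forall c, 0 <= f c)%E -> measurable_fun setT f -> j != k ->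
  E1 j (E1 k f) c = E1 k (E1 j f) c.
Proof.
move=> f0 mf jk; rewrite /E1.
pose F (p : R * R) := f (upd (upd c j p.1) k p.2).
have mF : measurable_fun setT F.
  apply: (measurableT_comp mf); apply: measurable_upd => //.
  by apply: measurable_upd => //; exact: measurable_cst.
have := @fubini_tonelli _ _ _ _ R leb leb F mF (fun _ => f0 _).
rewrite /F /= => ->; apply: eq_integral => y _; apply: eq_integral => x _.
congr f; apply/funext => i; rewrite /upd.
by case: (eqVneq i k) => // ->; rewrite eq_sym (negbTE jk).
Qed.

Fixpoint Es (ks : seq nat) (f : (nat -> R) -> \bar R) (c : nat -> R) : \bar R :=
  if ks is k :: ks' then E1 k (Es ks' f) c else f c.

Lemma Es_ge0 ks f c : (forall c, 0 <= f c)%E -> (0 <= Es ks f c)%E.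
Proof. by move=> f0; elim: ks c => [|k ks IH] c //=; apply: E1_ge0. Qed.

Lemma measurable_Es ks (f : coords -> \bar R) :
  (forall c, 0 <= f c)%E -> measurable_fun setT f -> measurable_fun setT (Es ks f : coords -> _).
Proof.
move=> f0 mf; elim: ks => [|k ks IH] //=.
by apply: measurable_E1 => // c; apply: Es_ge0.
Qed.

Lemma Es_cat ks ls f c : Es (ks ++ ls) f c = Es ks (Es ls f) c.
Proof.
elim: ks c => [|k ks IH] c //=; rewrite /E1; apply: eq_integral => x _; exact: IH.
Qed.

Lemma le_E1 k (f g : coords -> \bar R) c : (forall c, 0 <= f c)%E -> (forall c, 0 <= g c)%E ->
  measurable_fun setT f -> measurable_fun setT g ->
  (forall c, f c <= g c)%E -> (E1 k f c <= E1 k g c)%E.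
Proof.
move=> f0 g0 mf mg fg; apply: ge0_le_integral => //; exact: measurable_upd_section.
Qed.

Lemma le_Es ks (f g : coords -> \bar R) c : (forall c, 0 <= f c)%E -> (forall c, 0 <= g c)%E ->
  measurable_fun setT f -> measurable_fun setT g ->
  (forall c, f c <= g c)%E -> (Es ks f c <= Es ks g c)%E.
Proof.
move=> f0 g0 mf mg fg; elim: ks c => [|k ks IH] c //=.
by apply: le_E1 => // *; rewrite ?Es_ge0 //; apply: measurable_Es.
Qed.

Lemma Es_ext ks f g c : (forall c, f c = g c) -> Es ks f c = Es ks g c.
Proof. by move=> h; congr (Es ks _ c); apply/funext. Qed.

Lemma Es_swap k ks f c : (forall c, 0 <= f c)%E -> measurable_fun setT (f : coords -> _) ->
  k \notin ks -> E1 k (Es ks f) c = Es ks (E1 k f) c.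
Proof.
move=> f0 mf; elim: ks c => [|j ks IH] c //=; rewrite inE negb_or => /andP[kj kks].
rewrite E1_comm //; first by rewrite /E1; apply: eq_integral => x _; apply: IH.
  by move=> ?; apply: Es_ge0.
exact: measurable_Es.
Qed.

Lemma Es_perm ks ls f c : (forall c, 0 <= f c)%E -> measurable_fun setT (f : coords -> _) ->
  uniq ks -> perm_eq ks ls -> Es ks f c = Es ls f c.
Proof.
move=> f0 mf; elim: ks ls c => [|k ks IH] ls c /=.
  by move=> _; rewrite perm_sym => /perm_nilP ->.
move=> /andP[kks uks] pe.
have kl : k \in ls by rewrite -(perm_mem pe) inE eqxx.
case/splitPr: ls / kl pe => l1 l2 pe.
have pe' : perm_eq ks (l1 ++ l2).
  by rewrite -(perm_cons k) (permPl pe) perm_catC /= perm_cons perm_catC.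
have nk : k \notin l1 by apply: contra kks => h; rewrite (perm_mem pe') mem_cat h.
rewrite Es_cat /= -(@Es_swap k l1 (Es l2 f) c _ _ nk); first last.
- exact: measurable_Es.
- by move=> ?; apply: Es_ge0.
rewrite /E1; apply: eq_integral => x _.
by rewrite (IH _ _ uks pe') Es_cat.
Qed.

Lemma itint_Es N f : itint N f = Es (iota 0 N) f (fun _ => 0).
Proof.
(* The parameter m is the first coordinate integrated: [Es] overwrites entries m to m + N - 1 of c,
   whereas [itint] reads a fresh sequence d there. *)
have gen : forall N m (f : (nat -> R) -> \bar R) (c : nat -> R),
    Es (iota m N) f c = itint N (fun d => f (fun k => if (k < m)%N then c k
       else if (k < m + N)%N then d (k - m)%N else c k)).
  elim => [|N' IH] m g c /=.
    congr g; apply/funext => k; rewrite addn0; by case: ifP => // ->.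
  rewrite /E1; apply: eq_integral => x _; rewrite IH; congr (itint N' _).
  apply/funext => d; congr g; apply/funext => k; rewrite /upd.
  rewrite ltnS leq_eqVlt; case: (eqVneq k m) => [->|km] /=.
    by rewrite ltnn addnS ltnS leq_addr subnn.
  rewrite addSnnS; case: ltnP => // mk.
  by have -> : (k - m)%N = (k - m.+1).+1 by rewrite subnS prednK // subn_gt0 ltn_neqAle eq_sym km.
(* What remains is that [itint N] feeds sequences that already vanish from N on, so cutting them off
   there changes nothing. *)
rewrite gen; elim: N f => [//|N' IH] g /=.
apply: eq_integral => x _; rewrite [LHS]IH.
congr (itint N' _); apply/funext => d; congr g; apply/funext => -[|k] //=.
by rewrite !add0n !subn0 ltnS.
Qed.
End CoordSpace.

Section CoordSpace2.
Variable R : realType.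
Local Notation leb := (@lebesgue_measure R).
Local Notation coords := (coords R).

Lemma measurable_Es_param d (T : measurableType d) ks (f : T * coords -> \bar R) :
  (forall c, 0 <= f c)%E -> measurable_fun setT f ->
  measurable_fun setT (fun p : T * coords => Es ks (fun c => f (p.1, c)) p.2).
Proof.
move=> f0 mf; elim: ks => [|k ks IH] /=.
  by apply: (eq_measurable_fun f) => // -[].
pose g (p : T * coords) := Es ks (fun c => f (p.1, c)) p.2.
have g0 p : (0 <= g p)%E by apply: Es_ge0.
exact: (measurable_E1_param k g0 IH).
Qed.

Lemma measurable_pairl d1 d2 (T1 : measurableType d1) (T2 : measurableType d2)
    (f : T1 * T2 -> \bar R) y : measurable_fun setT f -> measurable_fun setT (fun x => f (x, y)).
Proof. by move=> mf; apply: (measurableT_comp mf); exact: pair2_measurable. Qed.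

Lemma E1_E1_pair k l (f : coords * coords -> \bar R) c y :
  (forall c, 0 <= f c)%E -> measurable_fun setT f ->
  E1 k (fun c => E1 l (fun y => f (c, y)) y) c = E1 l (fun y => E1 k (fun c => f (c, y)) c) y.
Proof.
move=> f0 mf; rewrite /E1.
pose F (p : R * R) := f (upd c k p.1 : coords, upd y l p.2 : coords).
have mF : measurable_fun setT F.
  apply: (measurableT_comp mf); apply/measurable_fun_pairP; split => /=;
    by apply: measurable_upd => //; exact: measurable_cst.
exact: (@fubini_tonelli _ _ _ _ R leb leb F mF (fun _ => f0 _)).
Qed.

Lemma E1_Es_pair k ls (f : coords * coords -> \bar R) c y :
  (forall c, 0 <= f c)%E -> measurable_fun setT f ->
  E1 k (fun c => Es ls (fun y => f (c, y)) y) c = Es ls (fun y => E1 k (fun c => f (c, y)) c) y.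
Proof.
move=> f0 mf; elim: ls y => [|l ls IH] y //=.
pose g (p : coords * coords) := Es ls (fun y => f (p.1, y)) p.2.
have g0 p : (0 <= g p)%E by apply: Es_ge0.
rewrite (E1_E1_pair k l c y g0 (measurable_Es_param ls f0 mf)) /g /=.
by congr (E1 l _ y); apply/funext => z; rewrite IH.
Qed.

(** Tonelli for two independent sequences: the uniqueness argument integrates over a point and over
    a translation at once. *)
Lemma Es_Es_pair ks ls (f : coords * coords -> \bar R) c y :
  (forall c, 0 <= f c)%E -> measurable_fun setT f ->
  Es ks (fun c => Es ls (fun y => f (c, y)) y) c = Es ls (fun y => Es ks (fun c => f (c, y)) c) y.
Proof.
move=> f0 mf; elim: ks c => [|k ks IH] c //=.
pose sw (p : coords * coords) := (p.2, p.1).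
have msw : measurable_fun setT sw.
  by apply/measurable_fun_pairP; split => /=; [exact: measurable_snd|exact: measurable_fst].
pose g (p : coords * coords) := Es ks (fun c => f (c, p.2)) p.1.
have g0 p : (0 <= g p)%E by apply: Es_ge0.
have mg : measurable_fun setT g.
  have h := @measurable_Es_param _ coords ks (f \o sw) (fun _ => f0 _) (measurableT_comp mf msw).
  exact: (measurableT_comp h msw).
rewrite -(E1_Es_pair k ls c y g0 mg) /g /=.
by congr (E1 k _ c); apply/funext => z; rewrite IH.
Qed.

Lemma EsZl ks (k : \bar R) (f : coords -> \bar R) c : (0 <= k)%E ->
  (forall c, 0 <= f c)%E -> measurable_fun setT f ->
  Es ks (fun c => k * f c)%E c = (k * Es ks f c)%E.
Proof.
move=> k0 f0 mf; elim: ks c => [|j ks IH] c //=.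
rewrite /E1 -ge0_integralZl //.
- by apply: eq_integral => x _; rewrite IH.
- apply: measurable_upd_section; exact: measurable_Es.
- by move=> *; apply: Es_ge0.
Qed.

Definition cadd (c h : nat -> R) : nat -> R := fun k => c k + h k.

Lemma Es_shift ks (f : coords -> \bar R) (c h : nat -> R) :
  (forall c, 0 <= f c)%E -> measurable_fun setT f ->
  Es ks (fun c => f (cadd c h)) c = Es ks f (cadd c h).
Proof.
move=> f0 mf; elim: ks c => [|k ks IH] c //=; rewrite /E1.
under eq_integral do rewrite IH.
rewrite -(@ge0_integral_shift R (h k) (fun x => Es ks f (upd (cadd c h) k x))).
- apply: eq_integral => x _; congr (Es ks f); apply/funext => j; rewrite /cadd /upd.
  by case: eqP => // ->.
- apply: measurable_upd_section; exact: measurable_Es.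
- by move=> x; apply: Es_ge0.
Qed.

Lemma Es_agree ks (f : coords -> \bar R) c c' : (forall k, k \notin ks -> c k = c' k) ->
  Es ks f c = Es ks f c'.
Proof.
elim: ks c c' => [|k ks IH] c c' h /=; first by congr f; apply/funext => k; apply: h.
rewrite /E1; apply: eq_integral => x _; apply: IH => j jks; rewrite /upd.
case: (eqVneq j k) => // jk; apply: h; by rewrite inE negb_or jk.
Qed.

(** [itint N] keeps the coordinates from N on at 0, while a translation moves them too; functions
    that ignore them do not notice. *)
Definition finitary (N : nat) T (f : coords -> T) :=
  forall c c' : nat -> R, (forall k, (k < N)%N -> c k = c' k) -> f c = f c'.

Lemma itint_shift N (f : coords -> \bar R) h :
  (forall c, 0 <= f c)%E -> measurable_fun setT f -> finitary N f ->
  itint N (fun c => f (cadd c h)) = itint N f.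
Proof.
move=> f0 mf fN; rewrite !itint_Es.
pose h' k := if (k < N)%N then h k else 0.
rewrite (@Es_ext _ _ _ (fun c => f (cadd c h'))); last first.
  by move=> c; apply: fN => k kN; rewrite /cadd /h' kN.
rewrite Es_shift //; apply: Es_agree => k.
by rewrite mem_iota add0n /= /cadd /h' => /negbTE ->; rewrite addr0.
Qed.

Lemma measurable_cadd d (T : measurableType d) (f g : T -> coords) :
  measurable_fun setT f -> measurable_fun setT g ->
  measurable_fun setT (fun t => cadd (f t) (g t) : coords).
Proof.
move=> mf mg; apply: measurable_to_coords => k; rewrite /cadd.
by apply: measurable_funD; apply: (measurableT_comp (@measurable_coord R k)).
Qed.

Definition copp (c : nat -> R) : nat -> R := fun k => - c k.

Lemma measurable_copp d (T : measurableType d) (f : T -> coords) :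
  measurable_fun setT f -> measurable_fun setT (fun t => copp (f t) : coords).
Proof.
move=> mf; apply: measurable_to_coords => k; rewrite /copp.
by apply: measurable_funN; apply: (measurableT_comp (@measurable_coord R k)).
Qed.

(* Uniqueness of translation-invariant measures: both sides equal the double integral of
   [f (L c) * g (L c + y)] over [c] and [y]. *)
Lemma itint_linear_mul N (L : coords -> coords) (f g : coords -> \bar R) :
  measurable_fun setT L ->
  (forall k, (k < N)%N -> forall c d, L (cadd c d) k = L c k + L d k) ->
  (forall h, exists d, forall k, (k < N)%N -> L d k = h k) ->
  (forall c, 0 <= f c)%E -> measurable_fun setT f -> finitary N f ->
  (forall c, 0 <= g c)%E -> measurable_fun setT g -> finitary N g ->
  (forall c, f (copp c) = f c) -> (forall k, (k < N)%N -> finitary N (L^~ k)) ->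
  (itint N (f \o L) * itint N g = itint N (g \o L) * itint N f)%E.
Proof.
move=> mL Ladd Lsurj f0 mf fN g0 mg gN fs LN.
have mfL : measurable_fun setT (f \o L) by exact: measurableT_comp.
have mgL : measurable_fun setT (g \o L) by exact: measurableT_comp.
pose F (p : coords * coords) := (f (L p.1) * g (cadd (L p.1) p.2))%E.
pose G (p : coords * coords) := (g (L p.1) * f (cadd (L p.1) (copp p.2)))%E.
have F0 p : (0 <= F p)%E by apply: mule_ge0.
have G0 p : (0 <= G p)%E by apply: mule_ge0.
have mL1 : measurable_fun setT (fun p : coords * coords => L p.1) by apply: (measurableT_comp mL).
have mF : measurable_fun setT F.
  apply: emeasurable_funM; first exact: (measurableT_comp mf).
  by apply: (measurableT_comp mg); apply: measurable_cadd.
have mG : measurable_fun setT G.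
  apply: emeasurable_funM; first exact: (measurableT_comp mg).
  by apply: (measurableT_comp mf); apply: measurable_cadd => //; apply: measurable_copp.
have sectF c : itint N (fun y => F (c, y)) = (f (L c) * itint N g)%E.
  rewrite -(@itint_shift N g (L c)) // !itint_Es -EsZl //; last first.
    by apply: (measurableT_comp mg); apply: measurable_cadd => //; exact: measurable_cst.
  apply: Es_ext => y; congr (_ * g _)%E; apply/funext => k; exact: addrC.
have sectG c : itint N (fun y => G (c, y)) = (g (L c) * itint N f)%E.
  rewrite -(@itint_shift N f (copp (L c))) // !itint_Es -EsZl //; last first.
    by apply: (measurableT_comp mf); apply: measurable_cadd => //; exact: measurable_cst.
  apply: Es_ext => y; congr (_ * _)%E; rewrite -fs; congr f; apply/funext => k.
  by rewrite /cadd /copp /= opprD opprK addrC.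
(* Translating c by some d with L d = -y turns f (L c) g (L c + y) into f (L c - y) g (L c). This is
   the only place where surjectivity of L enters. *)
have sectFG y : itint N (fun c => F (c, y)) = itint N (fun c => G (c, y)).
  have [d dy] := Lsurj (copp y).
  have LN' c c' : (forall k, (k < N)%N -> c k = c' k) -> forall k, (k < N)%N -> L c k = L c' k.
    by move=> cc' k kN; apply: LN kN _ _ cc'.
  rewrite -(@itint_shift N (fun c => F (c, y)) d) //; last 2 first.
  - exact: measurable_pairl.
  - move=> c c' cc'; rewrite /F /=; congr (_ * _)%E; first by apply: fN; apply: LN'.
    by apply: gN => k kN; rewrite /cadd (LN' _ _ cc').
  congr (itint N _); apply/funext => c; rewrite /F /G /= muleC; congr (_ * _)%E.
    by apply: gN => k kN; rewrite {1}/cadd Ladd // dy // /copp subrK.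
  by apply: fN => k kN; rewrite Ladd // dy.
transitivity (itint N (fun c => itint N (fun y => F (c, y)))).
  rewrite (_ : (fun c => _) = fun c => (itint N g * (f \o L) c)%E); last first.
    by apply/funext => c; rewrite sectF muleC.
  rewrite [RHS]itint_Es EsZl; [by rewrite -itint_Es muleC| |by move=> ? /=|exact: mfL].
  by rewrite itint_Es; exact: Es_ge0.
transitivity (itint N (fun c => itint N (fun y => G (c, y)))); last first.
  rewrite (_ : (fun c => _) = fun c => (itint N f * (g \o L) c)%E); last first.
    by apply/funext => c; rewrite sectG muleC.
  rewrite [LHS]itint_Es EsZl; [by rewrite -itint_Es muleC| |by move=> ? /=|exact: mgL].
  by rewrite itint_Es; exact: Es_ge0.
have tonelli (H : coords * coords -> \bar R) : (forall p, 0 <= H p)%E -> measurable_fun setT H ->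
    itint N (fun c => itint N (fun y => H (c, y))) = itint N (fun y => itint N (fun c => H (c, y))).
  move=> H0 mH; rewrite [LHS]itint_Es [RHS]itint_Es.
  under Es_ext do rewrite itint_Es.
  rewrite Es_Es_pair //; apply: Es_ext => y; by rewrite itint_Es.
rewrite !tonelli //; congr (itint N _); apply/funext => y; exact: sectFG.
Qed.

Lemma measurable_E1_signed k (f : coords -> \bar R) :
  measurable_fun setT f -> measurable_fun setT (E1 k f : coords -> _).
Proof.
move=> mf; rewrite (_ : E1 k f = (E1 k (f ^\+)%E \- E1 k (f ^\-)%E)%E); last first.
  apply/funext => c; rewrite /E1 integralE.
  by congr (_ - _)%E; apply: eq_integral => x _; rewrite ?funeposE ?funenegE.
apply: emeasurable_funB; apply: measurable_E1 => //.
- exact: measurable_funepos.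
- exact: measurable_funeneg.
Qed.

Lemma measurable_Es_signed ks (f : coords -> \bar R) :
  measurable_fun setT f -> measurable_fun setT (Es ks f : coords -> _).
Proof. by move=> mf; elim: ks => [|k ks IH] //=; apply: measurable_E1_signed. Qed.

(** Inner integrals may be infinite at some points, where the difference formula can fail. Absolute
    integrability makes them finite almost everywhere at each level, which is enough for the next
    integral. *)
Lemma Es_posneg ks (f : coords -> \bar R) c : measurable_fun setT f ->
  (Es ks (fun c => `|f c|) c < +oo)%E ->
  Es ks f c = (Es ks (f ^\+)%E c - Es ks (f ^\-)%E c)%E.
Proof.
move=> mf.
have mp : measurable_fun setT (f ^\+)%E by exact: measurable_funepos.
have mn : measurable_fun setT (f ^\-)%E by exact: measurable_funeneg.
have ma : measurable_fun setT (fun c : coords => `|f c|)%E by exact: measurableT_comp.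
elim: ks c => [|k ks IH] c /=; first by move=> _; rewrite {1}(funeposneg f).
rewrite /E1 => fin.
have i0 : leb.-integrable setT (fun x : R => Es ks (fun c => `|f c|)%E (upd c k x)).
  apply/integrableP; split; first by apply: measurable_upd_section; apply: measurable_Es.
  apply: le_lt_trans fin; rewrite le_eqVlt; apply/orP; left; apply/eqP.
  by apply: eq_integral => x _; rewrite gee0_abs //; apply: Es_ge0.
have ip : leb.-integrable setT (fun x : R => Es ks (f ^\+)%E (upd c k x)).
  apply: le_integrable i0 => //; first by apply: measurable_upd_section; apply: measurable_Es.
  move=> x _; rewrite !gee0_abs ?Es_ge0 //; apply: le_Es => // d.
  by rewrite -/((abse \o f) d) fune_abse leeDl.
have im : leb.-integrable setT (fun x : R => Es ks (f ^\-)%E (upd c k x)).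
  apply: le_integrable i0 => //; first by apply: measurable_upd_section; apply: measurable_Es.
  move=> x _; rewrite !gee0_abs ?Es_ge0 //; apply: le_Es => // d.
  by rewrite -/((abse \o f) d) fune_abse leeDr.
rewrite -integralB //.
apply: ae_eq_integral => //.
- by apply: measurable_upd_section; apply: measurable_Es_signed.
- by apply: emeasurable_funB; apply: measurable_upd_section; apply: measurable_Es.
have := integrable_ae measurableT i0.
apply: filterS => x /= h _; rewrite IH //.
by have := h I; rewrite ge0_fin_numE // Es_ge0.
Qed.
End CoordSpace2.

Section CoordTopology.
Variable R : realType.
Local Notation leb := (@lebesgue_measure R).
Local Notation coords := (coords R).

Definition cclose (N : nat) (e : R) (c c' : nat -> R) : Prop :=
  forall k, (k < N)%N -> `|c' k - c k| < e.

Lemma measurable_close N e c : measurable (cclose N e c : set coords).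
Proof.
elim: N => [|N IH].
  rewrite (_ : cclose 0 e c = setT) //; by apply/seteqP; split.
rewrite (_ : cclose N.+1 e c = cclose N e c `&` [set c' : coords | `|c' N - c N| < e]).
  apply: measurableI => //.
  rewrite -[X in measurable X]setTI.
  have mf : measurable_fun setT (fun c' : coords => `|c' N - c N|).
    apply: measurableT_comp => //; apply: measurable_funB => //; exact: measurable_coord.
  rewrite (_ : [set c' : coords | `|c' N - c N| < e] = (fun c' : coords => `|c' N - c N|) @^-1` `]-oo, e[).
    by apply: mf => //; exact: measurable_itv.
  by apply/seteqP; split=> x /=; rewrite in_itv.
apply/seteqP; split=> x /=.
  by move=> h; split; [move=> k kN; apply: h; apply: leqW | apply: h].
move=> [h1 h2] k; rewrite ltnS leq_eqVlt => /orP[/eqP ->//|]; exact: h1.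
Qed.

Definition opencoords (N : nat) (U : set coords) : Prop :=
  forall c, U c -> exists2 e : R, 0 < e & cclose N e c `<=` U.

(** An open set is a countable union of boxes with rational centres and radii 1/(n+1). [pickle]
    enumerates them, and boxes that leave U are replaced by the empty set. *)
Lemma measurable_opencoords N (U : set coords) : opencoords N U -> measurable U.
Proof.
move=> oU.
pose bx (p : seq rat * nat) : set coords := cclose N (p.2.+1%:R^-1) (fun k => ratr p.1`_k).
pose F (m : nat) : set coords :=
  if unpickle m is Some p then (if `[< bx p `<=` U >] then bx p else set0) else set0.
have -> : U = \bigcup_m F m.
  apply/seteqP; split => c; last first.
    move=> [m _]; rewrite /F; case: (unpickle m) => // p; case: asboolP => // h; exact: h.
  move=> Uc; have [e e0 he] := oU c Uc.
  (* Then 1/(n+1) < e/2, so a box of this radius that contains c stays within e of c. *)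
  pose n := Num.truncn (2 / e).
  have n0 : 0 < (n.+1%:R : R) by rewrite ltr0n.
  have ne : n.+1%:R^-1 < e / 2.
    have := truncnS_gt (2 / e); rewrite -/n => h.
    by rewrite -[X in _ < X]invrK ltf_pV2 ?posrE ?invr_gt0 ?divr_gt0 // invf_div.
  have rk k : exists s : rat, `|c k - ratr s| < n.+1%:R^-1.
    have lt : c k - n.+1%:R^-1 < c k + n.+1%:R^-1.
      by rewrite ltrBlDr -addrA ltrDl addr_gt0 ?invr_gt0.
    have [s] := rat_in_itvoo lt; rewrite in_itv /= => /andP[h1 h2].
    by exists s; rewrite distrC ltr_distl h1 h2.
  pose s := mkseq (fun k => projT1 (cid (rk k))) N.
  have bc : bx (s, n) c.
    by move=> k kN /=; rewrite /s nth_mkseq //; case: (cid (rk k)).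
  exists (pickle (s, n)) => //; rewrite /F pickleK asboolT //.
  move=> c' bc'; apply: he => k kN.
  have := bc k kN; have := bc' k kN => /=; move: (ratr _) => z h1 h2.
  apply: le_lt_trans (ler_distD z _ _) _; rewrite (distrC z).
  by apply: lt_trans (ltrD h1 h2) _; rewrite [ltRHS]splitr ltrD.
apply: bigcupT_measurable => m; rewrite /F; case: (unpickle m) => // p.
case: asboolP => // _; exact: measurable_close.
Qed.

Lemma measurable_on_open N (D : set coords) (h : coords -> R) : opencoords N D ->
  (forall c, D c -> forall e, 0 < e -> exists2 d : R, 0 < d &
      forall c', cclose N d c c' -> D c' -> `|h c' - h c| < e) ->
  measurable_fun setT (fun c : coords => if `[< D c >] then h c else 0).
Proof.
move=> oD ch.
apply: (measurability _ (RGenOInfty.measurableE R)) => _ [_ [a ->] <-].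
rewrite setTI.
have mS : measurable [set c | D c /\ a < h c].
  apply: (@measurable_opencoords N) => c [Dc ac].
  have [e e0 he] := oD c Dc.
  have ah : 0 < h c - a by rewrite subr_gt0.
  have [d d0 hd] := ch c Dc _ ah.
  exists (Num.min e d); first by rewrite lt_min e0.
  move=> c' cc'; have Dc' : D c'.
    by apply: he => k kN; apply: lt_le_trans (cc' k kN) _; rewrite ge_min lexx.
  split => //; have := hd c' _ Dc'.
  have : cclose N d c c' by move=> k kN; apply: lt_le_trans (cc' k kN) _; rewrite ge_min lexx orbT.
  move=> cl /(_ cl); rewrite ltr_distl => /andP[h1 _]; lra.
(* For negative a the preimage also contains the complement of D, where the function has the value
   0. *)
case: (ltrP a 0) => a0.
  rewrite (_ : _ @^-1` _ = [set c | D c /\ a < h c] `|` ~` D).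
    by apply: measurableU => //; apply: measurableC; exact: measurable_opencoords oD.
  apply/seteqP; split=> c /=; rewrite in_itv /= andbT; case: asboolP => Dc.
  - by left. - by right. - by case=> [[]|]. - by [].
rewrite (_ : _ @^-1` _ = [set c | D c /\ a < h c]) //.
apply/seteqP; split=> c /=; rewrite in_itv /= andbT; case: asboolP => Dc //.
- by move=> h'; move: (lt_le_trans h' a0); rewrite ltxx.
- by case.
- by case.
Qed.

(** Each integral is cut down to the interval of radius r about [c0 k]; the argument then ends up in
    the cube on which F is at least d. *)
Lemma Es_lower N ks (F : coords -> \bar R) (c0 c : nat -> R) (r d : R) : 0 < r -> 0 < d ->
  (forall c, 0 <= F c)%E -> measurable_fun setT F ->
  (forall c, cclose N r c0 c -> d%:E <= F c)%E ->
  (forall k, (k < N)%N -> k \notin ks -> `|c k - c0 k| < r) ->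
  ((d * (r + r) ^+ size ks)%:E <= Es ks F c)%E.
Proof.
move=> r0 d0 F0 mF hF; elim: ks c => [|k ks IH] c hc.
  by rewrite expr0 mulr1; apply: hF => k kN; apply: hc.
rewrite /= /E1.
pose A := `]c0 k - r, c0 k + r[%classic : set (measurableTypeR R).
have mA : measurable A by exact: measurable_itv.
have mE : measurable_fun setT (fun x : R => Es ks F (upd c k x)).
  by apply: measurable_upd_section; apply: measurable_Es.
apply: le_trans (_ : \int[leb]_(x in A) Es ks F (upd c k x) <= _)%E; last first.
  by apply: ge0_subset_integral => // x _; apply: Es_ge0.
apply: le_trans (_ : \int[leb]_(x in A) (d * (r + r) ^+ size ks)%:E <= _)%E; last first.
  apply: ge0_le_integral => //.
  - by move=> x _; rewrite lee_fin mulr_ge0 ?exprn_ge0 ?addr_ge0 // ltW.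
  - by apply: measurable_funS mE.
  move=> x; rewrite /A /= in_itv /= => /andP[h1 h2]; apply: IH => j jN jks; rewrite /upd.
  case: (eqVneq j k) => [->|jk]; first by rewrite ltr_distl h1 h2.
  by apply: hc => //; rewrite inE negb_or jk.
have hA : leb A = (r + r)%:E.
  rewrite /A lebesgue_measure_itv /= lte_fin.
  have -> : c0 k - r < c0 k + r by lra.
  by rewrite -EFinB; congr (_%:E); ring.
rewrite integral_cst // [X in (_ * X)%E](_ : _ = (r + r)%:E) //.
by rewrite -EFinM lee_fin exprSr mulrA.
Qed.

Lemma itint_gt0 N (F : coords -> \bar R) (c0 : nat -> R) (r d : R) : 0 < r -> 0 < d ->
  (forall c, 0 <= F c)%E -> measurable_fun setT F ->
  (forall c, cclose N r c0 c -> d%:E <= F c)%E -> (0 < itint N F)%E.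
Proof.
move=> r0 d0 F0 mF hF; rewrite itint_Es.
have h : (forall k, (k < N)%N -> k \notin iota 0 N -> `|(fun=> 0) k - c0 k| < r).
  by move=> k kN; rewrite mem_iota kN.
apply: lt_le_trans (Es_lower r0 d0 F0 mF hF h).
by rewrite lte_fin mulr_gt0 ?exprn_gt0 ?addr_gt0.
Qed.
End CoordTopology.

(** * Integrals of powers with an integrable singularity *)

Section PowerIntegral.
Variable R : realType.
Local Notation leb := (@lebesgue_measure R).

Lemma ge0_integral_reflect (f : R -> \bar R) :
  measurable_fun [set: R] f -> (forall r, 0 <= f r)%E ->
  (\int[leb]_(x in [set: R]) f (- x)%R = \int[leb]_(x in [set: R]) f x)%E.
Proof.
move=> mf f0.
pose sh : measurableTypeR R -> measurableTypeR R := fun x : R => - x.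
have ms : measurable_fun setT sh by apply: measurable_funN.
rewrite [LHS](_ : _ = \int[leb]_(x in sh @^-1` setT) (f \o sh) x)%E //.
rewrite -ge0_integral_pushforward//=.
apply: eq_measure_integral => //= A mA AS.
exact: lebesgue_measureN.
Qed.

Lemma integral_powR_itvcc (p e w : R) : -1 < p -> 0 < e -> e < w ->
  (\int[leb]_(x in `[e, w]) (x `^ p)%:E <= (w `^ (p + 1) / (p + 1))%:E)%E.
Proof.
move=> p1 e0 ew.
have p10 : p + 1 != 0 by rewrite gt_eqF // -ltrBlDr sub0r.
have p1p : 0 < p + 1 by lra.
have dF (x : R) : 0 < x -> is_derive x 1 (fun x : R => (p + 1)^-1 * x `^ (p + 1)) (x `^ p).
  move=> x0; have h := is_derive1_powR (p + 1) x0.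
  have h2 := @is_deriveZ _ _ _ _ (p + 1)^-1 _ _ _ h.
  apply: (is_derive_eq h2).
  by rewrite /GRing.scale /= mulrA mulVf // mul1r addrK.
have cF (x : R) : 0 < x -> {for x, continuous (fun x : R => (p + 1)^-1 * x `^ (p + 1))}.
  move=> x0; apply: differentiable_continuous; apply/derivable1_diffP.
  by have [] := dF x x0.
rewrite (@continuous_FTC2 R (fun x => x `^ p) (fun x => (p + 1)^-1 * x `^ (p + 1))) //.
- rewrite -EFinB lee_fin mulrC lerBlDr lerDl mulr_ge0 ?powR_ge0 //.
  by rewrite invr_ge0 ltW.
- apply: derivable_within_continuous => x; rewrite in_itv /= => /andP[h _].
  by have [] := is_derive1_powR p (lt_le_trans e0 h).
- split.
  + move=> x; rewrite in_itv /= => /andP[h _].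
    by have [] := dF x (lt_trans e0 h).
  + exact: cvg_at_right_filter (cF _ e0).
  + apply: cvg_at_left_filter (cF _ _); exact: lt_trans ew.
- move=> x; rewrite in_itv /= => /andP[h _].
  by rewrite derive1E; have [] := dF x (lt_trans e0 h).
Qed.

Lemma integral_powR_itvoc (p w : R) : -1 < p -> 0 < w ->
  (\int[leb]_(x in `]0%R, w]) (x `^ p)%:E <= (w `^ (p + 1) / (p + 1))%:E)%E.
Proof.
move=> p1 w0.
(* The denominator n + 2 keeps the left end strictly below w already for n = 0. *)
pose F (n : nat) : set (measurableTypeR R) := `[w / n.+2%:R, w]%classic.
have mF n : measurable (F n) by exact: measurable_itv.
have FU : `]0%R, w]%classic = \bigcup_n F n.
  apply/seteqP; split => x /=.
    rewrite in_itv /= => /andP[x0 xw].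
    exists (Num.truncn (w / x)) => //; rewrite /F /= in_itv /= xw andbT.
    rewrite ler_pdivrMr ?ltr0n // mulrC -ler_pdivrMr //.
    by apply/ltW/(lt_trans (truncnS_gt _)); rewrite ltr_nat.
  move=> [n _]; rewrite /F /= !in_itv /= => /andP[h ->]; rewrite andbT.
  by apply: lt_le_trans h; rewrite divr_gt0 // ltr0n.
have mf : measurable_fun setT (fun x : measurableTypeR R => (x `^ p)%:E).
  by apply/measurable_EFinP; exact: measurable_powR.
have h := @ge0_nondecreasing_set_cvg_integral _ _ R F (fun x => (x `^ p)%:E) leb.
have nnd : nondecreasing_seq F.
  apply/nondecreasing_seqP => n; rewrite subsetEset => x; rewrite /F /= !in_itv /= => /andP[hx ->].
  rewrite andbT; apply: le_trans hx.
  by rewrite ler_pM2l // lef_pV2 ?posrE ?ltr0n // ler_nat.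
have f0 : forall i x, F i x -> (0 <= (x `^ p)%:E)%E by move=> n x _; rewrite lee_fin powR_ge0.
have {}h := h nnd mF (fun i => measurable_funS measurableT (@subsetT _ _) mf) f0.
rewrite FU -(cvg_lim _ h) //.
apply: lime_le; first by apply/cvg_ex; eexists; exact: h.
apply: nearW => n; apply: integral_powR_itvcc => //.
  by rewrite divr_gt0 // ltr0n.
by rewrite ltr_pdivrMr ?ltr0n // ltr_pMr // ltr1n.
Qed.

(** The cut at 0 lets a power of s - x^2 be integrated over the whole line while only the interval
    x^2 < s counts. *)
Definition pospow (p u : R) : R := if 0 < u then u `^ p else 0.

Lemma pospow_ge0 p u : 0 <= pospow p u.
Proof. by rewrite /pospow; case: ifP => // _; exact: powR_ge0. Qed.

Lemma measurable_pospow p : measurable_fun setT (pospow p).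
Proof.
apply: (@measurable_fun_ifT _ _ _ _ (@powR R ^~ p) (fun=> 0) (fun u : R => 0 < u)) => //.
exact: measurable_fun_ltr.
Qed.

Lemma powR_le_neg (p x y : R) : p <= 0 -> 0 < x -> x <= y -> y `^ p <= x `^ p.
Proof.
move=> p0 x0 xy; rewrite -[p]opprK !(powRN _ (- p)).
rewrite lef_pV2 ?posrE ?powR_gt0 //; last exact: lt_le_trans xy.
by apply: ge0_ler_powR; rewrite ?nnegrE ?oppr_ge0 // ltW // (lt_le_trans x0).
Qed.

(** Put a = sqrt s. For p >= 0 the integrand is at most s^p on an interval of length 2a. For p < 0
    factor s - x^2 = (a + x)(a - x): the factor not near its zero is at least a, so its power is at
    most a^p, and the other factor has an integrable singularity because p > -1. *)
Lemma integral_pospow_disc (p : R) : -1 < p -> exists2 K : R, 0 <= K & forall s x0 : R, 0 < s ->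
  (\int[leb]_(x in [set: R]) (pospow p (s - (x - x0) ^+ 2))%:E <= (K * s `^ (p + 2^-1))%:E)%E.
Proof.
move=> p1.
have mq (s : R) : measurable_fun setT (fun x : R => (pospow p (s - x ^+ 2))%:E).
  apply/measurable_EFinP; apply: (measurableT_comp (measurable_pospow p)).
  by apply: measurable_funB => //; apply: measurable_funX.
have shift (s x0 : R) : (\int[leb]_(x in [set: R]) (pospow p (s - (x - x0)%R ^+ 2))%:E =
     \int[leb]_(x in [set: R]) (pospow p (s - x ^+ 2))%:E)%E.
  apply: (@ge0_integral_shift R (- x0) (fun x : R => (pospow p (s - x ^+ 2))%:E)) => //.
  by move=> x; rewrite lee_fin pospow_ge0.
have sq (s : R) : 0 < s -> (Num.sqrt s) ^+ 2 = s by move=> s0; rewrite sqr_sqrtr // ltW.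
have absq (s x : R) : 0 < s -> (0 < s - x ^+ 2) = (`|x| < Num.sqrt s).
  move=> s0; rewrite subr_gt0 -{1}(sq s s0) -(real_normK (num_real x)).
  by rewrite ltr_pXn2r ?nnegrE ?sqrtr_ge0.
have [p0|p0] := lerP 0 p.
  exists 2; first by [].
  move=> s x0 s0; rewrite shift.
  set a := Num.sqrt s; have a0 : 0 < a by rewrite sqrtr_gt0.
  apply: le_trans (_ : \int[leb]_(x in `](- a)%R, a[) (s `^ p)%:E <= _)%E.
    rewrite [leRHS]integral_mkcond; apply: ge0_le_integral => //.
    - by move=> x _; rewrite lee_fin pospow_ge0.
    - exact: mq.
    - have mA : measurable (`](- a), a[%classic : set (measurableTypeR R)) by exact: measurable_itv.
      by apply: (measurable_restrictT (fun=> (s `^ p)%:E) mA).1; exact: measurable_cst.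
    move=> x _; rewrite patchE mem_setE in_itv /= -ltr_norml -absq //.
    rewrite /pospow; case: ifP => // h; rewrite lee_fin.
    apply: ge0_ler_powR => //; rewrite ?nnegrE; [exact: ltW|exact: ltW|].
    by rewrite lerBlDr lerDl sqr_ge0.
  have hA : leb `](- a), a[%classic = (a + a)%:E.
    rewrite lebesgue_measure_itv /= lte_fin.
    have -> : - a < a by lra.
    by rewrite -EFinB opprK.
  rewrite integral_cst // [X in (_ * X)%E](_ : _ = (a + a)%:E) //.
  rewrite -EFinM lee_fin powRD; last by apply/implyP => _; rewrite gt_eqF.
  by rewrite (powR12_sqrt (ltW s0)) -/a le_eqVlt; apply/orP; left; apply/eqP; ring.
(* Each of the two endpoints contributes the integral of t^p over ]0, 2a], at most (2a)^(p+1) /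
   (p+1), and a^p a^(p+1) = s^(p+1/2). *)
pose K := 2 * (2 `^ (p + 1) / (p + 1)).
have p1p : 0 < p + 1 by lra.
exists K; first by rewrite /K mulr_ge0 // divr_ge0 ?powR_ge0 ?ltW.
move=> s x0 s0; rewrite shift.
set a := Num.sqrt s; have a0 : 0 < a by rewrite sqrtr_gt0.
pose phi (t : R) : R := if (0 < t) && (t <= a + a) then t `^ p else 0.
have phi0 t : 0 <= phi t by rewrite /phi; case: ifP => // _; exact: powR_ge0.
have mphi : measurable_fun setT (fun t : R => (phi t)%:E).
  apply/measurable_EFinP; apply: measurable_fun_ifT => //.
  by apply: measurable_and; [exact: measurable_fun_ltr | exact: measurable_fun_ler].
have Iphi : (\int[leb]_(x in [set: R]) (phi x)%:E <= ((a + a) `^ (p + 1) / (p + 1))%:E)%E.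
  rewrite (_ : \int[leb]_(x in [set: R]) (phi x)%:E = \int[leb]_(x in `]0%R, (a + a)%R]) (x `^ p)%:E)%E.
    by apply: integral_powR_itvoc => //; rewrite addr_gt0.
  rewrite [RHS]integral_mkcond; apply: eq_integral => x _.
  by rewrite patchE mem_setE in_itv /= /phi; case: ifP.
have mphi1 : measurable_fun setT (fun t : R => (phi (t + a)%R)%:E).
  by apply: (measurableT_comp mphi); apply: measurable_funD.
have mphi2 : measurable_fun setT (fun t : R => (phi (- t + a)%R)%:E).
  by apply: (measurableT_comp mphi1); apply: measurable_funN.
have I1 : (\int[leb]_(x in [set: R]) (phi (x + a)%R)%:E <= ((a + a) `^ (p + 1) / (p + 1))%:E)%E.
  by rewrite (@ge0_integral_shift R a (fun x => (phi x)%:E)).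
have I2 : (\int[leb]_(x in [set: R]) (phi (- x + a)%R)%:E <= ((a + a) `^ (p + 1) / (p + 1))%:E)%E.
  rewrite (@ge0_integral_reflect (fun x => (phi (x + a)%R)%:E)) // => r.
  by rewrite lee_fin.
have mS0 : measurable_fun setT (fun x : R => (phi (x + a)%R)%:E + (phi (- x + a)%R)%:E)%E.
  exact: emeasurable_funD.
have mS : measurable_fun setT (fun x : R => (a `^ p)%:E * ((phi (x + a)%R)%:E + (phi (- x + a)%R)%:E))%E.
  by apply: (@emeasurable_funM _ _ _ _ (fun=> (a `^ p)%:E)) mS0 => //; exact: measurable_cst.
apply: le_trans (_ : \int[leb]_(x in [set: R]) ((a `^ p)%:E * ((phi (x + a)%R)%:E + (phi (- x + a)%R)%:E)) <= _)%E.
  apply: ge0_le_integral => //.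
  - by move=> x _; rewrite lee_fin pospow_ge0.
  - exact: mq.
  move=> x _; rewrite -EFinD -EFinM lee_fin /pospow absq // -/a.
  case: ifPn => [|_]; last by rewrite mulr_ge0 ?powR_ge0 // addr_ge0.
  rewrite ltr_norml => /andP[h1 h2].
  have -> : s - x ^+ 2 = (x + a) * (- x + a) by rewrite -(sq s s0) -/a; ring.
  rewrite powRM; [|lra|lra].
  rewrite mulrDr.
  have [xp|xn] := lerP 0 x.
    rewrite -[leLHS]add0r; apply: lerD; first by rewrite mulr_ge0 ?powR_ge0.
    rewrite /phi (_ : _ && _); last by apply/andP; split; lra.
    rewrite ler_wpM2r ?powR_ge0 //; apply: powR_le_neg; lra.
  rewrite -[leLHS]addr0; apply: lerD; last by rewrite mulr_ge0 ?powR_ge0.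
  rewrite /phi (_ : _ && _); last by apply/andP; split; lra.
  rewrite mulrC ler_wpM2r ?powR_ge0 //; apply: powR_le_neg; lra.
rewrite ge0_integralZl; [|exact: measurableT|exact: mS0| |by rewrite lee_fin powR_ge0]; last first.
  by move=> x _; rewrite -EFinD lee_fin addr_ge0.
rewrite ge0_integralD; [|exact: measurableT|by move=> x _; rewrite lee_fin|by []|by move=> x _; rewrite lee_fin|by []].
apply: le_trans (_ : (a `^ p)%:E * (((a + a) `^ (p + 1) / (p + 1))%:E + ((a + a) `^ (p + 1) / (p + 1))%:E) <= _)%E.
  by apply: lee_wpmul2l; [rewrite lee_fin powR_ge0 | apply: leeD].
rewrite -EFinD -EFinM lee_fin.
have -> : a + a = 2 * a by ring.
rewrite (@powRM R 2 a) ?(ltW a0) //.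
have -> : s `^ (p + 2^-1) = a `^ p * a `^ (p + 1).
  rewrite /a -(powR12_sqrt (ltW s0)) -!powRrM -powRD; last by apply/implyP => _; rewrite gt_eqF.
  by congr (_ `^ _); field.
by rewrite /K le_eqVlt; apply/orP; left; apply/eqP; ring.
Qed.
End PowerIntegral.

Import Normc.
Local Open Scope complex_scope.
Local Open Scope ring_scope.

(** * Hermitian forms and positive semidefinite matrices *)

Notation "A ^h" := (mxadj A) (at level 1, format "A ^h").

(* Sealed: unification attempts between [psd x] and [psd (- x)] would otherwise unfold matrices. *)
HB.lock Definition Psd (R : realType) q (x : 'M[R[i]]_q) : Prop := psd x.
Lemma PsdE (R : realType) q : @psd R q = @Psd R q. Proof. by rewrite Psd.unlock. Qed.

HB.lock Definition bf (R : realType) n (x : 'M[R[i]]_n) (u v : 'cV[R[i]]_n) : R[i] :=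
  (u^h *m x *m v) 0 0.

Section Adjoint.
Variable R : realType.
Local Notation C := (R[i]).

Lemma addmxE m n (x y : 'M[C]_(m, n)) i j : (x + y) i j = x i j + y i j.
Proof. by rewrite mxE. Qed.

Lemma oppmxE m n (x : 'M[C]_(m, n)) i j : (- x) i j = - x i j.
Proof. by rewrite mxE. Qed.

Lemma scalemxE m n (a : C) (x : 'M[C]_(m, n)) i j : (a *: x) i j = a * x i j.
Proof. by rewrite mxE. Qed.

Lemma deltamxE m n i j k l : (delta_mx i j : 'M[C]_(m, n)) k l = ((k == i) && (l == j))%:R.
Proof. by rewrite mxE. Qed.

Lemma conjcM (x y : C) : (x * y)^*%C = x^*%C * y^*%C.
Proof. exact: rmorphM. Qed.

Lemma conjcD (x y : C) : (x + y)^*%C = x^*%C + y^*%C.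
Proof. exact: rmorphD. Qed.

Lemma conjcZr (k : R) (z : C) : (k%:C * z)^*%C = k%:C * z^*%C.
Proof. by rewrite rmorphM; congr (_ * _); exact: conjc_real. Qed.

Lemma mxadjE m n (x : 'M[C]_(m, n)) i j : x^h i j = (x j i)^*%C.
Proof. by rewrite !mxE. Qed.

Lemma mxadjK m n (x : 'M[C]_(m, n)) : x^h^h = x.
Proof. by apply/matrixP => i j; rewrite !mxadjE conjcK. Qed.

Lemma mxadjD m n (x y : 'M[C]_(m, n)) : (x + y)^h = x^h + y^h.
Proof. by apply/matrixP => i j; rewrite !(mxadjE, mxE) rmorphD. Qed.

Lemma mxadjN m n (x : 'M[C]_(m, n)) : (- x)^h = - x^h.
Proof. by apply/matrixP => i j; rewrite !(mxadjE, mxE) rmorphN. Qed.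

Lemma mxadjB m n (x y : 'M[C]_(m, n)) : (x - y)^h = x^h - y^h.
Proof. by rewrite mxadjD mxadjN. Qed.

Lemma mxadjZ m n (a : C) (x : 'M[C]_(m, n)) : (a *: x)^h = a^*%C *: x^h.
Proof. by apply/matrixP => i j; rewrite !(mxadjE, mxE) rmorphM. Qed.

Lemma mxadjZr m n (a : R) (x : 'M[C]_(m, n)) : (a%:C *: x)^h = a%:C *: x^h.
Proof. by rewrite mxadjZ conjc_real. Qed.

Lemma mxadjM m n p (x : 'M[C]_(m, n)) (y : 'M[C]_(n, p)) : (x *m y)^h = y^h *m x^h.
Proof. by rewrite /mxadj map_mxM trmx_mul. Qed.

Lemma mxadj1 n : (1%:M : 'M[C]_n)^h = 1%:M.
Proof. by rewrite /mxadj map_mx1 trmx1. Qed.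

Lemma mxadj0 m n : (0 : 'M[C]_(m, n))^h = 0.
Proof. by apply/matrixP => i j; rewrite !(mxadjE, mxE) rmorph0. Qed.

Lemma mxadj_diag n (d : 'rV[C]_n) : (diag_mx d)^h = diag_mx (map_mx Num.conj d).
Proof. by rewrite /mxadj map_diag_mx tr_diag_mx. Qed.

Lemma mxadj_sum m n I (r : seq I) (P : pred I) (F : I -> 'M[C]_(m, n)) :
  (\sum_(i <- r | P i) F i)^h = \sum_(i <- r | P i) (F i)^h.
Proof. by apply: (big_morph (@mxadj R m n)) => [x y|]; rewrite ?mxadjD ?mxadj0. Qed.

Lemma mxadj_inv n (x : 'M[C]_n) : (invmx x)^h = invmx x^h.
Proof. by rewrite /mxadj map_invmx trmx_inv. Qed.

Lemma mxadj_unit n (x : 'M[C]_n) : (x^h \in unitmx) = (x \in unitmx).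
Proof. by rewrite /mxadj unitmx_tr map_unitmx. Qed.

Lemma mxadj_tr n (x : 'M[C]_n) : x^T^h = x^h^T.
Proof. by apply/matrixP => i j; rewrite !mxE. Qed.

Lemma mulmx_adj_00 n (u : 'cV[C]_n) : (u^h *m u) 0 0 = (\sum_i normc (u i 0) ^+ 2)%:C.
Proof.
rewrite mxE rmorph_sum /=; apply: eq_bigr => i _; rewrite mxadjE mulrC -sqr_normc.
by rewrite rmorphXn.
Qed.

Lemma ReZ (a : R) (z : C) : complex.Re (a%:C * z) = a * complex.Re z.
Proof. by case: z => x y /=; rewrite mul0r subr0. Qed.

Lemma add00 (x y : 'M[C]_1) : (x + y) 0 0 = x 0 0 + y 0 0.
Proof. by rewrite mxE. Qed.

Lemma scale00 (a : C) (x : 'M[C]_1) : (a *: x) 0 0 = a * x 0 0.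
Proof. by rewrite mxE. Qed.

Lemma bf_conj n (x : 'M[C]_n) u v : x^h = x -> (bf x u v)^*%C = bf x v u.
Proof.
move=> hx; rewrite bf.unlock.
have : (u^h *m x *m v)^h = v^h *m x *m u by rewrite !mxadjM mxadjK hx mulmxA.
by move/matrixP/(_ 0 0); rewrite mxadjE.
Qed.

Lemma bfDm n (x y : 'M[C]_n) u v : bf (x + y) u v = bf x u v + bf y u v.
Proof. by rewrite bf.unlock mulmxDr mulmxDl add00. Qed.

Lemma bfNm n (x : 'M[C]_n) u v : bf (- x) u v = - bf x u v.
Proof. by rewrite bf.unlock mulmxN mulNmx [LHS]mxE. Qed.

Lemma bfZm n (a : C) (x : 'M[C]_n) u v : bf (a *: x) u v = a * bf x u v.
Proof. by rewrite bf.unlock -scalemxAr -scalemxAl [LHS]mxE. Qed.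

Lemma bf0m n (u v : 'cV[C]_n) : bf 0 u v = 0.
Proof. by rewrite bf.unlock mulmx0 mul0mx mxE. Qed.

Lemma bfDl n (x : 'M[C]_n) u u' v : bf x (u + u') v = bf x u v + bf x u' v.
Proof. by rewrite bf.unlock mxadjD !mulmxDl add00. Qed.

Lemma bfDr n (x : 'M[C]_n) u v v' : bf x u (v + v') = bf x u v + bf x u v'.
Proof. by rewrite bf.unlock mulmxDr add00. Qed.

Lemma bfZl n (x : 'M[C]_n) (a : C) u v : bf x (a *: u) v = a^*%C * bf x u v.
Proof. by rewrite bf.unlock mxadjZ -!scalemxAl [LHS]mxE. Qed.

Lemma bf_scaler n (x : 'M[C]_n) (a : C) u v : bf x u (a *: v) = a * bf x u v.
Proof. by rewrite bf.unlock -scalemxAr [LHS]mxE. Qed.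

Lemma bf_congr n m (a : 'M[C]_(n, m)) (x : 'M[C]_m) u v :
  bf (a *m x *m a^h) u v = bf x (a^h *m u) (a^h *m v).
Proof. by rewrite bf.unlock mxadjM mxadjK !mulmxA. Qed.

Lemma bf_mulr n (x : 'M[C]_n) u v w : x *m v = w -> bf x u v = (u^h *m w) 0 0.
Proof. by move=> <-; rewrite bf.unlock mulmxA. Qed.

(** For Hermitian x the form is already real ([bf_real]); taking the real part keeps all order
    arguments in R. *)
Definition rq n (x : 'M[C]_n) (u : 'cV[C]_n) : R := complex.Re (bf x u u).

Lemma rqE n (x : 'M[C]_n) u : rq x u = complex.Re ((u^h *m x *m u) 0 0).
Proof. by rewrite /rq bf.unlock. Qed.

Lemma rqD n (x y : 'M[C]_n) u : rq (x + y) u = rq x u + rq y u.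
Proof. by rewrite /rq bfDm raddfD. Qed.

Lemma rqN n (x : 'M[C]_n) u : rq (- x) u = - rq x u.
Proof. by rewrite /rq bfNm raddfN. Qed.

Lemma rqB n (x y : 'M[C]_n) u : rq (x - y) u = rq x u - rq y u.
Proof. by rewrite rqD rqN. Qed.

Lemma rqZ n (a : R) (x : 'M[C]_n) u : rq (a%:C *: x) u = a * rq x u.
Proof. by rewrite /rq bfZm ReZ. Qed.

Lemma rq0 n (u : 'cV[C]_n) : rq 0 u = 0.
Proof. by rewrite /rq bf0m. Qed.

Lemma rqv0 n (x : 'M[C]_n) : rq x 0 = 0.
Proof. by rewrite rqE mulmx0 mxE. Qed.

Lemma rq_mul0 n (x : 'M[C]_n) u : x *m u = 0 -> rq x u = 0.
Proof. by move=> h; rewrite /rq (bf_mulr _ h) mulmx0 mxE. Qed.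

Lemma rq_conj n m (a : 'M[C]_(n, m)) (x : 'M[C]_m) u : rq (a *m x *m a^h) u = rq x (a^h *m u).
Proof. by rewrite /rq bf_congr. Qed.

Lemma rq1 n (u : 'cV[C]_n) : rq 1%:M u = \sum_i normc (u i 0) ^+ 2.
Proof. by rewrite rqE mulmx1 mulmx_adj_00. Qed.

Lemma rq1_ge0 n (u : 'cV[C]_n) : 0 <= rq 1%:M u.
Proof. by rewrite rq1; apply: sumr_ge0 => i _; apply: sqr_ge0. Qed.

Lemma normc_ge0 (z : C) : 0 <= normc z.
Proof. by case: z => a b; apply: sqrtr_ge0. Qed.

Lemma rq1_eq0 n (u : 'cV[C]_n) : rq 1%:M u = 0 -> u = 0.
Proof.
rewrite rq1 => /eqP; rewrite psumr_eq0; last by move=> i _; apply: sqr_ge0.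
move=> /allP h; apply/matrixP => i j; rewrite ord1 mxE.
have := h i (mem_index_enum _); rewrite sqrf_eq0 => /eqP; exact: eq0_normc.
Qed.

Lemma rq1_gt0 n (u : 'cV[C]_n) : u != 0 -> 0 < rq 1%:M u.
Proof.
move=> u0; rewrite lt_def rq1_ge0 andbT; apply: contra u0 => /eqP /rq1_eq0 ->.
exact: eqxx.
Qed.

Lemma bf_real n (x : 'M[C]_n) (u : 'cV[C]_n) : x^h = x -> bf x u u = (rq x u)%:C.
Proof.
move=> hx; have := bf_conj u u hx; rewrite /rq; case: (bf x u u) => a b /= [] h; congr (_ +i* _).
by apply/eqP; rewrite -eqNr; apply/eqP.
Qed.

Lemma herm_form_real n (x : 'M[C]_n) (u : 'cV[C]_n) : x^h = x ->
  (u^h *m x *m u) 0 0 = (rq x u)%:C.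
Proof. by move=> hx; rewrite -bf_real // bf.unlock. Qed.

Lemma psdP q (x : 'M[C]_q) : Psd x <-> x^h = x /\ forall u, 0 <= rq x u.
Proof.
rewrite -PsdE.
split=> -[h1 h2]; split=> // u; have := h2 u.
  by rewrite herm_form_real // ler0c.
by rewrite herm_form_real // ler0c.
Qed.

Lemma pdP q (x : 'M[C]_q) : pd x <-> x^h = x /\ forall u, u != 0 -> 0 < rq x u.
Proof.
split=> -[h1 h2]; split=> // u u0; have := h2 u u0.
  by rewrite herm_form_real // ltcR.
by rewrite herm_form_real // ltcR.
Qed.

Lemma Re_bfC n (x : 'M[C]_n) u v : x^h = x -> complex.Re (bf x v u) = complex.Re (bf x u v).
Proof. by move=> hx; rewrite -bf_conj //; case: (bf x u v). Qed.

Lemma rq_add n (x : 'M[C]_n) u v : x^h = x ->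
  rq x (u + v) = rq x u + rq x v + 2 * complex.Re (bf x u v).
Proof. by move=> hx; rewrite /rq bfDl !bfDr !raddfD /= (Re_bfC u v hx); ring. Qed.

Lemma rq_scale n (x : 'M[C]_n) (a : C) u : rq x (a *: u) = normc a ^+ 2 * rq x u.
Proof.
by rewrite /rq bfZl bf_scaler mulrA [a^*%C * a]mulrC -sqr_normc -rmorphXn /= ReZ.
Qed.

Lemma normc_conj (z : C) : normc z^*%C = normc z.
Proof. by case: z => a b /=; rewrite sqrrN. Qed.

Lemma mul_conj_normc (z : C) : z * z^*%C = (normc z ^+ 2)%:C.
Proof. by rewrite -sqr_normc rmorphXn. Qed.

Lemma real_quad_disc (a b c : R) : 0 <= a ->
  (forall t : R, 0 <= a + 2 * t * b + t ^+ 2 * c) -> b ^+ 2 <= a * c.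
Proof.
move=> a0 h.
have [c0|c0] := lerP c 0.
  have [b0|b0] := eqVneq b 0.
    rewrite b0 expr0n /=; move: c0; rewrite le_eqVlt => /orP[/eqP ->|c0]; first by rewrite mulr0.
    (* At this t one has t^2 c = (a+1)^2 (c - 2 + 1/c) <= -2 (a+1)^2 < -a, which contradicts
       nonnegativity when c < 0. *)
    have := h ((a + 1) * (1 - c^-1)); rewrite b0 mulr0 addr0.
    have ci : c^-1 < 0 by rewrite invr_lt0.
    have -> : ((a + 1) * (1 - c^-1)) ^+ 2 * c = (a + 1) ^+ 2 * (c - 2 + c^-1).
      by field; rewrite lt_eqF.
    have : (a + 1) ^+ 2 * (c - 2 + c^-1) <= (a + 1) ^+ 2 * (- 2).
      by rewrite ler_wpM2l ?sqr_ge0 //; lra.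
    nra.
  (* This t makes the linear term equal to -(a + 1), so with c <= 0 the whole expression is at most
     -1. *)
  pose t := - (a + 1) / (2 * b).
  have tb : 2 * t * b = - (a + 1) by rewrite /t; field.
  have : t ^+ 2 * c <= 0 by rewrite mulr_ge0_le0 // sqr_ge0.
  have := h t.
  rewrite tb; lra.
have := h (- b / c).
have -> : a + 2 * (- b / c) * b + (- b / c) ^+ 2 * c = (a * c - b ^+ 2) / c.
  by field; rewrite gt_eqF.
by rewrite pmulr_lge0 ?invr_gt0 // subr_ge0.
Qed.

(** Cauchy-Schwarz for a form that may be degenerate. With z = [bf x u v], evaluating at u + t z^* v
    makes the mixed term real; the discriminant bound then carries a surplus factor |z|^2, which is
    cancelled. *)
Lemma psd_CS n (x : 'M[C]_n) u v : Psd x -> normc (bf x u v) ^+ 2 <= rq x u * rq x v.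
Proof.
move=> /psdP[hx px].
have [z0|z0] := eqVneq (bf x u v) 0.
  by rewrite z0 normc0 expr0n /= mulr_ge0.
set z := bf x u v in z0 *.
have n0 : 0 < normc z ^+ 2.
  rewrite exprn_gt0 // lt_def normc_ge0 andbT; apply: contra z0 => /eqP /eq0_normc ->.
  exact: eqxx.
have key : (normc z ^+ 2) ^+ 2 <= rq x u * (normc z ^+ 2 * rq x v).
  apply: real_quad_disc => [//|t].
  have := px (u + (t%:C * z^*%C) *: v); rewrite rq_add // rq_scale bf_scaler -/z.
  rewrite -mulrA [z^*%C * z]mulrC mul_conj_normc -rmorphM /= normcM normc_conj.
  have -> : normc t%:C = `|t| by rewrite /= expr0n /= addr0 sqrtr_sqr.
  rewrite exprMn real_normK ?num_real //; lra.
move: key n0; set N := normc z ^+ 2 => key n0.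
by rewrite -(ler_pM2l n0) [leRHS]mulrCA -expr2.
Qed.
End Adjoint.

(** * Positive semidefinite matrices, square roots and matrix norms *)

Section Psd.
Variables (R : realType) (q : nat).
Local Notation C := (R[i]).
Local Notation M := ('M[C]_q).
Implicit Types (x y a : M) (u v : 'cV[C]_q).

Lemma psd_herm x : Psd x -> x^h = x. Proof. by case/psdP. Qed.
Lemma psd_rq x u : Psd x -> 0 <= rq x u. Proof. by move=> /psdP[]. Qed.

Lemma psd0 : Psd (0 : M).
Proof. by apply/psdP; rewrite mxadj0; split=> // u; rewrite rq0. Qed.

Lemma psd1 : Psd (1%:M : M).
Proof. by apply/psdP; rewrite mxadj1; split=> // u; exact: rq1_ge0. Qed.

Lemma psdD x y : Psd x -> Psd y -> Psd (x + y).
Proof.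
move=> /psdP[hx px] /psdP[hy py]; apply/psdP; rewrite mxadjD hx hy; split=> // u.
by rewrite rqD addr_ge0.
Qed.

Lemma psdZ (k : R) x : 0 <= k -> Psd x -> Psd (k%:C *: x).
Proof.
move=> k0 /psdP[hx px]; apply/psdP; rewrite mxadjZr hx; split=> // u.
by rewrite rqZ mulr_ge0.
Qed.

Lemma psd_conj a x : Psd x -> Psd (a *m x *m a^h).
Proof.
move=> /psdP[hx px]; apply/psdP; rewrite !mxadjM mxadjK hx mulmxA; split=> // u.
by rewrite rq_conj.
Qed.

Lemma psd_gram n (a : 'M[C]_(q, n)) : Psd (a *m a^h).
Proof.
apply/psdP; rewrite mxadjM mxadjK; split=> // u.
have -> : rq (a *m a^h) u = rq 1%:M (a^h *m u) by rewrite -rq_conj mulmx1.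
exact: rq1_ge0.
Qed.

Lemma psd_sqr x : x^h = x -> Psd (x *m x).
Proof. by move=> hx; rewrite -{2}hx; exact: psd_gram. Qed.

Lemma psd_sum I (r : seq I) (P : pred I) (F : I -> M) : (forall i, P i -> Psd (F i)) ->
  Psd (\sum_(i <- r | P i) F i).
Proof. by move=> h; apply: (big_ind (@Psd R q)) => //; [exact: psd0 | move=> *; exact: psdD]. Qed.

Definition ecol (i : 'I_q) : 'cV[C]_q := delta_mx i 0.

Lemma bf_ecol x i j : bf x (ecol i) (ecol j) = x i j.
Proof.
rewrite bf.unlock /ecol.
have -> : (delta_mx i 0 : 'cV[C]_q)^h = delta_mx 0 i.
  by apply/matrixP => k l; rewrite mxadjE !mxE rmorph_nat andbC.
by rewrite -rowE -colE !mxE.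
Qed.

Lemma rq_ecol x i : rq x (ecol i) = complex.Re (x i i).
Proof. by rewrite -bf_ecol. Qed.

Lemma bf_ecoll x i v : bf x (ecol i) v = (x *m v) i 0.
Proof.
rewrite bf.unlock -mulmxA /ecol.
have -> : (delta_mx i 0 : 'cV[C]_q)^h = delta_mx 0 i.
  by apply/matrixP => k l; rewrite mxadjE !mxE rmorph_nat andbC.
by rewrite -rowE !mxE.
Qed.

Lemma psd_bf0 x u v : Psd x -> rq x v = 0 -> bf x u v = 0.
Proof.
move=> px h; have := psd_CS u v px; rewrite h mulr0 => le0.
apply: eq0_normc; apply/eqP; rewrite -sqrf_eq0; apply/eqP/le_anti.
by rewrite le0 sqr_ge0.
Qed.

Lemma psd_ker x v : Psd x -> rq x v = 0 -> x *m v = 0.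
Proof.
move=> px h; apply/matrixP => i j; rewrite ord1 [RHS]mxE -bf_ecoll; exact: psd_bf0.
Qed.

(** Instead of polarisation: x - y is positive semidefinite with zero quadratic form, so
    Cauchy-Schwarz kills every entry. *)
Lemma rq_ext x y : x^h = x -> y^h = y -> (forall u, rq x u = rq y u) -> x = y.
Proof.
move=> hx hy h; apply/eqP; rewrite -subr_eq0; apply/eqP/matrixP => i j.
have pd : Psd (x - y).
  by apply/psdP; rewrite mxadjB hx hy; split=> // u; rewrite rqB h subrr.
by rewrite -bf_ecol [RHS]mxE psd_bf0 // rqB h subrr.
Qed.

Lemma psd_anti x : Psd x -> Psd (- x) -> x = 0.
Proof.
move=> px /psdP[_ nx]; apply: rq_ext; rewrite ?mxadj0 ?psd_herm // => u.
rewrite rq0; apply/le_anti; rewrite (psd_rq u px) andbT.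
by have := nx u; rewrite rqN oppr_ge0.
Qed.

Lemma pd_psd x : pd x -> Psd x.
Proof.
move=> /pdP[hx px]; apply/psdP; split=> // u.
by have [->|/px/ltW//] := eqVneq u 0; rewrite rqv0.
Qed.

Lemma unit_ker x : (forall u, x *m u = 0 -> u = 0) -> x \in unitmx.
Proof.
move=> h; rewrite -unitmx_tr -row_free_unit -kermx_eq0; apply/eqP/row_matrixP => i.
rewrite row0; apply: trmx_inj; rewrite trmx0; apply: h.
apply: trmx_inj; rewrite trmx_mul trmxK trmx0.
by apply/sub_kermxP; exact: row_sub.
Qed.

Lemma pd_unit x : pd x -> x \in unitmx.
Proof.
move=> /pdP[hx px]; apply: unit_ker => u xu; apply/eqP; apply: contraT => /px.
by rewrite (rq_mul0 xu) ltxx.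
Qed.

Lemma psd_unit_pd x : Psd x -> x \in unitmx -> pd x.
Proof.
move=> px ux; apply/pdP; split; first exact: psd_herm.
move=> u u0; rewrite lt_def psd_rq // andbT; apply: contra u0 => /eqP /(psd_ker px) h.
by rewrite -[u]mul1mx -(mulVmx ux) -mulmxA h mulmx0.
Qed.

Lemma pd1 : pd (1%:M : M).
Proof. by apply: psd_unit_pd; [exact: psd1 | exact: unitmx1]. Qed.

Lemma pdD x y : Psd x -> pd y -> pd (x + y).
Proof.
move=> px /pdP[hy py]; apply/pdP; split; first by rewrite mxadjD hy psd_herm.
by move=> u u0; rewrite rqD ltr_wpDl ?py // psd_rq.
Qed.

Lemma pdZ (k : R) x : 0 < k -> pd x -> pd (k%:C *: x).
Proof.
move=> k0 /pdP[hx px]; apply/pdP; split; first by rewrite mxadjZr hx.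
by move=> u u0; rewrite rqZ mulr_gt0 // px.
Qed.

Definition unitary (U : M) := U *m U^h = 1%:M.

Lemma unitaryC U : unitary U -> U^h *m U = 1%:M.
Proof. exact: mulmx1C. Qed.

Definition rdiag (d : 'I_q -> R) : M := diag_mx (\row_i (d i)%:C).

Lemma rdiag_adj d : (rdiag d)^h = rdiag d.
Proof. by rewrite mxadj_diag; congr diag_mx; apply/rowP => i; rewrite !mxE; exact: conjc_real. Qed.

Lemma rdiagM d e : rdiag d *m rdiag e = rdiag (fun i => d i * e i).
Proof. by rewrite mulmx_diag; congr diag_mx; apply/rowP => i; rewrite !mxE rmorphM. Qed.

Lemma herm_spectral x : x^h = x ->
  exists U d, unitary U /\ x = U *m rdiag d *m U^h.
Proof.
move=> hx.
have ct (y : M) : map_mx Num.conj y^T = y^h by rewrite /mxadj map_trmx.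
have nx : x \is normalmx by apply/normalmxP; rewrite ct hx.
have /orthomx_spectralP E := nx.
pose P := spectralmx x; pose s := spectral_diag x.
have uP : P *m P^h = 1%:M by have /unitarymxP := spectral_unitarymx x; rewrite ct.
have iP : invmx P = P^h by have := invmx_unitary (spectral_unitarymx x); rewrite ct.
rewrite -/P -/s iP in E.
exists P^h, (fun i => complex.Re (s 0 i)); split.
  by rewrite /unitary mxadjK; exact: mulmx1C.
rewrite mxadjK {1}E; congr (_ *m _ *m _); congr diag_mx; apply/rowP => i; rewrite !mxE.
have Ed : diag_mx s = P *m x *m P^h.
  by rewrite E !mulmxA uP mul1mx -mulmxA uP mulmx1.
have : (diag_mx s)^h = diag_mx s by rewrite Ed !mxadjM mxadjK hx mulmxA.
move/matrixP/(_ i i); rewrite mxadjE !mxE eqxx !mulr1n.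
case: (s 0 i) => a b /= [] h; congr (_ +i* _).
by apply/eqP; rewrite -eqNr; apply/eqP.
Qed.

Lemma rq_spectral (U : M) d i : unitary U -> rq (U *m rdiag d *m U^h) (U *m ecol i) = d i.
Proof.
move=> uU; rewrite rq_conj mulmxA (unitaryC uU) mul1mx rq_ecol !mxE eqxx mulr1n //.
Qed.

Lemma psd_sqrt_exists x : Psd x -> exists s, Psd s /\ s *m s = x.
Proof.
move=> px; have [U [d [uU E]]] := herm_spectral (psd_herm px).
have d0 i : 0 <= d i by rewrite -(rq_spectral d i uU) -E; exact: psd_rq.
exists (U *m rdiag (fun i => Num.sqrt (d i)) *m U^h); split.
  apply: psd_conj.
  have -> : rdiag (fun i => Num.sqrt (d i)) =
     rdiag (fun i => Num.sqrt (Num.sqrt (d i))) *m (rdiag (fun i => Num.sqrt (Num.sqrt (d i))))^h.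
    rewrite rdiag_adj rdiagM; congr rdiag; apply/funext => i.
    by rewrite -expr2 sqr_sqrtr // sqrtr_ge0.
  exact: psd_gram.
rewrite -!mulmxA (mulmxA U^h) (unitaryC uU) mul1mx (mulmxA (rdiag _)) rdiagM E -mulmxA.
by congr (_ *m (rdiag _ *m _)); apply/funext => i; rewrite -expr2 sqr_sqrtr.
Qed.

(** Submultiplicative, defined for all shapes and equivalent to [mnorm]; it serves as the working
    norm for all estimates. *)
Definition mN m n (x : 'M[C]_(m, n)) : R := \sum_i \sum_j normc (x i j).

Lemma mN_ge0 m n (x : 'M[C]_(m, n)) : 0 <= mN x.
Proof. by apply: sumr_ge0 => i _; apply: sumr_ge0 => j _; apply: normc_ge0. Qed.

Lemma mN_entry m n (x : 'M[C]_(m, n)) i j : normc (x i j) <= mN x.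
Proof.
rewrite /mN (bigD1 i) //= (bigD1 j) //= -addrA lerDl addr_ge0 //.
  by apply: sumr_ge0 => *; apply: normc_ge0.
by apply: sumr_ge0 => *; apply: sumr_ge0 => *; apply: normc_ge0.
Qed.

Lemma mN0 m n : mN (0 : 'M[C]_(m, n)) = 0.
Proof. by rewrite /mN big1 // => i _; rewrite big1 // => j _; rewrite mxE normc0. Qed.

Lemma mN_eq0 m n (x : 'M[C]_(m, n)) : mN x = 0 -> x = 0.
Proof.
move=> h; apply/matrixP => i j; rewrite [RHS]mxE; apply: eq0_normc; apply/le_anti.
by rewrite normc_ge0 andbT -h mN_entry.
Qed.

Lemma mND m n (x y : 'M[C]_(m, n)) : mN (x + y) <= mN x + mN y.
Proof.
rewrite /mN -big_split; apply: ler_sum => i _; rewrite -big_split; apply: ler_sum => j _.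
by rewrite mxE; exact: le_normcD.
Qed.

Lemma mNN m n (x : 'M[C]_(m, n)) : mN (- x) = mN x.
Proof. by apply: eq_bigr => i _; apply: eq_bigr => j _; rewrite mxE normcN. Qed.

Lemma mNB m n (x y : 'M[C]_(m, n)) : mN (x - y) = mN (y - x).
Proof. by rewrite -mNN opprB. Qed.

Lemma mN_tri m n (y x z : 'M[C]_(m, n)) : mN (x - z) <= mN (x - y) + mN (y - z).
Proof. by rewrite -{1}(subrK y x) -addrA; exact: mND. Qed.

Lemma mNZ m n (a : C) (x : 'M[C]_(m, n)) : mN (a *: x) = normc a * mN x.
Proof.
rewrite /mN mulr_sumr; apply: eq_bigr => i _; rewrite mulr_sumr; apply: eq_bigr => j _.
by rewrite mxE normcM.
Qed.

Lemma normc_real (a : R) : normc a%:C = `|a|.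
Proof. by rewrite /= expr0n /= addr0 sqrtr_sqr. Qed.

Lemma normc_sum I (r : seq I) (P : pred I) (F : I -> C) :
  normc (\sum_(i <- r | P i) F i) <= \sum_(i <- r | P i) normc (F i).
Proof.
elim/big_rec2: _ => [|i b a _ h]; first by rewrite normc0.
by apply: le_trans (le_normcD _ _) _; rewrite lerD2l.
Qed.

Lemma mNM m n p (x : 'M[C]_(m, n)) (y : 'M[C]_(n, p)) : mN (x *m y) <= mN x * mN y.
Proof.
rewrite /mN mulr_suml; apply: ler_sum => i _.
rewrite mulr_suml.
apply: le_trans (_ : \sum_j \sum_k normc (x i k) * normc (y k j) <= _).
  apply: ler_sum => j _; rewrite mxE; apply: le_trans (normc_sum _ _ _) _.
  by apply: ler_sum => k _; rewrite normcM.
rewrite exchange_big /=; apply: ler_sum => k _; rewrite -mulr_sumr ler_wpM2l ?normc_ge0 //.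
rewrite [leRHS](bigD1 k) //= lerDl; apply: sumr_ge0 => *; apply: sumr_ge0 => *; exact: normc_ge0.
Qed.

Lemma mN_adj m n (x : 'M[C]_(m, n)) : mN x^h = mN x.
Proof.
rewrite /mN exchange_big; apply: eq_bigr => i _; apply: eq_bigr => j _.
by rewrite mxadjE normc_conj.
Qed.

Lemma trace_adj_normc x : \tr (x^h *m x) = (\sum_i \sum_j normc (x i j) ^+ 2)%:C.
Proof.
rewrite /mxtrace exchange_big rmorph_sum; apply: eq_bigr => j _.
rewrite mxE rmorph_sum; apply: eq_bigr => i _.
by rewrite mxadjE mulrC mul_conj_normc.
Qed.

Lemma mnormE x : mnorm x = Num.sqrt (\sum_i \sum_j normc (x i j) ^+ 2).
Proof. by rewrite /mnorm trace_adj_normc. Qed.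

Lemma mnorm_entry x i j : normc (x i j) <= mnorm x.
Proof.
rewrite mnormE -[leLHS]ger0_norm ?normc_ge0 // -sqrtr_sqr ler_wsqrtr //.
rewrite (bigD1 i) //= (bigD1 j) //= -addrA lerDl addr_ge0 //.
  by apply: sumr_ge0 => *; apply: sqr_ge0.
by apply: sumr_ge0 => *; apply: sumr_ge0 => *; apply: sqr_ge0.
Qed.

Lemma mN_le_mnorm x : mN x <= (q * q)%:R * mnorm x.
Proof.
apply: le_trans (_ : \sum_(i < q) \sum_(j < q) mnorm x <= _).
  by apply: ler_sum => i _; apply: ler_sum => j _; exact: mnorm_entry.
by rewrite !sumr_const !card_ord -mulrnA mulr_natl.
Qed.

Lemma sumsq_le I (r : seq I) (F : I -> R) : (forall i, 0 <= F i) ->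
  \sum_(i <- r) F i ^+ 2 <= (\sum_(i <- r) F i) ^+ 2.
Proof.
move=> F0; elim: r => [|i r IH]; first by rewrite !big_nil expr0n.
rewrite !big_cons; have : 0 <= \sum_(j <- r) F j by apply: sumr_ge0.
have := F0 i; move: IH; nra.
Qed.

Lemma mnorm_le_mN x : mnorm x <= mN x.
Proof.
rewrite mnormE -[leRHS]ger0_norm ?mN_ge0 // -sqrtr_sqr ler_wsqrtr //.
apply: le_trans (sumsq_le _ _); last by move=> i; apply: sumr_ge0 => *; apply: normc_ge0.
by apply: ler_sum => i _; apply: sumsq_le => j; exact: normc_ge0.
Qed.

Lemma rq_le_mN x u : `|rq x u| <= mN x * mN u ^+ 2.
Proof.
apply: le_trans (_ : normc ((u^h *m x *m u) 0 0) <= _).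
  rewrite rqE; case: (_ 0 0) => a b /=.
  by rewrite -sqrtr_sqr ler_wsqrtr // lerDl sqr_ge0.
apply: le_trans (mN_entry _ _ _) _; apply: le_trans (mNM _ _) _.
rewrite expr2 mulrA ler_wpM2r ?mN_ge0 //; apply: le_trans (mNM _ _) _.
by rewrite mN_adj mulrC.
Qed.

Lemma unitary_entry (U : M) i j : unitary U -> normc (U i j) <= 1.
Proof.
move=> uU; have /matrixP/(_ i i) := uU; rewrite !mxE eqxx => h.
have : \sum_k normc (U i k) ^+ 2 = 1.
  apply: (@complexI R); rewrite rmorph_sum -[RHS]h; apply: eq_bigr => k _.
  by rewrite mxadjE mul_conj_normc.
rewrite (bigD1 j) //= => h2.
have : normc (U i j) ^+ 2 <= 1.
  by rewrite -h2 lerDl; apply: sumr_ge0 => *; apply: sqr_ge0.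
by rewrite expr_le1 // normc_ge0.
Qed.

(* If [l] is an eigenvalue of [s - t] with unit eigenvector [w], then
   [w^h (s^2 - t^2) w = l * w^h (s + t) w], whose modulus is at least [l ^+ 2]. *)
Lemma eig_sub_sqr (s t : M) (w : 'cV[C]_q) (l : R) : Psd s -> Psd t ->
  (s - t) *m w = l%:C *: w -> rq 1%:M w = 1 ->
  l ^+ 2 <= `|rq (s *m s - t *m t) w|.
Proof.
move=> ps pt e w1.
have E : rq (s *m s - t *m t) w = l * (rq s w + rq t w).
  have hst : (s - t)^h = s - t by rewrite mxadjB !psd_herm.
  have -> : s *m s - t *m t = (s - t) *m s + t *m (s - t).
    by rewrite mulmxBl mulmxBr addrA subrK.
  rewrite rqD mulrDr; congr (_ + _); last first.
    by rewrite !rqE -!mulmxA e -!scalemxAr scale00 ReZ mulmxA.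
  by rewrite !rqE mulmxA -{1}hst -mxadjM e mxadjZr -!scalemxAl scale00 ReZ.
rewrite E normrM (ger0_norm (addr_ge0 (psd_rq _ ps) (psd_rq _ pt))).
rewrite -real_normK ?num_real // expr2 ler_wpM2l //.
have : rq s w - rq t w = l.
  rewrite -rqB rqE -mulmxA e -scalemxAr scale00 ReZ.
  by move: w1; rewrite rqE mulmx1 => ->; rewrite mulr1.
have := psd_rq w ps; have := psd_rq w pt; move: (rq s w) (rq t w); clear => a b h1 h2 <-.
by rewrite ler_norml; apply/andP; split; lra.
Qed.

Lemma rq1_ecol_unitary (U : M) i : unitary U -> rq 1%:M (U *m ecol i) = 1.
Proof.
move=> uU; have -> : rq 1%:M (U *m ecol i) = rq (U^h *m 1%:M *m U^h^h) (ecol i).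
  by rewrite rq_conj mxadjK.
by rewrite mulmx1 mxadjK (unitaryC uU) rq_ecol mxE eqxx.
Qed.

Lemma mN_unitary_ecol (U : M) i : unitary U -> mN (U *m ecol i) <= q%:R.
Proof.
move=> uU; rewrite /mN; apply: le_trans (_ : \sum_(k < q) 1 <= _).
  apply: ler_sum => k _; rewrite big_ord1 /ecol -colE mxE; exact: unitary_entry.
by rewrite sumr_const card_ord.
Qed.

Lemma unitary_eigen (U : M) d i : unitary U ->
  (U *m rdiag d *m U^h) *m (U *m ecol i) = (d i)%:C *: (U *m ecol i).
Proof.
move=> uU; rewrite -!mulmxA (mulmxA U^h) (unitaryC uU) mul1mx scalemxAr; congr (_ *m _).
apply/matrixP => k l; rewrite mul_diag_mx !mxE ord1.
by case: (eqVneq k i) => [->|]; rewrite ?mulr1 ?mulr0.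
Qed.

(** Continuity of the square root with exponent 1/2, and hence its uniqueness. By [eig_sub_sqr]
    every eigenvalue of s - t is at most q sqrt D, the factor q bounding [mN] of a unit eigenvector;
    summing q^3 terms of the spectral expansion gives q^4. *)
Lemma mN_sub_sqr (s t : M) : Psd s -> Psd t ->
  mN (s - t) <= q%:R ^+ 4 * Num.sqrt (mN (s *m s - t *m t)).
Proof.
move=> ps pt; have hst : (s - t)^h = s - t by rewrite mxadjB !psd_herm.
have [U [d [uU E]]] := herm_spectral hst.
set D := mN (s *m s - t *m t).
have q0 : 0 <= (q%:R : R) by rewrite ler0n.
have dle i : `|d i| <= q%:R * Num.sqrt D.
  have h := @eig_sub_sqr s t (U *m ecol i) (d i) ps pt _ (rq1_ecol_unitary i uU).
  have {}h : d i ^+ 2 <= `|rq (s *m s - t *m t) (U *m ecol i)| by apply: h; rewrite E unitary_eigen.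
  have {}h := le_trans h (rq_le_mN _ _).
  rewrite -sqrtr_sqr -[X in X * _](ger0_norm q0) -(sqrtr_sqr q%:R) -sqrtrM ?sqr_ge0 // ler_wsqrtr //.
  apply: le_trans h _; rewrite mulrC ler_wpM2r ?mN_ge0 // ler_pXn2r ?nnegrE ?mN_ge0 //.
  exact: mN_unitary_ecol.
rewrite E /mN.
apply: le_trans (_ : \sum_(i < q) \sum_(j < q) \sum_(k < q) q%:R * Num.sqrt D <= _).
  apply: ler_sum => i _; apply: ler_sum => j _; rewrite mxE.
  apply: le_trans (normc_sum _ _ _) _; apply: ler_sum => k _.
  rewrite mul_mx_diag !mxE !normcM normc_real normc_conj.
  rewrite -[leRHS]mul1r -[X in _ <= X]mulr1 ler_pM ?mulr_ge0 ?normc_ge0 ?unitary_entry //.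
  by rewrite ler_pM ?normc_ge0 ?unitary_entry.
rewrite !sumr_const !card_ord -!mulrnA -[leLHS]mulr_natl !natrM.
by rewrite le_eqVlt; apply/orP; left; apply/eqP; ring.
Qed.

Lemma psd_sqr_inj (s t : M) : Psd s -> Psd t -> s *m s = t *m t -> s = t.
Proof.
move=> ps pt h; have := mN_sub_sqr ps pt; rewrite h subrr mN0 sqrtr0 mulr0 => h0.
apply/eqP; rewrite -subr_eq0; apply/eqP/mN_eq0/le_anti; by rewrite h0 mN_ge0.
Qed.

Lemma msqrtP x : Psd x -> Psd (msqrt x) /\ msqrt x *m msqrt x = x.
Proof.
move=> px; have [s hs] := psd_sqrt_exists px; rewrite -PsdE in hs *; exact: (@xgetI _ 0 [set s | psd s /\ s *m s = x] s hs).
Qed.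

Lemma msqrt_psd x : Psd x -> Psd (msqrt x). Proof. by case/msqrtP. Qed.
Lemma msqrtK x : Psd x -> msqrt x *m msqrt x = x. Proof. by case/msqrtP. Qed.

Lemma msqrt_eq x (s : M) : Psd s -> s *m s = x -> msqrt x = s.
Proof.
move=> ps h; have px : Psd x by rewrite -h; apply: psd_sqr; exact: psd_herm.
by apply: psd_sqr_inj; rewrite ?msqrtK //; exact: msqrt_psd.
Qed.

Lemma sqr_msqrtK (s : M) : Psd s -> msqrt (s *m s) = s.
Proof. by move=> ps; exact: msqrt_eq. Qed.

Lemma msqrt_cont x y : Psd x -> Psd y ->
  mN (msqrt y - msqrt x) <= q%:R ^+ 4 * Num.sqrt (mN (y - x)).
Proof.
by move=> px py; have := mN_sub_sqr (msqrt_psd py) (msqrt_psd px); rewrite !msqrtK.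
Qed.

(** Turns the approximate support statements into exact inequalities of the Loewner order. *)
Lemma psd_closed x : (forall e : R, 0 < e -> exists2 y, Psd y & mN (y - x) < e) -> Psd x.
Proof.
move=> h; apply/psdP; split.
  apply/eqP; rewrite -subr_eq0; apply/eqP/mN_eq0/le_anti; rewrite mN_ge0 andbT.
  apply/ler_addgt0Pl => e e0; rewrite addr0.
  have e20 : 0 < e / 2 by rewrite divr_gt0.
  have [y py hy] := h _ e20.
  have -> : x^h - x = (x^h - y) + (y - x) by rewrite addrA subrK.
  apply: le_trans (mND _ _) _; rewrite -{1}(psd_herm py) -mxadjB mN_adj mNB; lra.
move=> u; rewrite leNgt; apply/negP => r0.
have e0 : 0 < - rq x u / (mN u ^+ 2 + 1).
  by rewrite divr_gt0 ?oppr_gt0 // ltr_wpDl // sqr_ge0.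
have [y py hy] := h _ e0.
have h1 := rq_le_mN (y - x) u.
have h2 : mN (y - x) * (mN u ^+ 2 + 1) < - rq x u.
  by rewrite -ltr_pdivlMr // ltr_wpDl // sqr_ge0.
have h3 := psd_rq u py.
have h4 := mN_ge0 (y - x).
move: h1 r0 h2 h3 h4; rewrite rqB ler_norml => /andP[_].
move: (rq y u) (rq x u) (mN _) (mN u ^+ 2); clear => a b c d; nra.
Qed.
End Psd.

(** * Order isomorphisms of the positive semidefinite cone *)

Section RankOne.
Variables (R : realType) (q : nat).
Local Notation C := (R[i]).
Local Notation M := ('M[C]_q).
Implicit Types (x y z a : M) (u v b : 'cV[C]_q).

Definition outer b : M := b *m b^h.

Lemma outer_psd b : Psd (outer b). Proof. exact: psd_gram. Qed.

Lemma outer0 : outer 0 = 0. Proof. by rewrite /outer mul0mx. Qed.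

Lemma outerE b i j : outer b i j = b i 0 * (b j 0)^*%C.
Proof. by rewrite mxE big_ord1 mxadjE. Qed.

Lemma outerZ (k : C) b : outer (k *: b) = (normc k ^+ 2)%:C *: outer b.
Proof.
by rewrite /outer mxadjZ -scalemxAl -scalemxAr scalerA mul_conj_normc.
Qed.

Lemma outer_scale (k : R) b : 0 <= k -> k%:C *: outer b = outer ((Num.sqrt k)%:C *: b).
Proof. by move=> k0; rewrite outerZ normc_real ger0_norm ?sqrtr_ge0 // sqr_sqrtr. Qed.

Lemma outer_mul a b : a *m outer b *m a^h = outer (a *m b).
Proof. by rewrite /outer mxadjM !mulmxA. Qed.

Lemma outer_mulv b u : outer b *m u = (b^h *m u) 0 0 *: b.
Proof.
rewrite /outer -mulmxA; apply/matrixP => i j.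
by rewrite !mxE big_ord1 !mxE (ord1 j) mulrC.
Qed.

Lemma rq_outer b u : rq (outer b) u = normc ((b^h *m u) 0 0) ^+ 2.
Proof.
rewrite rqE -mulmxA outer_mulv -scalemxAr mxE.
have -> : (u^h *m b) 0 0 = ((b^h *m u) 0 0)^*%C.
  by rewrite -mxadjE mxadjM mxadjK.
by rewrite mul_conj_normc.
Qed.

Lemma outer_eq0 b : outer b = 0 -> b = 0.
Proof.
move=> h; apply/matrixP => i j; rewrite ord1 [RHS]mxE.
have : outer b i i = 0 by rewrite h mxE.
rewrite outerE mul_conj_normc => -[] /eqP; rewrite sqrf_eq0 => /eqP; exact: eq0_normc.
Qed.

(** A rank one matrix spans an extreme ray. On vectors w orthogonal to b the form of z lies between
    0 and 0, so z w = 0; z is therefore determined by z b, and being Hermitian it is a multiple of b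
    b^*. *)
Lemma le_outer z b : Psd z -> Psd (outer b - z) -> exists2 c : R, 0 <= c & z = c%:C *: outer b.
Proof.
move=> pz /psdP[_ le].
have [b0|b0] := eqVneq b 0.
  exists 0 => //; rewrite scale0r; apply: psd_anti => //.
  apply/psdP; rewrite mxadjN psd_herm //; split=> [//|u].
  by have := le u; rewrite b0 outer0 sub0r.
pose n := rq 1%:M b; have n0 : 0 < n by exact: rq1_gt0.
have nE : (b^h *m b) 0 0 = n%:C by rewrite -[b^h]mulmx1 herm_form_real ?mxadj1.
have zu u : z *m u = ((b^h *m u) 0 0 / n%:C) *: (z *m b).
  set k := _ / _; pose w := u - k *: b.
  have bw : (b^h *m w) 0 0 = 0.
    rewrite /w mulmxBr -scalemxAr mxE [X in _ + X]mxE [X in _ - X]mxE nE /k.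
    by rewrite divfK ?subrr // -(rmorph0 (real_complex R)) (inj_eq (@complexI R)) gt_eqF.
  have zw : z *m w = 0.
    apply: psd_ker => //; apply/le_anti; rewrite psd_rq // andbT.
    by have := le w; rewrite rqB rq_outer bw normc0 expr0n /= sub0r oppr_ge0.
  by rewrite -[u](subrK (k *: b)) -/w mulmxDr zw add0r scalemxAr.
have zE : z = (n^-1)%:C *: (z *m outer b).
  apply/matrixP => i j; have := zu (ecol R j); move/matrixP/(_ i 0).
  rewrite -bf_ecoll bf_ecol => ->; rewrite /ecol -colE [_ 0 0 in LHS]mxE /outer mulmxA mxE.
  rewrite [RHS]mxE [X in _ * X = _]mxE [X in _ = _ * X]mxE big_ord1.
  rewrite fmorphV /= [(z *m b) i 0]mxE.
  by move: (\sum_(_ < q) _) (b^h 0 j) (_^-1) => A B k; ring.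
pose c := rq z b / (n ^+ 2).
exists c; first by rewrite /c divr_ge0 ?psd_rq // sqr_ge0.
have zE2 : z = (n^-1)%:C *: (outer b *m z).
  by rewrite -{1}(psd_herm pz) {1}zE mxadjZr mxadjM (psd_herm pz) (psd_herm (outer_psd b)).
rewrite {1}zE {1}zE2 -scalemxAl scalerA /outer -!mulmxA.
have -> : b *m (b^h *m (z *m (b *m b^h))) = (rq z b)%:C *: (b *m b^h).
  rewrite (mulmxA z) (mulmxA b^h) (mulmxA b^h z b) [b^h *m z *m b]mx11_scalar herm_form_real ?psd_herm //.
  by rewrite mul_scalar_mx scalemxAr.
rewrite scalerA -!rmorphM /=; congr (_%:C *: _).
by rewrite /c; field; rewrite gt_eqF.
Qed.

(** Choose u with n = u^* z u > 0. Then y = z u u^* z / n is of rank one and y <= z by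
    Cauchy-Schwarz. If [0, z] is a chain, y and z - y are comparable; the form of z - y vanishes at
    u and that of y does not, so z - y <= y and [le_outer] makes z a multiple of y. *)
Lemma chain_rank1 z : Psd z -> z != 0 ->
  (forall p r, Psd p -> Psd (z - p) -> Psd r -> Psd (z - r) -> Psd (r - p) \/ Psd (p - r)) ->
  exists b, z = outer b.
Proof.
move=> pz z0 chain.
have [i zi] : exists i, rq z (ecol R i) != 0.
  apply/existsP; apply: contraNT z0; rewrite negb_exists => /forallP h.
  apply/eqP/matrixP => i j; rewrite [RHS]mxE -bf_ecol psd_bf0 //.
  by have := h j; rewrite negbK => /eqP.
set u := ecol R i in zi; set n := rq z u in zi.
have n0 : 0 < n by rewrite lt_def zi psd_rq.
pose w := z *m u; pose y := (n^-1)%:C *: outer w.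
have py : Psd y by apply: psdZ; [rewrite invr_ge0 ltW | exact: outer_psd].
have wv v : (w^h *m v) 0 0 = bf z u v by rewrite /w mxadjM psd_herm // bf.unlock.
have wu : (w^h *m u) 0 0 = n%:C by rewrite wv bf_real // psd_herm.
have le : Psd (z - y).
  apply/psdP; rewrite mxadjB !psd_herm //; split=> // v.
  rewrite rqB rqZ rq_outer wv subr_ge0 ler_pdivrMl //; exact: psd_CS.
have yu : rq y u = n.
  by rewrite rqZ rq_outer wu normc_real ger0_norm ?(ltW n0) //; field; rewrite gt_eqF.
have le2 : Psd (z - (z - y)) by rewrite opprB addrC subrK.
case: (chain y (z - y)) => // h.
  have := psd_rq u h; rewrite !rqB -/n yu subrr sub0r oppr_ge0 => h2.
  by move: n0; rewrite ltNge h2.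
have py2 : Psd (outer ((Num.sqrt n^-1)%:C *: w) - (z - y)).
  by rewrite -outer_scale ?invr_ge0 ?(ltW n0).
have [c c0 E] := le_outer le py2.
exists ((Num.sqrt (c + 1))%:C *: ((Num.sqrt n^-1)%:C *: w)).
rewrite -outer_scale ?addr_ge0 // rmorphD scalerDl -E rmorph1 scale1r -outer_scale ?invr_ge0 ?(ltW n0) //.
by rewrite -/y subrK.
Qed.

Lemma psd_sum_outer x : Psd x -> exists l : seq 'cV[C]_q, x = \sum_(b <- l) outer b.
Proof.
move=> px; exists [seq col i (msqrt x) | i <- enum 'I_q].
rewrite big_map big_enum /= -{1}(msqrtK px) -{2}(psd_herm (msqrt_psd px)).
apply/matrixP => i j; rewrite mxE summxE; apply: eq_bigr => k _.
by rewrite outerE mxadjE !mxE.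
Qed.

Lemma rdiag_psd (d : 'I_q -> R) : (forall i, 0 <= d i) -> Psd (rdiag d).
Proof.
move=> d0; have -> : rdiag d = rdiag (fun i => Num.sqrt (d i)) *m (rdiag (fun i => Num.sqrt (d i)))^h.
  by rewrite rdiag_adj rdiagM; congr rdiag; apply/funext => i; rewrite -expr2 sqr_sqrtr.
exact: psd_gram.
Qed.

Lemma psd_bounded z : Psd z -> exists2 t : R, 0 <= t & Psd (t%:C *: 1%:M - z).
Proof.
move=> pz; have [U [d [uU E]]] := herm_spectral (psd_herm pz).
have d0 i : 0 <= d i by rewrite -(rq_spectral d i uU) -E; exact: psd_rq.
exists (\sum_i d i); first exact: sumr_ge0.
have -> : (\sum_i d i)%:C *: 1%:M - z = U *m rdiag (fun i => \sum_k d k - d i) *m U^h.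
  have -> : rdiag (fun i => \sum_k d k - d i) = (\sum_i d i)%:C *: 1%:M - rdiag d.
    apply/matrixP => i j; rewrite !mxE; case: eqP => _; rewrite ?mulr1n ?mulr0n ?mulr0 ?subrr //.
    by rewrite mulr1 rmorphB.
  by rewrite mulmxBr mulmxBl -E -scalemxAr -scalemxAl mulmx1 uU.
apply: psd_conj; apply: rdiag_psd => i.
by rewrite subr_ge0 (bigD1 i) //= lerDl sumr_ge0.
Qed.
End RankOne.

Lemma cross_ring (T : comNzRingType) (a b c d e f k : T) : k * (a * b) = k * (c * d) ->
  a * (k * b - f) - (k * c - e) * d = e * d - a * f.
Proof.
move=> h; have -> : a * (k * b - f) - (k * c - e) * d = k * (a * b) - k * (c * d) + (e * d - a * f).
  by ring.
by rewrite h subrr add0r.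
Qed.

(** Proportionality to w, written as vanishing 2 by 2 minors, survives limits without any control of
    the factors k. *)
Lemma cross_limit (R : realType) q (w y : 'M[R[i]]_q) :
  (forall e : R, 0 < e -> exists (k : R[i]) (v E : 'M[R[i]]_q),
    [/\ forall i j l m, w i j * v l m = v i j * w l m, y = k *: v - E & mN E < e]) ->
  forall i j l m, w i j * y l m = y i j * w l m.
Proof.
move=> h i j l m; apply/eqP; rewrite -subr_eq0; apply/eqP; apply: eq0_normc; apply/le_anti.
rewrite normc_ge0 andbT; apply/ler_addgt0Pl => e e0; rewrite addr0.
pose K := 2 * mN w + 1.
have K0 : 0 < K by rewrite ltr_wpDl // mulr_ge0 ?mN_ge0.
have eK : 0 < e / K by rewrite divr_gt0.
have [k [v [E [cross -> NE]]]] := h _ eK.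
have ent a b : (k *: v - E) a b = k * v a b - E a b by rewrite !mxE.
rewrite !ent.
have -> : w i j * (k * v l m - E l m) - (k * v i j - E i j) * w l m =
    E i j * w l m - w i j * E l m by apply: cross_ring; rewrite cross.
apply: le_trans (le_normcD _ _) _; rewrite normcN !normcM.
apply: le_trans (_ : mN E * mN w + mN w * mN E <= _).
  by apply: lerD; apply: ler_pM; rewrite ?normc_ge0 ?mN_entry.
have -> : e = (e / K) * K by field; rewrite gt_eqF.
have := mN_ge0 w; have := mN_ge0 E; move: NE; rewrite /K.
move: (mN E) (mN w) (e / _); clear => a b c; nra.
Qed.

(** * Additivity of homogeneous order isomorphisms *)

Section Additivity.
Variables (R : realType) (q : nat).
Local Notation C := (R[i]).
Local Notation M := ('M[C]_q).
Variables S U : M -> M.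
Hypothesis Spsd : forall x, Psd x -> Psd (S x).
Hypothesis Upsd : forall x, Psd x -> Psd (U x).
Hypothesis SU : forall x, Psd x -> S (U x) = x.
Hypothesis US : forall x, Psd x -> U (S x) = x.
Hypothesis Smono : forall x y, Psd x -> Psd y -> Psd (y - x) -> Psd (S y - S x).
Hypothesis Umono : forall x y, Psd x -> Psd y -> Psd (y - x) -> Psd (U y - U x).
Hypothesis Shom : forall (k : R) x, 0 <= k -> Psd x -> S (k%:C *: x) = k%:C *: S x.
Hypothesis Scont : forall x, Psd x -> forall e : R, 0 < e -> exists2 d : R, 0 < d &
  forall y, Psd y -> mN (y - x) < d -> mN (S y - S x) < e.

Lemma S0 : S 0 = 0.
Proof. by have := Shom (lexx 0) (psd0 R q); rewrite !scale0r. Qed.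

Lemma Sinj x y : Psd x -> Psd y -> S x = S y -> x = y.
Proof. by move=> px py h; rewrite -(US px) h US. Qed.

Lemma increment_outer x b : Psd x -> b != 0 -> exists c, S (x + outer b) - S x = outer c.
Proof.
move=> px b0; have pb := outer_psd b; have pxb := psdD px pb.
have le : Psd (S (x + outer b) - S x) by apply: Smono => //; rewrite addrC addKr.
apply: chain_rank1 => //.
  apply: contra b0; rewrite subr_eq0 => /eqP /(Sinj pxb px) /eqP.
  by rewrite -subr_eq0 addrC addKr => /eqP /outer_eq0 ->.
have sect p : Psd p -> Psd (S (x + outer b) - S x - p) ->
    exists2 c : R, 0 <= c & S x + p = S (x + c%:C *: outer b).
  move=> pp ple.
  have psxp : Psd (S x + p) by apply: psdD => //; exact: Spsd.
  have l1 : Psd (U (S x + p) - x).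
    by rewrite -{2}(US px); apply: Umono => //; [exact: Spsd | rewrite addrC addKr].
  have l2 : Psd (x + outer b - U (S x + p)).
    rewrite -(US pxb); apply: Umono => //; first exact: Spsd.
    by rewrite opprD addrA.
  have [|c c0 E] := @le_outer _ _ (U (S x + p) - x) b l1; first by rewrite opprB addrA [outer b + x]addrC.
  by exists c => //; rewrite -E [x + _]addrC subrK SU.
move=> p r pp ple pr rle.
have [c c0 Ec] := sect p pp ple; have [d d0 Ed] := sect r pr rle.
have pcb k : 0 <= k -> Psd (x + k%:C *: outer b) by move=> k0; apply: psdD => //; exact: psdZ.
have comp (k l : R) : 0 <= k -> k <= l -> Psd (S (x + l%:C *: outer b) - S (x + k%:C *: outer b)).
  move=> k0 kl; apply: Smono; [exact: pcb|apply: pcb; exact: le_trans kl|].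
  by rewrite opprD addrACA subrr add0r -scalerBl -rmorphB; apply: psdZ; rewrite ?subr_ge0.
have rp : r - p = (S x + r) - (S x + p) by rewrite opprD addrACA subrr add0r.
have pr' : p - r = (S x + p) - (S x + r) by rewrite opprD addrACA subrr add0r.
rewrite rp pr' Ec Ed; case/orP: (le_total c d) => h; [left|right]; exact: comp.
Qed.

(** With y = b b^*, the increments w s = S (x + s y) - S x for s >= 1 have rank one and dominate w
    1, so they are proportional to it. By homogeneity w s / s = S (y + x / s) - S x / s, which tends
    to S y; hence w 1 is proportional to S y. *)
Lemma S_add_outer_scal x b : Psd x -> exists h : C, S (x + outer b) = S x + h *: S (outer b).
Proof.
move=> px; have [->|b0] := eqVneq b 0.
  by exists 0; rewrite outer0 S0 scaler0 !addr0.
have pb := outer_psd b; set y := outer b in pb *.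
pose w (s : R) := S (x + s%:C *: y) - S x.
have w1E : w 1 = S (x + y) - S x by rewrite /w rmorph1 scale1r.
have cross s i j k l : 1 <= s -> w 1 i j * w s k l = w s i j * w 1 k l.
  move=> s1; have s0 : 0 < s by exact: lt_le_trans s1.
  have [c cE] : exists c, w s = outer c.
    have := @increment_outer x ((Num.sqrt s)%:C *: b) px; rewrite -outer_scale ?(ltW s0) // -/y; apply.
    rewrite scaler_eq0 negb_or b0 andbT -(rmorph0 (real_complex R)) (inj_eq (@complexI R)).
    by rewrite gt_eqF // sqrtr_gt0.
  have p1 : Psd (w 1).
    rewrite w1E; apply: Smono => //; [exact: psdD | by rewrite addrC addKr].
  have le : Psd (outer c - w 1).
    rewrite -cE w1E /w opprB addrA subrK; apply: Smono; [exact: psdD| apply: psdD => //; apply: psdZ => //; exact: ltW|].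
    rewrite opprD addrACA subrr add0r -{2}[y]scale1r -(rmorph1 (real_complex R)) -scalerBl -rmorphB.
    by apply: psdZ; rewrite ?subr_ge0.
  have [t t0 ->] := le_outer p1 le; rewrite cE.
  by rewrite [(_ *: outer c) i j]mxE [(_ *: outer c) k l]mxE -mulrA [RHS]mulrCA.
have lim i j k l : w 1 i j * S y k l = S y i j * w 1 k l.
  apply: (@cross_limit _ _ (w 1)) => e e0.
  have e2 : 0 < e / 2 by rewrite divr_gt0.
  have [d d0 hd] := Scont pb e2.
  (* Large enough that x / s is within d of 0 and S x / s within e / 2; the summand 1 gives s >= 1
     and makes both bounds strict. *)
  pose s := 1 + mN x / d + mN (S x) / (e / 2).
  have f1 : 0 <= mN x / d by rewrite divr_ge0 ?mN_ge0 ?ltW.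
  have f2 : 0 <= mN (S x) / (e / 2) by rewrite divr_ge0 ?mN_ge0 ?ltW.
  have s1 : 1 <= s by rewrite /s; lra.
  have s0 : 0 < s by exact: lt_le_trans s1.
  have sV : 0 <= s^-1 by rewrite invr_ge0 ltW.
  have small (m : M) (r : R) : 0 < r -> mN m / r < s -> mN ((s^-1)%:C *: m) < r.
    by move=> r0 h; rewrite mNZ normc_real ger0_norm // ltr_pdivrMl // mulrC -ltr_pdivrMl // mulrC.
  have x1 : mN ((s^-1)%:C *: x) < d by apply: small => //; rewrite /s; lra.
  have x2 : mN ((s^-1)%:C *: S x) < e / 2 by apply: small => //; rewrite /s; lra.
  have wE : (s^-1)%:C *: w s = S (y + (s^-1)%:C *: x) - (s^-1)%:C *: S x.
    rewrite /w scalerBr -Shom //; last by apply: psdD => //; apply: psdZ => //; exact: ltW.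
    congr (S _ - _).
    by rewrite scalerDr scalerA -rmorphM /= mulVf ?gt_eqF // rmorph1 scale1r addrC.
  exists (s^-1)%:C, (w s), ((s^-1)%:C *: w s - S y); split.
  - by move=> ? ? ? ?; exact: cross.
  - by rewrite opprB addrC subrK.
  rewrite wE addrAC; apply: le_lt_trans (mND _ _) _; rewrite mNN.
  have := hd (y + (s^-1)%:C *: x) (psdD pb (psdZ sV px)).
  rewrite addrAC subrr add0r => /(_ x1) h.
  by rewrite [ltRHS]splitr ltrD.
have Sy0 : S y != 0.
  apply: contra b0 => /eqP h; have : y = 0 by apply: Sinj => //; [exact: psd0 | rewrite h S0].
  by move/outer_eq0 => ->.
have [k [l kl]] : exists k l, S y k l != 0.
  apply: contrapT => nu; move/negP: Sy0; apply; apply/eqP/matrixP => k l; rewrite [RHS]mxE.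
  by apply/eqP; apply: contraT => kl; case: nu; exists k, l.
exists (w 1 k l / S y k l).
have wy : w 1 = (w 1 k l / S y k l) *: S y.
  apply/matrixP => i j; rewrite [RHS]mxE; apply: (mulIf kl).
  by rewrite lim mulrAC divfK // mulrC.
by rewrite -wy w1E [RHS]addrCA subrr addr0.
Qed.

Lemma S_add_outer (l : seq 'cV[C]_q) b :
  S (\sum_(v <- l) outer v + outer b) = S (\sum_(v <- l) outer v) + S (outer b).
Proof.
elim: l b => [|v l IH] b; first by rewrite big_nil add0r S0 add0r.
rewrite big_cons [outer v + _]addrC; set x := \sum_(_ <- _) _ in IH *.
have px : Psd x by apply: psd_sum => i _; exact: outer_psd.
have pv := outer_psd v; have pb := outer_psd b.
have [v0|v0] := eqVneq (outer v) 0; first by rewrite v0 addr0 IH.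
have [h hE] := S_add_outer_scal b (psdD px pv).
have [k kE] := S_add_outer_scal v (psdD px pb).
have [h1|h1] := eqVneq h 1; first by rewrite hE h1 scale1r.
have E : (h - 1) *: S (outer b) = (k - 1) *: S (outer v).
  move: kE; rewrite addrAC hE !IH !scalerBl !scale1r => kE.
  have : S x + S (outer v) + h *: S (outer b) - (S x + S (outer v) + S (outer b)) =
      S x + S (outer b) + k *: S (outer v) - (S x + S (outer v) + S (outer b)) by rewrite kE.
  have aux (A B D F : M) : A + B + D - (A + B + F) = D - F by rewrite opprD addrACA subrr add0r.
  by rewrite aux [S x + S (outer v) + S (outer b)]addrAC aux.
pose c := (k - 1) / (h - 1).
have Ec : S (outer b) = c *: S (outer v).
  by rewrite /c mulrC -scalerA -E scalerA mulVf ?scale1r // subr_eq0.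
have [u u0] : exists u, rq (S (outer v)) u != 0.
  apply: contrapT => nu; move/negP: v0; apply; apply/eqP.
  apply: Sinj => //; first exact: psd0.
  rewrite S0; apply: rq_ext; rewrite ?mxadj0 ?(psd_herm (Spsd pv)) // => u.
  by rewrite rq0; apply/eqP; apply: contraT => hu; case: nu; exists u.
pose t := rq (S (outer b)) u / rq (S (outer v)) u.
have cE : c = t%:C.
  have : bf (S (outer b)) u u = c * bf (S (outer v)) u u.
    by rewrite Ec bfZm.
  rewrite !bf_real ?(psd_herm (Spsd _)) // /t rmorphM fmorphV /= => ->.
  by rewrite mulfK // -(rmorph0 (real_complex R)) (inj_eq (@complexI R)).
have t0 : 0 <= t by rewrite divr_ge0 // psd_rq //; exact: Spsd.
have bE : outer b = t%:C *: outer v.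
  by apply: Sinj => //; [exact: psdZ | rewrite Shom // Ec cE].
have -> : x + outer v + outer b = x + (1 + t)%:C *: outer v.
  by rewrite bE rmorphD rmorph1 scalerDl scale1r addrA.
rewrite bE.
have t1 : 0 <= 1 + t by rewrite addr_ge0.
rewrite outer_scale // IH -outer_scale // IH (Shom t1 pv) (Shom t0 pv).
by rewrite rmorphD scalerDl rmorph1 scale1r addrA.
Qed.

Lemma S_add x y : Psd x -> Psd y -> S (x + y) = S x + S y.
Proof.
move=> px /psd_sum_outer[l ->]; have [k ->] := psd_sum_outer px.
elim: l k => [|b l IH] k; first by rewrite big_nil addr0 S0 addr0.
rewrite !big_cons addrA.
have -> : \sum_(b <- k) outer b + outer b = \sum_(b <- b :: k) outer b by rewrite big_cons addrC.
rewrite IH big_cons [outer b + _]addrC S_add_outer -addrA; congr (_ + _).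
by rewrite [outer b + _]addrC S_add_outer addrC.
Qed.

Lemma S_outer b : exists c, S (outer b) = outer c.
Proof.
have [->|b0] := eqVneq b 0; first by exists 0; rewrite outer0 S0.
by have [c] := increment_outer (psd0 R q) b0; rewrite add0r S0 subr0 => h; exists c.
Qed.

Lemma S1_pd : pd (S 1%:M).
Proof.
apply/pdP; split; first exact/psd_herm/Spsd/psd1.
move=> u u0; rewrite lt_def psd_rq ?andbT; last exact/Spsd/psd1.
apply: contra u0 => /eqP h0.
have pu := outer_psd u.
have [t t0 le] := psd_bounded (Upsd pu).
have := Smono (Upsd pu) (psdZ t0 (psd1 R q)) le.
rewrite SU // Shom //; last exact: psd1.
move/(psd_rq u); rewrite rqB rqZ h0 mulr0 sub0r rq_outer oppr_ge0 => le0.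
have : normc ((u^h *m u) 0 0) ^+ 2 = 0 by apply/le_anti; rewrite le0 sqr_ge0.
move/eqP; rewrite sqrf_eq0 => /eqP /eq0_normc h.
apply/eqP/rq1_eq0; by rewrite rqE mulmx1 h.
Qed.
End Additivity.

(** * Additive maps that preserve rank one and fix the diagonal matrix units *)

Section Classification.
Variables (R : realType) (q : nat).
Local Notation C := (R[i]).
Local Notation M := ('M[C]_q).
Local Notation E i j := (delta_mx i j : M).
Variables F : M -> M.
Hypothesis Fpsd : forall x, Psd x -> Psd (F x).
Hypothesis Fhom : forall (k : R) x, 0 <= k -> Psd x -> F (k%:C *: x) = k%:C *: F x.
Hypothesis Fadd : forall x y, Psd x -> Psd y -> F (x + y) = F x + F y.
Hypothesis Frank : forall b : 'cV[C]_q, exists c : 'cV[C]_q, F (outer b) = outer c.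
Hypothesis Fdiag : forall i, F (E i i) = E i i.

(* The real-linear extension of [F] to Hermitian matrices, through [4 x = (1 + x)^2 - (1 - x)^2]. *)
Definition herm_ext (x : M) : M :=
  (4^-1)%:C *: (F ((1%:M + x) *m (1%:M + x)) - F ((1%:M - x) *m (1%:M - x))).
Local Notation L := herm_ext.

Lemma sqr1D_psd (x : M) : x^h = x -> Psd ((1%:M + x) *m (1%:M + x)).
Proof. by move=> hx; apply: psd_sqr; rewrite mxadjD mxadj1 hx. Qed.

Lemma sqr1B_psd (x : M) : x^h = x -> Psd ((1%:M - x) *m (1%:M - x)).
Proof. by move=> hx; apply: psd_sqr; rewrite mxadjB mxadj1 hx. Qed.

Lemma herm_quarter (x : M) : x =
  (4^-1)%:C *: ((1%:M + x) *m (1%:M + x)) - (4^-1)%:C *: ((1%:M - x) *m (1%:M - x)).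
Proof.
rewrite -scalerBr !mulmxDl !mulmxDr !mulNmx !mulmxN !mul1mx !mulmx1 opprK.
have -> : 1%:M + x + (x + x *m x) - (1%:M - x + (- x + x *m x)) = 4%:R *: x.
  rewrite !opprD !opprK scaler_nat !mulrSr mulr0n add0r.
  apply/matrixP => i j; rewrite !mxE; ring.
rewrite scalerA.
have -> : (4^-1)%:C * 4%:R = 1 :> C.
  by rewrite -(rmorph_nat (real_complex R)) -rmorphM /= mulVf ?rmorph1 // pnatr_eq0.
by rewrite scale1r.
Qed.

(** Two representations A - B = x - y by positive semidefinite matrices give A + y = B + x, and
    additivity of F there shows that the extension does not depend on the choice. *)
Lemma herm_ext_sub x y : Psd x -> Psd y -> L (x - y) = F x - F y.
Proof.
move=> px py; have hh : (x - y)^h = x - y by rewrite mxadjB !psd_herm.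
have k0 : 0 <= 4^-1 :> R by rewrite invr_ge0.
have p1 := sqr1D_psd hh; have p2 := sqr1B_psd hh.
rewrite /L scalerBr -!Fhom //.
have := herm_quarter (x - y); move: (psdZ k0 p1) (psdZ k0 p2).
move: (_ *: _) (_ *: _) => B A pA pB AB.
have : A + y = B + x by rewrite -[A](subrK B) -AB addrAC subrK addrC.
move/(congr1 F); rewrite !Fadd // => h.
apply/eqP; rewrite subr_eq addrAC eq_sym subr_eq eq_sym; apply/eqP.
by rewrite h addrC.
Qed.

Lemma herm_split (x : M) : x^h = x -> exists a b, [/\ Psd a, Psd b & x = a - b].
Proof.
move=> hx; have k0 : 0 <= 4^-1 :> R by rewrite invr_ge0.
exists ((4^-1)%:C *: ((1%:M + x) *m (1%:M + x))), ((4^-1)%:C *: ((1%:M - x) *m (1%:M - x))).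
split; [apply: psdZ => //; exact: sqr1D_psd|apply: psdZ => //; exact: sqr1B_psd|].
exact: herm_quarter.
Qed.

Lemma F0 : F 0 = 0.
Proof. by have := Fhom (lexx 0) (psd0 R q); rewrite !scale0r. Qed.

Lemma herm_ext_psd x : Psd x -> L x = F x.
Proof. by move=> px; rewrite -{1}[x]subr0 herm_ext_sub ?F0 ?subr0 //; exact: psd0. Qed.

Lemma herm_ext_add x y : x^h = x -> y^h = y -> L (x + y) = L x + L y.
Proof.
move=> /herm_split[a [b [pa pb ->]]] /herm_split[c [d [pc pd ->]]].
rewrite [a - b + _]addrACA -opprD !herm_ext_sub ?Fadd //; try exact: psdD.
by rewrite opprD addrACA.
Qed.

Lemma herm_ext_scale (k : R) x : x^h = x -> L (k%:C *: x) = k%:C *: L x.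
Proof.
move=> /herm_split[a [b [pa pb ->]]]; rewrite herm_ext_sub //.
have [k0|k0] := lerP 0 k.
  by rewrite scalerBr herm_ext_sub ?Fhom ?scalerBr //; exact: psdZ.
have k1 : 0 <= - k by rewrite oppr_ge0 ltW.
have -> : k%:C *: (a - b) = (- k)%:C *: b - (- k)%:C *: a.
  by rewrite -scalerBr rmorphN scaleNr -scalerN opprB.
by rewrite herm_ext_sub ?Fhom //; [rewrite -scalerBr rmorphN scaleNr -scalerN opprB | exact: psdZ | exact: psdZ].
Qed.

Lemma herm_ext_herm x : x^h = x -> (L x)^h = L x.
Proof.
move=> /herm_split[a [b [pa pb ->]]]; rewrite herm_ext_sub // mxadjB.
by rewrite !psd_herm //; exact: Fpsd.
Qed.

Lemma herm_ext_sum I (r : seq I) (P : pred I) (G : I -> M) :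
  (forall i, (G i)^h = G i) -> L (\sum_(i <- r | P i) G i) = \sum_(i <- r | P i) L (G i).
Proof.
move=> hG; elim: r => [|i r IH]; first by rewrite !big_nil herm_ext_psd ?F0 //; exact: psd0.
rewrite !big_cons; case: ifP => // _; rewrite herm_ext_add ?IH //.
by rewrite mxadj_sum; apply: eq_bigr.
Qed.

Lemma mxadj_delta i j : (E i j)^h = E j i.
Proof. by apply/matrixP => k l; rewrite mxadjE !mxE rmorph_nat andbC. Qed.

Definition H i j (z : C) : M := z *: E i j + z^*%C *: E j i.

Lemma H_herm i j z : (H i j z)^h = H i j z.
Proof. by rewrite /H mxadjD !mxadjZ !mxadj_delta conjcK addrC. Qed.

Lemma H_sym i j z : H i j z = H j i z^*%C.
Proof. by rewrite /H conjcK addrC. Qed.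

Lemma HD i j z w : H i j (z + w) = H i j z + H i j w.
Proof. by rewrite /H rmorphD !scalerDl addrACA. Qed.

Lemma HZ i j (k : R) z : H i j (k%:C * z) = k%:C *: H i j z.
Proof. by rewrite /H conjcZr -!scalerA scalerDr. Qed.

Lemma E_diag_psd i : Psd (E i i).
Proof.
have -> : E i i = outer (ecol R i); last exact: outer_psd.
by apply/matrixP => k l; rewrite outerE !mxE !andbT rmorph_nat -natrM mulnb.
Qed.

Lemma outer_pair i j z (t : R) :
  outer (ecol R i + (t%:C * z^*%C) *: ecol R j) =
  E i i + (t ^+ 2 * normc z ^+ 2)%:C *: E j j + t%:C *: H i j z.
Proof.
apply/matrixP => k l; rewrite outerE /H !(addmxE, scalemxE, deltamxE) !eqxx !andbT.
have -> : (t ^+ 2 * normc z ^+ 2)%:C = t%:C * t%:C * (z * z^*%C) :> C.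
  by rewrite mul_conj_normc expr2 !rmorphM.
have hc : (t%:C * z^*%C * (l == j)%:R)^*%C = t%:C * z * (l == j)%:R.
  by rewrite conjcM conjcZr conjcK conjc_nat.
rewrite conjcD hc !conjc_nat -!mulnb !natrM; ring.
Qed.

Lemma Fpair i j z (t : R) :
  F (outer (ecol R i + (t%:C * z^*%C) *: ecol R j)) =
  E i i + (t ^+ 2 * normc z ^+ 2)%:C *: E j j + t%:C *: L (H i j z).
Proof.
have n0 : 0 <= t ^+ 2 * normc z ^+ 2 by rewrite mulr_ge0 ?sqr_ge0.
rewrite -herm_ext_psd; last exact: outer_psd.
have hE k : (E k k)^h = E k k by rewrite mxadj_delta.
rewrite outer_pair herm_ext_add; [|by rewrite mxadjD mxadjZr !hE|by rewrite mxadjZr H_herm].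
rewrite herm_ext_add; [|by rewrite hE|by rewrite mxadjZr hE].
rewrite (herm_ext_scale _ (hE j)) (herm_ext_scale _ (H_herm i j z)).
by rewrite (herm_ext_psd (E_diag_psd i)) (herm_ext_psd (E_diag_psd j)) !Fdiag.
Qed.

Lemma Fpair_diag i j k z (t : R) :
  0 <= (i == k)%:R + t ^+ 2 * normc z ^+ 2 * (j == k)%:R + t * complex.Re (L (H i j z) k k).
Proof.
have := psd_rq (ecol R k) (Fpsd (outer_psd (ecol R i + (t%:C * z^*%C) *: ecol R j))).
rewrite Fpair rq_ecol !addmxE !scalemxE !raddfD /= !ReZ !deltamxE !andbb.
by rewrite ![k == _]eq_sym; case: (i == k); case: (j == k).
Qed.

Lemma quad_lin0 (a c : R) : 0 <= a -> (forall t : R, 0 <= t ^+ 2 * a + t * c) -> c = 0.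
Proof.
move=> a0 h; have [->//|c0] := eqVneq c 0.
have a1 : a + 1 != 0 by rewrite gt_eqF // ltr_wpDl.
have := h (- c / (a + 1)).
have -> : (- c / (a + 1)) ^+ 2 * a + - c / (a + 1) * c = - (c ^+ 2 / (a + 1) ^+ 2) by field.
rewrite oppr_ge0 pmulr_lle0 ?invr_gt0 ?exprn_gt0 ?ltr_wpDl // => h2.
by apply/eqP; rewrite -sqrf_eq0; apply/eqP/le_anti; rewrite h2 sqr_ge0.
Qed.

Lemma lin0 (a c : R) : 0 <= a -> (forall t : R, 0 <= a + t * c) -> c = 0.
Proof.
move=> a0 h; apply: (@quad_lin0 a) => // t.
have [->|t0] := eqVneq t 0; first by rewrite expr0n /= !mul0r addr0.
have -> : t ^+ 2 * a + t * c = t ^+ 2 * (a + t^-1 * c) by field.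
by rewrite mulr_ge0 ?sqr_ge0.
Qed.

(** The diagonal entry of the image of a rank one matrix is a polynomial in t that is nonnegative
    for all real t. It has the form 1 + t c, t^2 |z|^2 + t c or t c, and each forces c = 0. *)
Lemma L_diag_re i j k z : i != j -> complex.Re (L (H i j z) k k) = 0.
Proof.
move=> ij; have h t := Fpair_diag i j k z t.
have [ik|ik] := eqVneq i k.
  apply: (@lin0 1) => // t; have := h t; rewrite ik eqxx -ik eq_sym (negbTE ij) mulr0 addr0.
  by rewrite ik.
have [jk|jk] := eqVneq j k.
  apply: (@quad_lin0 (normc z ^+ 2)); first exact: sqr_ge0.
  by move=> t; have := h t; rewrite (negbTE ik) jk eqxx mulr1 add0r.
apply: (@lin0 0) => // t; have := h t.
by rewrite (negbTE ik) (negbTE jk) mulr0 !add0r.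
Qed.

Lemma herm_diag (x : M) k : x^h = x -> x k k = (complex.Re (x k k))%:C.
Proof.
move/matrixP/(_ k k); rewrite mxadjE; case: (x k k) => a b /= [] h; congr (_ +i* _).
by apply/eqP; rewrite -eqNr; apply/eqP.
Qed.

Lemma L_diag i j k z : i != j -> L (H i j z) k k = 0.
Proof.
move=> ij; rewrite herm_diag; last by apply: herm_ext_herm; exact: H_herm.
by rewrite L_diag_re.
Qed.

Lemma Fpair1 i j z : exists b : 'cV[C]_q,
  E i i + (normc z ^+ 2)%:C *: E j j + L (H i j z) = outer b.
Proof.
have [b] := Frank (ecol R i + (1%:C * z^*%C) *: ecol R j).
by rewrite Fpair rmorph1 scale1r expr1n mul1r => h; exists b.
Qed.

(** The image b b^* of the rank one matrix has a zero k-th diagonal entry, so b k = 0 and the whole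
    k-th column vanishes. *)
Lemma L_off i j k l z : i != j -> k != i -> k != j -> L (H i j z) l k = 0.
Proof.
move=> ij ki kj; have [b hb] := Fpair1 i j z.
have bk : b k 0 = 0.
  have := congr1 (fun m : M => m k k) hb; rewrite outerE mul_conj_normc.
  rewrite !addmxE L_diag // !scalemxE !deltamxE (negbTE ki) (negbTE kj) /= mulr0 !addr0.
  by case=> /esym/eqP; rewrite sqrf_eq0 => /eqP; exact: eq0_normc.
have := congr1 (fun m : M => m l k) hb; rewrite outerE bk conjc0 mulr0.
rewrite !addmxE !scalemxE !deltamxE (negbTE ki) (negbTE kj) !andbF mulr0 !add0r.
by [].
Qed.

(** By [L_H] this single entry describes the whole image of [H i j z]; it is a real-linear isometry
    of C in z. *)
Definition alpha i j (z : C) : C := L (H i j z) i j.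

Lemma L_H i j z : i != j -> L (H i j z) = H i j (alpha i j z).
Proof.
move=> ij; have hL : (L (H i j z))^h = L (H i j z) by apply: herm_ext_herm; exact: H_herm.
have dg k := L_diag k z ij; have off k l := @L_off i j k l z ij.
rewrite /alpha; move: (L _) hL dg off => N hL dg off.
apply/matrixP => k l; rewrite /H !addmxE !scalemxE !deltamxE.
have [ki|ki] := eqVneq k i.
  have [lj|lj] := eqVneq l j.
    by rewrite ki lj (negbTE ij) /= mulr1 mulr0 addr0.
  rewrite /= mulr0 add0r ki (negbTE ij) /= mulr0.
  have [->|li] := eqVneq l i; first by rewrite dg.
  by rewrite off.
rewrite /= mulr0 add0r.
have [kj|kj] := eqVneq k j; last first.
  by rewrite /= mulr0 -hL mxadjE off // conjc0.
have [li|li] := eqVneq l i; first by rewrite /= mulr1 kj li -{1}hL mxadjE.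
rewrite /= mulr0 kj; have [->|lj] := eqVneq l j; first by rewrite dg.
by rewrite off.
Qed.

(** The image has rank one with diagonal entries 1 and |z|^2 at i and j; vanishing of its 2 by 2
    minor gives the modulus of the off-diagonal entry. *)
Lemma alpha_norm i j z : i != j -> normc (alpha i j z) = normc z.
Proof.
move=> ij; have [b hb] := Fpair1 i j z.
have dg k := L_diag k z ij.
rewrite /alpha; move: (L _) hb dg => N hb dg.
have e k l := congr1 (fun m : M => m k l) hb.
have eij := e i j; have eii := e i i; have ejj := e j j.
move: eij eii ejj; rewrite /= !outerE !addmxE !dg !scalemxE !deltamxE.
rewrite !eqxx (negbTE ij) eq_sym (negbTE ij) /= !mulr0 !mulr1 !addr0 !add0r.
rewrite !mul_conj_normc => -> [h1] [h2].
rewrite normcM normc_conj; apply/eqP.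
rewrite -(@eqrXn2 _ 2) ?mulr_ge0 ?normc_ge0 //.
by rewrite exprMn -h1 -h2 mul1r.
Qed.

Lemma alphaD i j z w : alpha i j (z + w) = alpha i j z + alpha i j w.
Proof. by rewrite /alpha HD herm_ext_add ?H_herm // mxE. Qed.

Lemma alphaZ i j (k : R) z : alpha i j (k%:C * z) = k%:C * alpha i j z.
Proof. by rewrite /alpha HZ herm_ext_scale ?H_herm // mxE. Qed.

Lemma alpha_sym i j z : alpha j i z^*%C = (alpha i j z)^*%C.
Proof.
rewrite /alpha -H_sym -mxadjE herm_ext_herm //; exact: H_herm.
Qed.

Lemma half_double (z : C) : (2^-1)%:C * (z + z) = z.
Proof.
have -> : z + z = (2 : R)%:C * z by rewrite rmorph_nat mulr_natl mulr2n.
by rewrite mulrA -rmorphM /= mulVf ?pnatr_eq0 // rmorph1 mul1r.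
Qed.

(** Every off-diagonal pair is met twice and [H] doubles a real diagonal entry, whence the factor
    1/2. *)
Lemma herm_decomp x : x^h = x -> x = \sum_i \sum_l (2^-1)%:C *: H i l (x i l).
Proof.
move=> hx; apply/matrixP => a b; rewrite summxE.
under eq_bigr do rewrite summxE.
have t i l : ((2^-1)%:C *: H i l (x i l)) a b =
   (2^-1)%:C * (x i l * ((a == i) && (b == l))%:R) + (2^-1)%:C * ((x i l)^*%C * ((a == l) && (b == i))%:R).
  by rewrite /H !mxE mulrDr.
under eq_bigr do under eq_bigr do rewrite t.
under eq_bigr do rewrite big_split /=.
rewrite big_split /= (bigD1 a) //= (bigD1 b) //= !eqxx big1 ?addr0; last first.
  by move=> l lb; rewrite [b == l]eq_sym (negbTE lb) !mulr0.
rewrite big1 ?addr0; last first.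
  by move=> i ia; rewrite big1 // => l _; rewrite [a == i]eq_sym (negbTE ia) !mulr0.
rewrite (bigD1 b) //= (bigD1 a) //= !eqxx big1 ?addr0; last first.
  by move=> l la; rewrite [a == l]eq_sym (negbTE la) !mulr0.
rewrite big1 ?addr0; last first.
  by move=> i ib; rewrite big1 // => l _; rewrite [b == i]eq_sym (negbTE ib) andbF !mulr0.
by rewrite !mulr1 -mxadjE hx -mulrDr half_double.
Qed.

Lemma L_entries x : x^h = x ->
  L x = \matrix_(j, k) (if j == k then x j j else alpha j k (x j k)).
Proof.
move=> hx; set y : M := \matrix_(_, _) _.
have hH i l : ((2^-1)%:C *: H i l (x i l))^h = (2^-1)%:C *: H i l (x i l) by rewrite mxadjZr H_herm.
have hy i l : L (H i l (x i l)) = H i l (y i l).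
  rewrite mxE; case: eqVneq => [<-|il]; last exact: L_H.
  rewrite /H -mxadjE hx -scalerDl.
  have -> : x i i + x i i = (complex.Re (x i i) + complex.Re (x i i))%:C.
    by rewrite rmorphD /= -herm_diag.
  rewrite herm_ext_scale ?mxadj_delta // herm_ext_psd ?Fdiag //; exact: E_diag_psd.
have yh : y^h = y.
  apply/matrixP => a b; rewrite mxadjE !mxE eq_sym; case: eqVneq => [->|ab].
    by rewrite -mxadjE hx.
  by rewrite -alpha_sym -mxadjE hx.
rewrite {1}(herm_decomp hx) herm_ext_sum; last by move=> i; rewrite mxadj_sum; apply: eq_bigr.
rewrite [RHS](herm_decomp yh); apply: eq_bigr => i _.
rewrite herm_ext_sum //; apply: eq_bigr => l _.
by rewrite herm_ext_scale ?H_herm // hy.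
Qed.

Variable o : 'I_q.

(** Take the vector with entries 1, z, w at o, j, k. Its image is some c c^* with |c o| = 1, and the
    entry at (j, k) is the product of those at (j, o) and (o, k). *)
Lemma alpha_cocycle j k (z w : C) : j != o -> k != o -> j != k ->
  alpha j k (z * w^*%C) = alpha j o z * (alpha k o w)^*%C.
Proof.
move=> jo ko jk.
pose b : 'cV[C]_q := \col_i (if i == o then 1 else if i == j then z else if i == k then w else 0).
have [c hc] := Frank b.
have e i l : outer c i l = if i == l then outer b i i else alpha i l (outer b i l).
  by rewrite -hc -herm_ext_psd ?L_entries ?mxE ?(psd_herm (outer_psd b)) //; exact: outer_psd.
have ejk := e j k; have ejo := e j o; have eok := e o k; have eoo := e o o.
move: ejk ejo eok eoo; rewrite (negbTE jk) (negbTE jo) eqxx eq_sym (negbTE ko) !outerE !mxE.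
rewrite !eqxx (negbTE jo) (negbTE ko) eq_sym (negbTE jk) !rmorph1 !mulr1 mul1r alpha_sym.
move=> <- <- <- h.
rewrite [RHS](_ : _ = c j 0 * (c k 0)^*%C * (c o 0 * (c o 0)^*%C)); last by ring.
by rewrite h mulr1.
Qed.

Lemma alpha_real_lin i j (z : C) :
  alpha i j z = (complex.Re z)%:C * alpha i j 1 + (complex.Im z)%:C * alpha i j 'i%C.
Proof.
case: z => a b /=; have -> : a +i* b = a%:C * 1 + b%:C * 'i%C.
  by apply/eqP; rewrite eq_complex /= !mulr0 !mul0r !mulr1 !subr0 !addr0 add0r !eqxx.
by rewrite alphaD !alphaZ.
Qed.

(** The condition on c + d says that c and d are orthogonal as vectors of R^2. The number t below is
    their determinant, which is then 1 or -1. *)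
Lemma unit_isometry (c d : C) : normc c = 1 -> normc d = 1 -> normc (c + d) ^+ 2 = 2 ->
  d = 'i%C * c \/ d = - ('i%C * c).
Proof.
case: c => a b; case: d => e f /= h1 h2 h3.
have g1 : a ^+ 2 + b ^+ 2 = 1 by rewrite -[LHS]sqr_sqrtr ?addr_ge0 ?sqr_ge0 // h1 expr1n.
have g2 : e ^+ 2 + f ^+ 2 = 1 by rewrite -[LHS]sqr_sqrtr ?addr_ge0 ?sqr_ge0 // h2 expr1n.
have g3 : (a + e) ^+ 2 + (b + f) ^+ 2 = 2 by rewrite -[LHS]sqr_sqrtr ?addr_ge0 ?sqr_ge0.
have g4 : a * e + b * f = 0 by lra.
have g5 : (a * f - b * e) ^+ 2 = 1.
  have -> : (a * f - b * e) ^+ 2 = (a ^+ 2 + b ^+ 2) * (e ^+ 2 + f ^+ 2) - (a * e + b * f) ^+ 2 by ring.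
  by rewrite g1 g2 g4 expr0n /= mulr1 subr0.
set t := a * f - b * e in g5.
have ef : e = - b * t /\ f = a * t.
  split.
    have -> : e = e * (a ^+ 2 + b ^+ 2) by rewrite g1 mulr1.
    have -> : e * (a ^+ 2 + b ^+ 2) = - b * t + a * (a * e + b * f) by rewrite /t; ring.
    by rewrite g4 mulr0 addr0.
  have -> : f = f * (a ^+ 2 + b ^+ 2) by rewrite g1 mulr1.
  have -> : f * (a ^+ 2 + b ^+ 2) = a * t + b * (a * e + b * f) by rewrite /t; ring.
  by rewrite g4 mulr0 addr0.
case: ef => -> ->.
have /orP[/eqP -> | /eqP ->] : (t == 1) || (t == -1) by rewrite -sqrf_eq1 g5.
  by left; apply/eqP; rewrite eq_complex /= !mul0r !mul1r !mulr1 sub0r add0r !eqxx.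
by right; apply/eqP; rewrite eq_complex /= !mul0r !mul1r !mulrN1 sub0r add0r opprK !eqxx.
Qed.

Lemma beta_i j : j != o -> alpha j o 'i%C = 'i%C * alpha j o 1 \/ alpha j o 'i%C = - ('i%C * alpha j o 1).
Proof.
move=> jo; have n1 : normc (1 : C) = 1 by rewrite normc1.
have ni : normc ('i%C : C) = 1 by rewrite /= expr0n expr1n /= add0r sqrtr1.
apply: unit_isometry; rewrite ?alpha_norm // -alphaD alpha_norm //=.
by rewrite addr0 add0r expr1n sqr_sqrtr // addr_ge0.
Qed.

(** The cocycle at (z, w) = ('i, 1) and at (1, -'i) evaluates [alpha j k 'i] in two ways; one linear
    and one conjugate-linear factor would give opposite nonzero values. *)
Lemma beta_i_same j k : j != o -> k != o ->
  alpha j o 'i%C = 'i%C * alpha j o 1 -> alpha k o 'i%C = 'i%C * alpha k o 1.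
Proof.
move=> jo ko hj; have [->//|jk] := eqVneq k j.
case: (beta_i ko) => // hk; exfalso.
have kj : j != k by rewrite eq_sym.
have c1 := alpha_cocycle 'i%C 1 jo ko kj.
have c2 := alpha_cocycle 1 (- 'i%C) jo ko kj.
have nz i : i != o -> alpha i o 1 != 0.
  move=> io; apply: contraTneq isT => h0.
  have := alpha_norm 1 io; rewrite h0 normc0 normc1 => /eqP; by rewrite eq_sym oner_eq0.
have ci : (- 'i%C : C)^*%C = 'i%C by apply/eqP; rewrite eq_complex /= oppr0 opprK !eqxx.
have ci2 : ('i%C : C)^*%C = - 'i%C by apply/eqP; rewrite eq_complex /= oppr0 !eqxx.
have aN : alpha k o (- 'i%C) = - alpha k o 'i%C.
  by rewrite -mulN1r -[X in _ = - X]mul1r -mulNr -(rmorph1 (real_complex R)) -rmorphN alphaZ.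
move: c1 c2; rewrite rmorph1 mulr1 mul1r ci => -> .
rewrite aN hk opprK conjcM ci2 hj => /eqP.
rewrite -subr_eq0 [X in X == 0](_ : _ = ('i%C + 'i%C) * (alpha j o 1 * (alpha k o 1)^*%C)); last by ring.
rewrite !mulf_eq0 conjc_eq0 (negbTE (nz _ jo)) (negbTE (nz _ ko)) !orbF.
by rewrite eq_complex /= addr0 eqxx /= -mulr2n pnatr_eq0.
Qed.

Definition phase (j : 'I_q) : C := if j == o then 1 else alpha j o 1.

Lemma phase_neq0 j : phase j != 0.
Proof.
rewrite /phase; case: (eqVneq j o) => [_|jo]; first by rewrite oner_eq0.
apply: contraTneq isT => h0.
by have := alpha_norm 1 jo; rewrite h0 normc0 normc1 => /eqP; rewrite eq_sym oner_eq0.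
Qed.

Lemma phase_norm j : phase j * (phase j)^*%C = 1.
Proof.
rewrite mul_conj_normc /phase; case: eqVneq => [_|jo]; rewrite ?alpha_norm // normc1 expr1n rmorph1 //.
Qed.

(** Here g stands for the identity or the conjugation; the cocycle spreads the formula from the
    pairs (j, o) to all pairs. *)
Lemma alpha_phase (g : C -> C) : (forall z, g z^*%C = (g z)^*%C) -> g 1 = 1 ->
  (forall j z, j != o -> alpha j o z = phase j * g z) ->
  forall j k z, j != k -> alpha j k z = phase j * (phase k)^*%C * g z.
Proof.
move=> gc g1 h j k z jk.
have [jo|jo] := eqVneq j o.
  have ko : k != o by rewrite -jo eq_sym.
  have -> : alpha j k z = (alpha k o z^*%C)^*%C by rewrite jo -alpha_sym conjcK.
  by rewrite h // conjcM gc conjcK jo /phase eqxx mul1r.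
have [ko|ko] := eqVneq k o; first by rewrite ko h // /phase eqxx rmorph1 mulr1.
have := alpha_cocycle z 1 jo ko jk; rewrite rmorph1 mulr1 => ->.
by rewrite !h // g1 mulr1 mulrAC.
Qed.

Theorem additive_cone_map : exists d : 'rV[C]_q, (forall j, d 0 j != 0) /\
  ((forall x, Psd x -> F x = diag_mx d *m x *m (diag_mx d)^h) \/
   (forall x, Psd x -> F x = diag_mx d *m x^T *m (diag_mx d)^h)).
Proof.
exists (\row_j phase j); split; first by move=> j; rewrite mxE phase_neq0.
have entry (x : M) j k : (diag_mx (\row_j phase j) *m x *m (diag_mx (\row_j phase j))^h) j k =
    phase j * (phase k)^*%C * x j k.
  by rewrite mxadj_diag mul_mx_diag mul_diag_mx !mxE mulrAC.
have main (g : C -> C) : (forall z, g z^*%C = (g z)^*%C) -> g 1 = 1 ->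
    (forall a : R, g a%:C = a%:C) ->
    (forall j z, j != o -> alpha j o z = phase j * g z) ->
    forall x, Psd x -> forall j k, F x j k = phase j * (phase k)^*%C * g (x j k).
  move=> gc g1 gr h x px j k; rewrite -herm_ext_psd // L_entries ?psd_herm // mxE.
  case: eqVneq => [<-|jk]; last exact: alpha_phase.
  by rewrite phase_norm mul1r (herm_diag j (psd_herm px)) gr.
(* By [beta_i_same] the type is the same for all j: as soon as one is not complex linear, none
   is. *)
have [lin|nlin] := pselect (forall j, j != o -> alpha j o 'i%C = 'i%C * alpha j o 1).
  left=> x px; apply/matrixP => j k; rewrite entry.
  apply: (main id) => // i z io; rewrite alpha_real_lin lin // /phase (negbTE io) {3}[z]complexE; ring.
right=> x px; apply/matrixP => j k; rewrite entry.
(* On Hermitian matrices transposition is entrywise conjugation, so conjugate-linear [alpha] yields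
   the second form. *)
have -> : x^T j k = (x j k)^*%C by rewrite mxE -{1}(psd_herm px) mxadjE.
apply: (main (fun z => z^*%C)) => //.
- by rewrite rmorph1.
- by move=> a; rewrite conjc_real.
move=> i z io; rewrite alpha_real_lin.
have -> : alpha i o 'i%C = - ('i%C * alpha i o 1).
  case: (beta_i io) => // hi; case: nlin => l lo; exact: beta_i_same hi.
have -> : z^*%C = (complex.Re z)%:C - 'i%C * (complex.Im z)%:C.
  by rewrite {1}[z]complexE; case: z => a b; apply/eqP; rewrite eq_complex /= !mul0r !mul1r !subr0 !add0r !addr0 ?oppr0 ?sub0r !eqxx.
rewrite /phase (negbTE io); ring.
Qed.
End Classification.

(** * Supports of convolutions of point masses *)

Section Cancel.
Variable V : zmodType.
Implicit Types a b c : V.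

Lemma sub_subl a b c : a - b - (a - c) = c - b.
Proof. by rewrite opprB addrC addrA subrK. Qed.

Lemma sub_subr a b c : a - c - (b - c) = a - b.
Proof. by rewrite opprB addrA subrK. Qed.

Lemma sub_defect a b c k : a - (c - k) - (a + b - c) = k - b.
Proof. by rewrite !opprB [a + (k - c)]addrA addrA subrK opprD addrACA subrr add0r. Qed.

Lemma opp_defect a b c k : c - k - b - - (a + b - c) = a - k.
Proof. by rewrite opprK -[c - k - b]addrA [LHS]addrC [LHS]addrA subrK addrACA subrr addr0. Qed.
End Cancel.

Section Contraction.
Variables (R : realType) (q : nat).
Local Notation C := (R[i]).
Local Notation M := ('M[C]_q).
Implicit Types (x y z v w : M).

(** The square of the point at which delta_r * delta_s evaluates a test function, for r = sqrt x and
    s = sqrt y. *)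
Definition conv_arg x y v : M :=
  x + y + msqrt y *m v *m msqrt x + msqrt x *m v^h *m msqrt y.

Lemma inDE v : inD v = pd (1%:M - v^h *m v).
Proof. by []. Qed.

(** With w = v^* u, |w|^2 is the scalar product of u and v w, so |w|^4 <= |u|^2 |v w|^2 <= |u|^2
    |w|^2, and |w|^2 is cancelled. *)
Lemma contraction_adj v : Psd (1%:M - v^h *m v) -> Psd (1%:M - v *m v^h).
Proof.
move=> /psdP[_ h]; apply/psdP; split.
  by rewrite mxadjB mxadj1 mxadjM mxadjK.
have E w u : rq (w *m w^h) u = rq 1%:M (w^h *m u) by rewrite -rq_conj mulmx1.
have hv u : rq 1%:M (v *m u) <= rq 1%:M u.
  by have := h u; rewrite rqB -{2}[v]mxadjK E mxadjK subr_ge0.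
move=> u; rewrite rqB E; set w := v^h *m u.
have E2 : bf 1%:M u (v *m w) = (rq 1%:M w)%:C.
  rewrite -bf_real ?mxadj1 // bf.unlock !mulmx1 /w mxadjM mxadjK !mulmxA //.
have := psd_CS u (v *m w) (psd1 R q); rewrite E2 normc_real.
rewrite real_normK ?num_real // => h2.
have h3 := le_trans h2 (ler_wpM2l (rq1_ge0 u) (hv w)).
have := rq1_ge0 w; rewrite le_eqVlt => /orP[/eqP <-|w0]; first by rewrite subr0 rq1_ge0.
by rewrite subr_ge0 -(ler_pM2r w0) -expr2.
Qed.

Lemma inD_psd v : inD v -> Psd (1%:M - v^h *m v).
Proof. by rewrite inDE => /pd_psd. Qed.

Lemma inD_adj v : inD v -> inD v^h.
Proof.
rewrite !inDE mxadjK => pv.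
apply: psd_unit_pd; first exact/contraction_adj/pd_psd.
have uv := pd_unit pv; apply: unit_ker => u hu.
have e : u = v *m (v^h *m u) by apply/eqP; rewrite -subr_eq0 mulmxA -{1}[u]mul1mx -mulmxBl hu.
have : (1%:M - v^h *m v) *m (v^h *m u) = 0.
  by rewrite mulmxBl mul1mx -mulmxA -e subrr.
move=> h0; have vu : v^h *m u = 0 by rewrite -[LHS]mul1mx -(mulVmx uv) -mulmxA h0 mulmx0.
by rewrite e vu mulmx0.
Qed.

Lemma inD_opp v : inD v -> inD (- v).
Proof. by rewrite !inDE mxadjN mulNmx mulmxN opprK. Qed.

Lemma inD_scalar (t : R) : `|t| < 1 -> inD (t%:C%:M : M).
Proof.
move=> t1; rewrite inDE.
have -> : 1%:M - (t%:C%:M)^h *m t%:C%:M = (1 - t ^+ 2)%:C *: 1%:M :> M.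
  rewrite -[t%:C%:M]scalemx1 mxadjZr mxadj1 -scalemxAl mul1mx scalerA -rmorphM -expr2.
  by rewrite rmorphB rmorph1 scalerBl scale1r.
apply: pdZ; last exact: pd1.
by rewrite subr_gt0 -real_normK ?num_real // expr_lt1.
Qed.

Lemma two_sub_contraction v : Psd (1%:M - v^h *m v) -> Psd ((2 : R)%:C *: 1%:M - (v + v^h)).
Proof.
move=> pv.
have -> : (2 : R)%:C *: 1%:M - (v + v^h) = (1%:M - v^h) *m (1%:M - v^h)^h + (1%:M - v^h *m v).
  rewrite mxadjB mxadj1 mxadjK mulmxBl mulmxBr mul1mx mulmxBr !mulmx1 mul1mx.
  rewrite rmorph_nat scaler_nat mulr2n !opprD !opprK.
  by apply/matrixP => i j; rewrite !mxE; ring.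
by apply: psdD => //; exact: psd_gram.
Qed.

Lemma conv_arg_psd x y v : Psd x -> Psd y -> inD v -> Psd (conv_arg x y v).
Proof.
move=> px py dv.
have hx := psd_herm (msqrt_psd px); have hy := psd_herm (msqrt_psd py).
have kx := msqrtK px; have ky := msqrtK py.
rewrite /conv_arg; move: (msqrt x) (msqrt y) hx hy kx ky => a b ha hb <- <-.
have -> : a *m a + b *m b + b *m v *m a + a *m v^h *m b =
   (b *m v + a) *m (b *m v + a)^h + b *m (1%:M - v *m v^h) *m b^h.
  rewrite mxadjD mxadjM ha hb !mulmxDl !mulmxDr !mulmxDl mulmxN mulNmx mulmx1 !mulmxA.
  by apply/matrixP => i j; rewrite !addmxE oppmxE; ring.
apply: psdD; first exact: psd_gram.
apply: psd_conj; apply: contraction_adj; exact: inD_psd.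
Qed.

Lemma conv_arg_opp x y v : conv_arg x y (- v) = (2 : R)%:C *: (x + y) - conv_arg x y v.
Proof.
rewrite /conv_arg mxadjN !mulmxN !mulNmx rmorph_nat scaler_nat mulr2n.
move: (_ *m _ *m _) (_ *m _ *m _) => a b.
by apply/matrixP => i j; rewrite !(addmxE, oppmxE); ring.
Qed.

Lemma msqrtZ (a : R) x : 0 <= a -> Psd x -> msqrt ((a ^+ 2)%:C *: x) = a%:C *: msqrt x.
Proof.
move=> a0 px; apply: msqrt_eq; first exact/psdZ/msqrt_psd.
by rewrite -scalemxAl -scalemxAr scalerA msqrtK // expr2 rmorphM.
Qed.

Lemma conv_argZ (a b : R) x v : 0 <= a -> 0 <= b -> Psd x ->
  conv_arg ((a ^+ 2)%:C *: x) ((b ^+ 2)%:C *: x) v =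
  (a ^+ 2 + b ^+ 2)%:C *: x + (a * b)%:C *: (msqrt x *m (v + v^h) *m msqrt x).
Proof.
move=> a0 b0 px; rewrite /conv_arg !msqrtZ // rmorphD scalerDl -addrA; congr (_ + _).
rewrite -!scalemxAl -!scalemxAr !scalerA -!rmorphM [b * a]mulrC -scalerDr.
by rewrite mulmxDr mulmxDl.
Qed.

Lemma conv_argZ_upper (a b : R) x v : 0 <= a -> 0 <= b -> Psd x -> inD v ->
  Psd (((a + b) ^+ 2)%:C *: x - conv_arg ((a ^+ 2)%:C *: x) ((b ^+ 2)%:C *: x) v).
Proof.
move=> a0 b0 px dv; rewrite conv_argZ //.
have -> : ((a + b) ^+ 2)%:C *: x - ((a ^+ 2 + b ^+ 2)%:C *: x + (a * b)%:C *: (msqrt x *m (v + v^h) *m msqrt x))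
  = (a * b)%:C *: (msqrt x *m ((2 : R)%:C *: 1%:M - (v + v^h)) *m (msqrt x)^h).
  rewrite (psd_herm (msqrt_psd px)) mulmxBr mulmxBl -scalemxAr mulmx1 -scalemxAl msqrtK //.
  rewrite scalerBr scalerA -rmorphM opprD addrA -scalerBl -rmorphB.
  by congr (_%:C *: _ - _); ring.
apply: psdZ; first exact: mulr_ge0.
by apply: psd_conj; apply: two_sub_contraction; exact: inD_psd.
Qed.

Lemma conv_argZ_lower (a b : R) x v : 0 <= b -> b <= a -> Psd x -> inD v ->
  Psd (conv_arg ((a ^+ 2)%:C *: x) ((b ^+ 2)%:C *: x) v - ((a - b) ^+ 2)%:C *: x).
Proof.
move=> b0 ba px dv; have a0 := le_trans b0 ba.
have := conv_argZ_upper a0 b0 px (inD_opp dv); rewrite conv_arg_opp.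
congr Psd; rewrite -scalerDl scalerA -rmorphD -rmorphM opprB addrCA -scalerBl -rmorphB.
by congr (_ + _); rewrite -[RHS]scaleNr -rmorphN; congr (_%:C *: _); ring.
Qed.

Lemma conv_arg_le4 x v : Psd x -> inD v -> Psd ((4 : R)%:C *: x - conv_arg x x v).
Proof.
move=> px dv; have := conv_argZ_upper ler01 ler01 px dv.
rewrite expr1n rmorph1 scale1r.
by have -> : (1 + 1) ^+ 2 = 4 :> R by ring.
Qed.
End Contraction.

(** * Order intervals, monotonicity and homogeneity *)

Section Step.
Variables (R : realType) (q : nat).
Local Notation C := (R[i]).
Local Notation M := ('M[C]_q).
Variable S : M -> M.
Hypothesis Spsd : forall x, Psd x -> Psd (S x).
Hypothesis Scont : forall x, Psd x -> forall e : R, 0 < e -> exists2 d : R, 0 < d &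
  forall y, Psd y -> mN (y - x) < d -> mN (S y - S x) < e.
Hypothesis Ssupp : forall x y v, Psd x -> Psd y -> inD v -> forall e : R, 0 < e ->
  exists2 v', inD v' & mN (S (conv_arg x y v) - conv_arg (S x) (S y) v') < e.

Lemma shrink_ring (T : comNzRingType) (h k a b c : T) : h * 2 = 1 ->
  c - k * (h * (h * b) - h * a - (h * a - c)) = k * (h * h * (2 * 2 * a - b)) + (1 - k) * c.
Proof.
move=> h2.
have -> : k * (h * h * (2 * 2 * a - b)) + (1 - k) * c =
  (h * 2) * (2 * (k * (h * a))) - k * (h * (h * b)) + (1 - k) * c by ring.
by rewrite h2; ring.
Qed.

(** The map w -> w/2 - 1 carries [0, 4] to [-1, 1], and 1 - (w/2 - 1)^2 = w (4 - w) / 4 is positive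
    semidefinite; the factor t adds the strictly positive (1 - t^2) 1. *)
Lemma shrink_inD (w : M) (t : R) : Psd w -> Psd ((4 : R)%:C *: 1%:M - w) -> 0 <= t -> t < 1 ->
  inD (t%:C *: ((2^-1)%:C *: w - 1%:M)).
Proof.
move=> pw pw4 t0 t1; rewrite inDE.
have hw := psd_herm pw.
rewrite mxadjZr mxadjB mxadjZr mxadj1 hw -scalemxAl -scalemxAr scalerA -rmorphM.
have -> : 1%:M - (t * t)%:C *: (((2^-1)%:C *: w - 1%:M) *m ((2^-1)%:C *: w - 1%:M)) =
  (t * t)%:C *: ((4^-1)%:C *: (msqrt w *m ((4 : R)%:C *: 1%:M - w) *m (msqrt w)^h)) + (1 - t * t)%:C *: 1%:M.
  have E1 : msqrt w *m ((4 : R)%:C *: 1%:M - w) *m (msqrt w)^h = (4 : R)%:C *: w - w *m w.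
    rewrite (psd_herm (msqrt_psd pw)) mulmxBr mulmxBl -scalemxAr mulmx1 -scalemxAl msqrtK //.
    congr (_ - _); rewrite -{2}(msqrtK pw) !mulmxA msqrtK //.
    by rewrite -mulmxA msqrtK.
  rewrite E1.
  rewrite mulmxBl mulmxBr mul1mx mulmx1 -scalemxAl -scalemxAr.
  apply/matrixP => i j; rewrite !(addmxE, oppmxE, scalemxE).
  move: (w i j) ((w *m w) i j) ((1%:M : M) i j) => a b c.
  have -> : (4^-1 : R)%:C = (2^-1)%:C * (2^-1)%:C by rewrite -rmorphM /= -invfM -natrM.
  have h2 : (2^-1 : R)%:C * 2 = 1 by rewrite -(rmorph_nat (real_complex R)) -rmorphM /= mulVf ?rmorph1 // pnatr_eq0.
  rewrite rmorphB rmorph1 rmorph_nat.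
  have -> : 4 = 2 * 2 :> C by rewrite -natrM.
  exact: shrink_ring.
apply: pdD; last first.
  apply: pdZ; last exact: pd1.
  by rewrite subr_gt0 -expr2 expr_lt1.
apply: psdZ; first exact: mulr_ge0.
by apply: psdZ; [rewrite invr_ge0 | exact: psd_conj].
Qed.

(** Conjugation by x^(-1/2) reduces to x = 1. Points of [0, 4x] contracted towards the centre 2x are
    attained exactly, with a Hermitian v. *)
Lemma pd_interval (x z : M) (t : R) : pd x -> Psd z -> Psd ((4 : R)%:C *: x - z) -> 0 <= t -> t < 1 ->
  exists2 v, inD v & conv_arg x x v = (2 : R)%:C *: x + t%:C *: (z - (2 : R)%:C *: x).
Proof.
move=> pdx pz le t0 t1; have px := pd_psd pdx.
have ps := msqrt_psd px; have us : msqrt x \in unitmx.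
  by have := pd_unit pdx; rewrite -{1}(msqrtK px) unitmx_mul => /andP[].
set s := msqrt x in ps us *; pose w := invmx s *m z *m (invmx s)^h.
have hi : (invmx s)^h = invmx s by rewrite mxadj_inv psd_herm.
have ss : s *m s = x by exact: msqrtK.
have pw : Psd w by exact: psd_conj.
have pw4 : Psd ((4 : R)%:C *: 1%:M - w).
  have -> : (4 : R)%:C *: 1%:M - w = invmx s *m ((4 : R)%:C *: x - z) *m (invmx s)^h.
    rewrite mulmxBr mulmxBl; congr (_ - _).
    by rewrite -scalemxAr -scalemxAl -ss hi !mulmxA mulVmx // mul1mx mulmxV.
  exact: psd_conj.
have sws : s *m w *m s = z.
  by rewrite /w hi -!mulmxA mulVmx // mulmx1 !mulmxA mulmxV // mul1mx.
exists (t%:C *: ((2^-1)%:C *: w - 1%:M)); first exact: shrink_inD.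
rewrite /conv_arg -/s mxadjZr mxadjB mxadjZr mxadj1 (psd_herm pw).
rewrite -!scalemxAr -!scalemxAl mulmxBr mulmxBl mulmx1 -scalemxAr -scalemxAl sws ss.
rewrite -addrA -scalerDr; congr (_ + _); first by rewrite rmorph_nat scaler_nat mulr2n.
congr (_ *: _); rewrite addrACA -opprD; congr (_ - _); last by rewrite rmorph_nat scaler_nat mulr2n.
rewrite -scalerDl -rmorphD.
have -> : 2^-1 + 2^-1 = 1 :> R by rewrite -div1r -splitr.
by rewrite rmorph1 scale1r.
Qed.

Lemma interp_sub (x z : M) (t : R) : x + (1 - t)%:C *: (z - x) - z = t%:C *: (x - z).
Proof.
rewrite rmorphB rmorph1 scalerBl scale1r [x + _]addrA [x + (z - x)]addrC subrK addrAC subrr add0r.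
by rewrite -scalerN opprB.
Qed.

(** [pd_interval] needs x invertible and z contracted, so x is increased by a small multiple of 1
    and z is pulled towards the centre; continuity of S at x and at z absorbs both changes. *)
Lemma cone_step (x z : M) : Psd x -> Psd z -> Psd ((4 : R)%:C *: x - z) -> Psd ((4 : R)%:C *: S x - S z).
Proof.
move=> px pz le; apply: psd_closed => e e0.
have e6 : 0 < e / 6 by rewrite divr_gt0.
have e12 : 0 < e / 12 by rewrite divr_gt0.
have [d1 d10 h1] := Scont px e12; have [d2 d20 h2] := Scont pz e6.
have N10 := mN_ge0 (1%:M : M).
pose r := d1 / 2 / (mN (1%:M : M) + 1).
have r0 : 0 < r by rewrite !divr_gt0 // ltr_wpDl.
pose x' := x + r%:C *: 1%:M.
have pdx' : pd x' by apply: pdD => //; apply: pdZ => //; exact: pd1.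
have px' := pd_psd pdx'.
have cx : mN (S x' - S x) < e / 12.
  apply: h1 => //; rewrite /x' addrAC subrr add0r mNZ normc_real gtr0_norm //.
  have rE : r * (mN (1%:M : M) + 1) = d1 / 2 by rewrite /r divfK // gt_eqF // ltr_wpDl.
  apply: le_lt_trans (_ : d1 / 2 < d1); last by rewrite ltr_pdivrMr // ltr_pMr // ltr1n.
  by rewrite -rE ler_pM2l // lerDl.
have lex' : Psd ((4 : R)%:C *: x' - z).
  by rewrite /x' scalerDr addrAC; apply: psdD => //; apply: psdZ => //; apply: psdZ; [exact: ltW | exact: psd1].
pose K := mN ((2 : R)%:C *: x' - z); have K0 : 0 <= K by exact: mN_ge0.
(* A move by the fraction s towards the centre 2 x' displaces z by s K < d2. *)
pose s := d2 / (d2 + K + 1).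
have dK : 0 < d2 + K + 1 by lra.
have s0 : 0 < s by rewrite divr_gt0.
have s1 : s <= 1 by rewrite ler_pdivrMr // mul1r -addrA lerDl addr_ge0.
have t0 : 0 <= 1 - s by rewrite subr_ge0.
have t1 : 1 - s < 1 by rewrite ltrBlDr ltrDl.
have [v dv vE] := pd_interval pdx' pz lex' t0 t1.
set y := conv_arg x' x' v in vE.
have py : Psd y by exact: conv_arg_psd.
have yz : mN (y - z) < d2.
  have -> : y - z = s%:C *: ((2 : R)%:C *: x' - z).
    by rewrite vE interp_sub.
  rewrite mNZ normc_real gtr0_norm // -/K /s mulrAC ltr_pdivrMr // ltr_pM2l //.
  lra.
have c2 := h2 y py yz.
have [v' dv' c3] := Ssupp px' px' dv e6; rewrite -/y in c3.
exists ((4 : R)%:C *: S x' - conv_arg (S x') (S x') v').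
  exact/conv_arg_le4/dv'/Spsd.
set k := conv_arg _ _ v' in c3 *.
have -> : (4 : R)%:C *: S x' - k - ((4 : R)%:C *: S x - S z) =
    (4 : R)%:C *: (S x' - S x) + ((S y - k) - (S y - S z)).
  rewrite scalerBr; move: (_ *: _) (_ *: _) (S z) (S y) => A B D G.
  by apply/matrixP => i j; rewrite !(addmxE, oppmxE); ring.
apply: le_lt_trans (mND _ _) _; rewrite mNZ normc_real ger0_norm //.
apply: le_lt_trans (lerD (lexx _) (mND _ _)) _; rewrite mNN.
apply: lt_le_trans (_ : 4 * (e / 12) + (e / 6 + e / 6) <= _); last by lra.
by apply: ltrD; [rewrite ltr_pM2l | apply: ltrD].
Qed.
End Step.

Lemma squeeze_real (R : realType) (F K N t c e : R) : 0 <= c -> 0 <= t -> 0 < e -> 1 <= N ->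
  0 <= K -> K <= N * t -> N * t < K + 1 -> (2 * t + 1) * c <= N * e ->
  K ^+ 2 * c <= N ^+ 2 * F -> N ^+ 2 * F <= (K + 1) ^+ 2 * c -> `|F - t ^+ 2 * c| <= e.
Proof.
move=> c0 t0 e0 n1 k0 k1 k2 ne A1 A2.
have n0 : 0 < N by lra.
have Nt0 : 0 <= N * t by lra.
have B1 : K ^+ 2 <= (N * t) ^+ 2 by rewrite ler_pXn2r ?nnegrE.
have B2 : (N * t) ^+ 2 <= (K + 1) ^+ 2 by rewrite ler_pXn2r ?nnegrE ?addr_ge0 // ltW.
have B3 : (2 * K + 1) * c <= N * ((2 * t + 1) * c) by rewrite mulrA ler_wpM2r //; lra.
have B4 : N * ((2 * t + 1) * c) <= N ^+ 2 * e by rewrite expr2 -mulrA ler_wpM2l // ltW.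
have B5 := ler_wpM2r c0 B1; have B6 := ler_wpM2r c0 B2.
rewrite -(ler_pM2l (exprn_gt0 2 n0)) -[X in X * `|_|](ger0_norm (sqr_ge0 N)) -normrM.
have E : N ^+ 2 * (F - t ^+ 2 * c) = N ^+ 2 * F - (N * t) ^+ 2 * c by ring.
rewrite E ler_norml; move: A1 A2 B3 B4 B5 B6.
have -> : (K + 1) ^+ 2 * c = K ^+ 2 * c + (2 * K + 1) * c by ring.
by move=> *; apply/andP; split; lra.
Qed.

(** The functional equation gives f (n t) = n^2 f t for integers n; monotonicity replaces continuity
    in the passage to real arguments. *)
Lemma quad_fun_monotone (R : realType) (f : R -> R) :
  (forall a, 0 <= a -> 0 <= f a) ->
  (forall a b, 0 <= a -> a <= b -> f a <= f b) ->
  (forall a b, 0 <= b -> b <= a -> f (a + b) + f (a - b) = 2 * (f a + f b)) ->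
  forall t, 0 <= t -> f t = t ^+ 2 * f 1.
Proof.
move=> f0 fm fq.
have fz : f 0 = 0 by have := fq 0 0 (lexx _) (lexx _); rewrite addr0 subr0; lra.
(* Two consecutive integers are carried along because the recursion has order two. *)
have fn (t : R) : 0 <= t -> forall n : nat, f (n%:R * t) = n%:R ^+ 2 * f t /\ f (n.+1%:R * t) = n.+1%:R ^+ 2 * f t.
  move=> t0; elim => [|n [IH1 IH2]]; first by rewrite mul0r fz expr0n /= mul0r mul1r expr1n mul1r.
  split=> //.
  have tn : t <= n.+1%:R * t by rewrite ler_peMl // ler1n.
  have := fq _ _ t0 tn.
  have -> : n.+1%:R * t + t = n.+2%:R * t by rewrite [n.+2%:R]mulrSr; ring.
  have -> : n.+1%:R * t - t = n%:R * t by rewrite mulrSr; ring.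
  rewrite IH1 IH2 => h.
  have -> : f (n.+2%:R * t) = 2 * (n.+1%:R ^+ 2 * f t + f t) - n%:R ^+ 2 * f t by rewrite -h addrK.
  by rewrite [n.+2%:R]mulrSr !mulrSr; ring.
move=> t t0; apply/eqP; rewrite -subr_eq0 -normr_eq0 eq_le normr_ge0 andbT.
apply/ler_addgt0Pl => e e0; rewrite addr0.
set c := f 1; have c0 : 0 <= c by exact: f0.
(* With k the integer part of n t, monotonicity traps n^2 f t between k^2 c and (k+1)^2 c; this n
   makes the gap (2k+1) c at most n^2 e. *)
pose n := (Num.truncn ((2 * t + 1) * c / e)).+1.
have n0 : 0 < n%:R :> R by rewrite ltr0n.
have n1 : 1 <= n%:R :> R by rewrite ler1n.
have ne : (2 * t + 1) * c <= n%:R * e.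
  by rewrite -ler_pdivrMr // ltW // truncnS_gt.
have nt0 : 0 <= n%:R * t by rewrite mulr_ge0 // ltW.
pose k := Num.truncn (n%:R * t).
have /andP[k1 k2] := truncn_itv nt0; rewrite -/k in k1 k2.
have A1 : k%:R ^+ 2 * c <= n%:R ^+ 2 * f t.
  have := fm _ _ (ler0n _ k) k1; rewrite (fn t t0 n).1.
  by have := (fn 1 ler01 k).1; rewrite mulr1 => ->.
have A2 : n%:R ^+ 2 * f t <= k.+1%:R ^+ 2 * c.
  have := fm _ _ nt0 (ltW k2); rewrite (fn t t0 n).1.
  by have := (fn 1 ler01 k.+1).1; rewrite mulr1 => ->.
have k0 : 0 <= k%:R :> R by rewrite ler0n.
rewrite (mulrSr 1 k) in A2 k2.
exact: (squeeze_real c0 t0 e0 n1 k0 k1 k2 ne A1 A2).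
Qed.

Section OrderIso.
Variables (R : realType) (q : nat).
Local Notation C := (R[i]).
Local Notation M := ('M[C]_q).
Variables S U : M -> M.
Hypothesis Spsd : forall x, Psd x -> Psd (S x).
Hypothesis Upsd : forall x, Psd x -> Psd (U x).
Hypothesis SU : forall x, Psd x -> S (U x) = x.
Hypothesis US : forall x, Psd x -> U (S x) = x.
Hypothesis Scont : forall x, Psd x -> forall e : R, 0 < e -> exists2 d : R, 0 < d &
  forall y, Psd y -> mN (y - x) < d -> mN (S y - S x) < e.
Hypothesis Ucont : forall x, Psd x -> forall e : R, 0 < e -> exists2 d : R, 0 < d &
  forall y, Psd y -> mN (y - x) < d -> mN (U y - U x) < e.
Hypothesis Ssupp : forall x y v, Psd x -> Psd y -> inD v -> forall e : R, 0 < e ->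
  exists2 v', inD v' & mN (S (conv_arg x y v) - conv_arg (S x) (S y) v') < e.
Hypothesis Usupp : forall x y v, Psd x -> Psd y -> inD v -> forall e : R, 0 < e ->
  exists2 v', inD v' & mN (U (conv_arg x y v) - conv_arg (U x) (U y) v') < e.

(** The factor 4 of [cone_step] is removed by using it in both directions. Let S x1 = S y / 4. The
    step for U gives y <= 4 x1, so x <= 4 x1, and the step for S gives S x <= 4 S x1 = S y. *)
Lemma order_mono x y : Psd x -> Psd y -> Psd (y - x) -> Psd (S y - S x).
Proof.
move=> px py le.
have q0 : 0 <= 4^-1 :> R by rewrite invr_ge0.
have four0 : 0 <= 4 :> R by [].
have fK (z : M) : (4 : R)%:C *: ((4^-1)%:C *: z) = z.
  by rewrite scalerA -rmorphM /= mulfV ?rmorph1 ?scale1r // pnatr_eq0.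
have Kf (z : M) : (4^-1)%:C *: ((4 : R)%:C *: z) = z.
  by rewrite scalerA -rmorphM /= mulVf ?rmorph1 ?scale1r // pnatr_eq0.
pose x1 := U ((4^-1)%:C *: S y).
have pS4 : Psd ((4^-1)%:C *: S y) by apply: psdZ => //; exact: Spsd.
have px1 : Psd x1 by exact: Upsd.
have h1 : Psd ((4 : R)%:C *: x1 - U (S y)).
  apply: (cone_step Upsd Ucont Usupp) => //; first exact: Spsd.
  by rewrite fK subrr; exact: psd0.
rewrite US // in h1.
have h2 : Psd ((4 : R)%:C *: x1 - x) by rewrite -(subrK y (_ *: _)) -addrA; exact: psdD.
by have := cone_step Spsd Scont Ssupp px1 px h2; rewrite /x1 SU // fK.
Qed.
End OrderIso.

Section Homogeneity.
Variables (R : realType) (q : nat).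
Local Notation C := (R[i]).
Local Notation M := ('M[C]_q).
Variables S U : M -> M.
Hypothesis Spsd : forall x, Psd x -> Psd (S x).
Hypothesis Upsd : forall x, Psd x -> Psd (U x).
Hypothesis SU : forall x, Psd x -> S (U x) = x.
Hypothesis US : forall x, Psd x -> U (S x) = x.
Hypothesis Scont : forall x, Psd x -> forall e : R, 0 < e -> exists2 d : R, 0 < d &
  forall y, Psd y -> mN (y - x) < d -> mN (S y - S x) < e.
Hypothesis Ssupp : forall x y v, Psd x -> Psd y -> inD v -> forall e : R, 0 < e ->
  exists2 v', inD v' & mN (S (conv_arg x y v) - conv_arg (S x) (S y) v') < e.
Hypothesis Usupp : forall x y v, Psd x -> Psd y -> inD v -> forall e : R, 0 < e ->
  exists2 v', inD v' & mN (U (conv_arg x y v) - conv_arg (U x) (U y) v') < e.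
Hypothesis Smono : forall x y, Psd x -> Psd y -> Psd (y - x) -> Psd (S y - S x).

(** The point z = [conv_arg (S x) (S y) v] need not be S of a support point, but U z is a limit of
    such points; the closed bounds pass to U z, and S is monotone. *)
Lemma image_between (x y m n : M) v : Psd x -> Psd y -> Psd m -> Psd n ->
  (forall w, inD w -> Psd (m - conv_arg x y w) /\ Psd (conv_arg x y w - n)) -> inD v ->
  Psd (S m - conv_arg (S x) (S y) v) /\ Psd (conv_arg (S x) (S y) v - S n).
Proof.
move=> px py pm pn bd dv.
have pSx := Spsd px; have pSy := Spsd py.
set z := conv_arg (S x) (S y) v; have pz : Psd z by exact: conv_arg_psd.
have pUz := Upsd pz.
have ap e : 0 < e -> exists2 w, inD w & mN (U z - conv_arg x y w) < e.
  by move=> e0; have := Usupp pSx pSy dv e0; rewrite !US.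
split.
  rewrite -(SU pz); apply: Smono => //; apply: psd_closed => e e0.
  have [w dw hw] := ap _ e0; exists (m - conv_arg x y w); first by case: (bd w dw).
  by rewrite sub_subl.
rewrite -(SU pz); apply: Smono => //; apply: psd_closed => e e0.
have [w dw hw] := ap _ e0; exists (conv_arg x y w - n); first by case: (bd w dw).
by rewrite sub_subr mNB.
Qed.

(** The extreme (a + t b)^2 x belongs to v = t 1 on the boundary of D, so v = (1 - s) t 1 is used;
    the displacement s K is below the d given by continuity of S. *)
Lemma near_extreme (x : M) (a b t : R) : Psd x -> 0 <= a -> 0 <= b ->
  t = 1 \/ t = -1 -> forall e, 0 < e -> exists2 v, inD v &
  mN (S ((a ^+ 2 + b ^+ 2 + 2 * a * b * t)%:C *: x) -
      conv_arg (S ((a ^+ 2)%:C *: x)) (S ((b ^+ 2)%:C *: x)) v) < e.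
Proof.
move=> px a0 b0 ht e e0.
have pxa : Psd ((a ^+ 2)%:C *: x) by apply: psdZ => //; exact: sqr_ge0.
have pxb : Psd ((b ^+ 2)%:C *: x) by apply: psdZ => //; exact: sqr_ge0.
set m := (_)%:C *: x.
have pm : Psd m.
  apply: psdZ => //; case: ht => ->.
    have -> : a ^+ 2 + b ^+ 2 + 2 * a * b * 1 = (a + b) ^+ 2 by ring.
    exact: sqr_ge0.
  have -> : a ^+ 2 + b ^+ 2 + 2 * a * b * -1 = (a - b) ^+ 2 by ring.
  exact: sqr_ge0.
have e2 : 0 < e / 2 by rewrite divr_gt0.
have [d d0 hd] := Scont pm e2.
pose K := 2 * a * b * mN x; have K0 : 0 <= K by rewrite !mulr_ge0 // mN_ge0.
pose s := d / (d + K + 1).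
have dK : 0 < d + K + 1 by lra.
have s0 : 0 < s by rewrite divr_gt0.
have s1 : s <= 1 by rewrite ler_pdivrMr // mul1r -addrA lerDl addr_ge0.
have dv : inD (((1 - s) * t)%:C%:M : M).
  apply: inD_scalar; rewrite normrM (_ : `|t| = 1) ?mulr1; last by case: ht => ->; rewrite ?normrN normr1.
  by rewrite ger0_norm ?subr_ge0 // ltrBlDr ltrDl.
have [w dw hw] := Ssupp pxa pxb dv e2.
exists w => //; apply: le_lt_trans (mN_tri (S (conv_arg ((a ^+ 2)%:C *: x) ((b ^+ 2)%:C *: x) ((1 - s) * t)%:C%:M)) _ _) _.
rewrite [ltRHS]splitr; apply: ltrD => //; rewrite mNB; apply: hd.
  exact: conv_arg_psd.
rewrite conv_argZ //.
have -> : msqrt x *m (((1 - s) * t)%:C%:M + (((1 - s) * t)%:C%:M)^h) *m msqrt x = (2 * ((1 - s) * t))%:C *: x.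
  rewrite -scalemx1 mxadjZr mxadj1 -scalerDl -rmorphD -scalemxAr mulmx1 -scalemxAl msqrtK //.
  by congr (_%:C *: _); ring.
rewrite scalerA -rmorphM -scalerDl -rmorphD /m -scalerBl -rmorphB mNZ normc_real.
have -> : a ^+ 2 + b ^+ 2 + a * b * (2 * ((1 - s) * t)) - (a ^+ 2 + b ^+ 2 + 2 * a * b * t) = - (s * (2 * a * b)) * t by ring.
have -> : `|- (s * (2 * a * b)) * t| = s * (2 * a * b).
  rewrite normrM (_ : `|t| = 1) ?mulr1; last by case: ht => ->; rewrite ?normrN normr1.
  by rewrite normrN ger0_norm // mulr_ge0 ?(ltW s0) // !mulr_ge0.
have -> : s * (2 * a * b) * mN x = s * K by rewrite /K !mulrA.
rewrite /s mulrAC ltr_pdivrMr // ltr_pM2l //.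
lra.
Qed.

(** The support set of the images is symmetric about S A + S B. Its upper bound S m and lower bound
    S n are both approximated from within, so the reflection exchanges them and their sum is twice
    the centre. *)
Lemma quad_eq (x : M) (a b : R) : Psd x -> 0 <= b -> b <= a ->
  S (((a + b) ^+ 2)%:C *: x) + S (((a - b) ^+ 2)%:C *: x) =
  (2 : R)%:C *: (S ((a ^+ 2)%:C *: x) + S ((b ^+ 2)%:C *: x)).
Proof.
move=> px b0 ba; have a0 := le_trans b0 ba.
have pz (k : R) : Psd ((k ^+ 2)%:C *: x) by apply: psdZ => //; exact: sqr_ge0.
set m := ((a + b) ^+ 2)%:C *: x; set n := ((a - b) ^+ 2)%:C *: x.
set A := (a ^+ 2)%:C *: x; set B := (b ^+ 2)%:C *: x.
have bd w : inD w -> Psd (m - conv_arg A B w) /\ Psd (conv_arg A B w - n).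
  by move=> dw; split; [exact: conv_argZ_upper | exact: conv_argZ_lower].
have bd' w dw := @image_between A B m n w (pz a) (pz b) (pz _) (pz _) bd dw.
have mE : m = (a ^+ 2 + b ^+ 2 + 2 * a * b * 1)%:C *: x by congr (_%:C *: _); ring.
have nE : n = (a ^+ 2 + b ^+ 2 + 2 * a * b * -1)%:C *: x by congr (_%:C *: _); ring.
set P := _ *: _; apply/eqP; rewrite -subr_eq0; apply/eqP.
apply: psd_anti; apply: psd_closed => e e0.
  (* The support point of w is close to S n; its reflection, the point of -w, lies below S m, which
     gives P - S n <= S m in the limit. *)
  have [w dw] := @near_extreme x a b (-1) px a0 b0 (or_intror erefl) _ e0; rewrite -nE -/A -/B => hw.
  have [h1 _] := bd' _ (inD_opp dw); rewrite conv_arg_opp -/P in h1.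
  exists (S m - (P - conv_arg (S A) (S B) w)) => //.
  by rewrite sub_defect mNB.
have [w dw] := @near_extreme x a b 1 px a0 b0 (or_introl erefl) _ e0; rewrite -mE -/A -/B => hw.
have [_ h1] := bd' _ (inD_opp dw); rewrite conv_arg_opp -/P in h1.
exists (P - conv_arg (S A) (S B) w - S n) => //.
by rewrite opp_defect.
Qed.

Lemma order_hom (k : R) x : 0 <= k -> Psd x -> S (k%:C *: x) = k%:C *: S x.
Proof.
move=> k0 px.
have pz (t : R) : Psd ((t ^+ 2)%:C *: x) by apply: psdZ => //; exact: sqr_ge0.
apply: rq_ext.
- by apply/psd_herm/Spsd/psdZ.
- by apply/psd_herm/psdZ => //; exact: Spsd.
move=> u; rewrite rqZ.
have := @quad_fun_monotone R (fun t => rq (S ((t ^+ 2)%:C *: x)) u) _ _ _ (Num.sqrt k) (sqrtr_ge0 k).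
rewrite sqr_sqrtr // expr1n rmorph1 scale1r; apply.
- by move=> a _; exact/psd_rq/Spsd.
- move=> a b a0 ab; rewrite -subr_ge0 -rqB; apply: psd_rq; apply: Smono => //.
  rewrite -scalerBl -rmorphB; apply: psdZ => //.
  by rewrite subr_ge0 ler_pXn2r ?nnegrE // (le_trans a0).
- by move=> a b b0 ba; rewrite -!rqD quad_eq // rqZ.
Qed.
End Homogeneity.

Section ConeIso.
Variables (R : realType) (q : nat).
Local Notation C := (R[i]).
Local Notation M := ('M[C]_q).
Variables S U : M -> M.
Hypothesis q0 : (0 < q)%N.
Hypothesis Spsd : forall x, Psd x -> Psd (S x).
Hypothesis Upsd : forall x, Psd x -> Psd (U x).
Hypothesis SU : forall x, Psd x -> S (U x) = x.
Hypothesis US : forall x, Psd x -> U (S x) = x.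
Hypothesis Smono : forall x y, Psd x -> Psd y -> Psd (y - x) -> Psd (S y - S x).
Hypothesis Umono : forall x y, Psd x -> Psd y -> Psd (y - x) -> Psd (U y - U x).
Hypothesis Shom : forall (k : R) x, 0 <= k -> Psd x -> S (k%:C *: x) = k%:C *: S x.
Hypothesis Scont : forall x, Psd x -> forall e : R, 0 < e -> exists2 d : R, 0 < d &
  forall y, Psd y -> mN (y - x) < d -> mN (S y - S x) < e.

Lemma sum_delta_diag : \sum_i (delta_mx i i : M) = 1%:M.
Proof.
apply/matrixP => i j; rewrite summxE mxE (bigD1 i) //= mxE eqxx big1 ?addr0; last first.
  by move=> k ki; rewrite mxE eq_sym (negbTE ki).
by rewrite eq_sym.
Qed.

Lemma S_sum I (r : seq I) (G : I -> M) : (forall i, Psd (G i)) ->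
  S (\sum_(i <- r) G i) = \sum_(i <- r) S (G i).
Proof.
move=> pG; elim: r => [|i r IH]; first by rewrite !big_nil (S0 Shom).
rewrite !big_cons (S_add Spsd SU US Smono Umono Shom Scont) ?IH //.
by apply: psd_sum => j _; exact: pG.
Qed.

(** The columns of a are the vectors of the rank one matrices S (E_jj). By additivity S 1 = a a^*,
    and [S1_pd] makes a invertible; conjugating S by the inverse of a fixes every E_jj. *)
Theorem cone_iso : exists2 a : M, a \in unitmx &
  (forall x, Psd x -> S x = a *m x *m a^h) \/ (forall x, Psd x -> S x = a *m x^T *m a^h).
Proof.
have rk := S_outer Spsd SU US Smono Umono Shom.
have dE i : delta_mx i i = outer (ecol R i) :> M.
  by apply/matrixP => k l; rewrite outerE !mxE !andbT conjc_nat -natrM mulnb.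
have ex i : exists c, S (delta_mx i i) = outer c by rewrite dE; exact: rk.
pose f i := projT1 (cid (ex i)).
have fE i : S (delta_mx i i) = outer (f i) by rewrite /f; case: (cid _).
pose a : M := \matrix_(i, j) f j i 0.
have aE j : a *m delta_mx j j *m a^h = outer (f j).
  rewrite dE outer_mul; congr outer.
  by apply/matrixP => i l; rewrite (ord1 l) /ecol -colE !mxE.
have S1 : S 1%:M = a *m a^h.
  rewrite -sum_delta_diag S_sum; last by move=> i; rewrite dE; exact: outer_psd.
  rewrite -[X in _ = X *m _]mulmx1 -sum_delta_diag mulmx_sumr mulmx_suml.
  by apply: eq_bigr => i _; rewrite fE aE.
have ua : a \in unitmx.
  have := pd_unit (S1_pd Spsd Upsd SU Smono Shom).
  by rewrite S1 unitmx_mul => /andP[].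
pose F x := invmx a *m S x *m (invmx a)^h.
have SF x : S x = a *m F x *m a^h.
  rewrite /F mxadj_inv -!mulmxA mulVmx ?mxadj_unit // mulmx1 mulmxA mulmxV // mul1mx //.
have Fpsd x : Psd x -> Psd (F x) by move=> px; apply/psd_conj/Spsd.
have Fhom (k : R) x : 0 <= k -> Psd x -> F (k%:C *: x) = k%:C *: F x.
  by move=> k0 px; rewrite /F Shom // -scalemxAr -scalemxAl.
have Fadd x y : Psd x -> Psd y -> F (x + y) = F x + F y.
  move=> px py; rewrite /F (S_add Spsd SU US Smono Umono Shom Scont) //.
  by rewrite mulmxDr mulmxDl.
have Frank b : exists c, F (outer b) = outer c.
  by have [c hc] := rk b; exists (invmx a *m c); rewrite /F hc outer_mul.
have Fdiag i : F (delta_mx i i) = delta_mx i i.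
  rewrite /F fE -aE mxadj_inv !mulmxA mulVmx // mul1mx -mulmxA mulmxV ?mulmx1 // mxadj_unit //.
have [d [d0 hd]] := additive_cone_map Fpsd Fhom Fadd Frank Fdiag (Ordinal q0).
exists (a *m diag_mx d).
  rewrite unitmx_mul ua unitmxE det_diag unitfE; apply/prodf_neq0 => i _; exact: d0.
case: hd => hd; [left|right] => x px; by rewrite SF hd // mxadjM !mulmxA.
Qed.
End ConeIso.

(** * Determinants on the matrix ball *)

Lemma sylvester_det (T : comNzRingType) m n (A : 'M[T]_(m, n)) (B : 'M[T]_(n, m)) :
  \det (1%:M + A *m B) = \det (1%:M + B *m A).
Proof.
pose X := block_mx (1%:M : 'M[T]_m) (- A) B (1%:M : 'M[T]_n).
transitivity (\det X).
  have E : X = block_mx (1%:M + A *m B) (- A) 0 1%:M *m block_mx 1%:M 0 B 1%:M.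
    by rewrite mulmx_block !mulmx1 ?mulmx0 ?mul0mx ?mul1mx ?add0r ?mulNmx ?addrK.
  by rewrite E det_mulmx det_ublock det_lblock !det1 !mulr1.
have E : X = block_mx 1%:M 0 B 1%:M *m block_mx 1%:M (- A) 0 (1%:M + B *m A).
  rewrite mulmx_block !mulmx1 ?mulmx0 ?mul0mx ?mul1mx ?addr0 ?mulmxN.
  by rewrite addrCA addNr addr0.
by rewrite E det_mulmx det_ublock det_lblock !det1 !mul1r.
Qed.

Section Disc.
Variables (R : realType) (q : nat).
Local Notation C := (R[i]).
Local Notation M := ('M[C]_q).
Implicit Types (x y a m : M) (u b : 'cV[C]_q).

Lemma det_spectral (U : M) d : unitary U -> \det (U *m rdiag d *m U^h) = (\prod_i d i)%:C.
Proof.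
move=> uU; rewrite !det_mulmx mulrAC -det_mulmx uU det1 mul1r det_diag rmorph_prod.
by apply: eq_bigr => i _; rewrite mxE.
Qed.

Lemma pd_eig_gt0 (U : M) d : unitary U -> pd (U *m rdiag d *m U^h) -> forall i, 0 < d i.
Proof.
move=> uU /pdP[_ h] i; rewrite -(rq_spectral d i uU); apply: h.
apply/negP => /eqP h0; have := rq1_ecol_unitary i uU.
by rewrite h0 rqv0 => /esym/eqP; rewrite oner_eq0.
Qed.

Lemma pd_det x : pd x -> \det x = (Delta x)%:C /\ 0 < Delta x.
Proof.
move=> px; have hx : x^h = x by case/pdP: px.
have [U [d [uU E]]] := herm_spectral hx; rewrite /Delta.
have d0 : forall i, 0 < d i by apply: (pd_eig_gt0 uU); rewrite -E.
rewrite E det_spectral // /=; split=> //.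
by apply: prodr_gt0 => i _.
Qed.

Lemma Delta_gt0 x : pd x -> 0 < Delta x. Proof. by case/pd_det. Qed.

Lemma Delta_sylvester (v : M) : Delta (1%:M - v *m v^h) = Delta (1%:M - v^h *m v).
Proof.
by rewrite /Delta -[in LHS]mulmxN -[in RHS]mulNmx sylvester_det mulNmx.
Qed.

(** The matrix determinant lemma for a rank one downdate. *)
Lemma det_sub_outer a u : pd a -> \det (a - outer u) = (Delta a * (1 - rq (invmx a) u))%:C.
Proof.
move=> pa; have ua := pd_unit pa; have ha : a^h = a by case/pdP: pa.
have -> : a - outer u = a *m (1%:M + (- (invmx a *m u)) *m u^h).
  by rewrite mulmxDr mulmx1 mulNmx mulmxN !mulmxA mulmxV // mul1mx.
rewrite det_mulmx sylvester_det mulmxN [_ - _]mx11_scalar det_scalar1 (pd_det pa).1 rmorphM.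
congr (_ * _); rewrite addmxE oppmxE mxE eqxx mulr1n rmorphB rmorph1 mulmxA herm_form_real //.
by rewrite mxadj_inv ha.
Qed.

Lemma psd_inv a : pd a -> Psd (invmx a).
Proof.
move=> pa; have ua := pd_unit pa; have ha : a^h = a by case/pdP: pa.
have -> : invmx a = invmx a *m a *m (invmx a)^h by rewrite mulVmx // mul1mx mxadj_inv ha.
by apply: psd_conj; exact: pd_psd.
Qed.

Variable k : 'I_q.
Local Notation e := (ecol R k).
Local Notation Ekk := (outer e).
Definition perp : M := 1%:M - Ekk.
Local Notation P := perp.

Lemma ecol_adj_mul : e^h *m e = 1%:M.
Proof.
have : bf 1%:M e e = 1 by rewrite bf_ecol mxE eqxx.
by rewrite bf.unlock mulmx1 [X in _ -> X = _]mx11_scalar => ->.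
Qed.

Lemma E_e : Ekk *m e = e.
Proof. by rewrite /outer -mulmxA ecol_adj_mul mulmx1. Qed.

Lemma P_e : P *m e = 0.
Proof. by rewrite /perp mulmxBl mul1mx E_e subrr. Qed.

Lemma E_E : Ekk *m Ekk = Ekk.
Proof. by rewrite {2}/outer mulmxA E_e. Qed.

Lemma E_P : Ekk *m P = 0.
Proof. by rewrite /perp mulmxBr mulmx1 E_E subrr. Qed.

Lemma P_P : P *m P = P.
Proof. by rewrite {1}/perp mulmxBl mul1mx E_P subr0. Qed.

Lemma P_adj : P^h = P.
Proof. by rewrite /perp mxadjB mxadj1 (psd_herm (outer_psd _)). Qed.

(** Cramer's rule for the k-th diagonal entry of the inverse; the principal minor is the determinant
    of a with row and column k replaced by those of the identity, so no submatrix type is needed. *)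
Lemma det_corner a : a \in unitmx -> \det (P *m a *m P + Ekk) = \det a * (e^h *m invmx a *m e) 0 0.
Proof.
move=> ua.
have -> : P *m a *m P + Ekk = (a *m P + Ekk) *m (1%:M + e *m (- (e^h *m a *m P))).
  have h0 : (a *m P + Ekk) *m e = e by rewrite mulmxDl -mulmxA P_e mulmx0 E_e add0r.
  rewrite mulmxDr mulmx1 [X in _ = _ + X]mulmxA h0 mulmxN !mulmxA -/Ekk.
  by rewrite addrAC {1}/perp mulmxBl mul1mx mulmxBl.
rewrite det_mulmx sylvester_det.
have -> : - (e^h *m a *m P) *m e = 0 by rewrite mulNmx -(mulmxA (e^h *m a)) P_e mulmx0 oppr0.
rewrite addr0 det1 mulr1.
have -> : a *m P + Ekk = a *m (1%:M + (invmx a *m e - e) *m e^h).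
  transitivity (a - a *m Ekk + Ekk); first by rewrite /perp mulmxBr mulmx1.
  rewrite mulmxDr mulmx1 -addrA; congr (_ + _).
  by rewrite mulmxBl mulmxBr /outer !mulmxA mulmxV // mul1mx addrC.
rewrite det_mulmx sylvester_det; congr (_ * _).
by rewrite mulmxBr ecol_adj_mul addrC subrK [X in \det X]mx11_scalar det_scalar1 mulmxA.
Qed.

Lemma pd_corner a : pd a -> pd (P *m a *m P + Ekk).
Proof.
move=> pa; have ha : a^h = a by case/pdP: pa.
have pp : Psd (P *m a *m P) by rewrite -{2}P_adj; apply: psd_conj; exact: pd_psd.
apply/pdP; split.
  by rewrite mxadjD !psd_herm //; exact: outer_psd.
move=> u u0; rewrite lt_def; apply/andP; split; last first.
  by apply: psd_rq; apply: psdD => //; exact: outer_psd.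
apply: contra u0 => /eqP; rewrite rqD => h.
have h1 := psd_rq u pp; have h2 := psd_rq u (outer_psd e).
have r1 : rq (P *m a *m P) u = 0 by lra.
have r2 : rq (outer e) u = 0 by lra.
have Pu : P *m u = 0.
  apply/eqP; apply: contraT => Pu0; have [_ /(_ _ Pu0)] := (pdP _).1 pa.
  by move: r1; rewrite -{2}P_adj rq_conj P_adj => ->; rewrite ltxx.
have eu : (e^h *m u) 0 0 = 0.
  apply: eq0_normc; apply/eqP; rewrite -sqrf_eq0; apply/eqP.
  by rewrite -r2 rq_outer.
have : u = P *m u + Ekk *m u by rewrite /perp mulmxBl mul1mx subrK.
by rewrite Pu outer_mulv eu scale0r addr0 => ->.
Qed.

(* [Ekk] is a rank one update, so the determinant is quadratic in the diagonal entry.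
   With [a = 1 - m' m'^*], [m' = m0 P], the radius satisfies [s <= 1 / (a^-1)_kk], and
   [(a^-1)_kk >= 1 / a_kk >= 1]. *)
Lemma disc (m0 : M) (z1 : C) : inD (m0 + z1 *: Ekk) ->
  inD (P *m m0 *m P) /\
  exists s x0 y0 : R, s <= 1 /\ forall x y : R,
   Delta (1%:M - (m0 + (x +i* y) *: Ekk) *m (m0 + (x +i* y) *: Ekk)^h) =
   Delta (1%:M - (P *m m0 *m P) *m (P *m m0 *m P)^h) * (s - (x - x0) ^+ 2 - (y - y0) ^+ 2).
Proof.
pose m' := m0 *m P; pose b := m0 *m e; pose a := 1%:M - m' *m m'^h.
have m'e : m' *m e = 0 by rewrite /m' -mulmxA P_e mulmx0.
have em' : e^h *m m'^h = 0 by rewrite -mxadjM m'e mxadj0.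
have mE z : 1%:M - (m0 + z *: Ekk) *m (m0 + z *: Ekk)^h = a - outer (b + z *: e).
  have -> : m0 + z *: Ekk = m' + (b + z *: e) *m e^h.
    rewrite /m' /b /perp mulmxBr mulmx1 mulmxDl -scalemxAl -[m0 *m e *m _]mulmxA -/Ekk addrA.
    by rewrite subrK.
  rewrite mxadjD mxadjM mxadjK mulmxDl !mulmxDr mulmxA m'e mul0mx addr0.
  rewrite -[_ *m e^h *m m'^h]mulmxA em' mulmx0 add0r.
  rewrite -[_ *m e^h *m _]mulmxA (mulmxA e^h) ecol_adj_mul mul1mx.
  by rewrite /a opprD addrA.
move=> d1.
have pa : pd a.
  have h := inD_adj d1; rewrite inDE mxadjK mE in h.
  have -> : a = outer (b + z1 *: e) + (a - outer (b + z1 *: e)) by rewrite addrC subrK.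
  by apply: pdD => //; exact: outer_psd.
have ua := pd_unit pa; have ha : a^h = a by case/pdP: pa.
have cE : 1%:M - (P *m m0 *m P) *m (P *m m0 *m P)^h = P *m a *m P + Ekk.
  rewrite !mxadjM P_adj /a (mulmxBr P 1%:M) mulmx1 (mulmxBl P _ P) P_P /m' mxadjM P_adj !mulmxA.
  have PE : P + Ekk = 1%:M by rewrite /perp subrK.
  by rewrite addrAC PE.
have dC : inD (P *m m0 *m P).
  rewrite -[P *m m0 *m P]mxadjK; apply: inD_adj; rewrite inDE mxadjK cE; exact: pd_corner.
split=> //.
pose g := rq (invmx a) e.
have hia : (invmx a)^h = invmx a by rewrite mxadj_inv ha.
have pia := psd_inv pa.
have g1 : 1 <= g.
  have := psd_CS e (invmx a *m e) (pd_psd pa).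
  have -> : bf a e (invmx a *m e) = 1.
    by rewrite bf.unlock -mulmxA (mulmxA a) mulmxV // mul1mx ecol_adj_mul mxE eqxx.
  have -> : rq a (invmx a *m e) = g.
    by have := rq_conj (invmx a) a e; rewrite hia mulVmx // mul1mx => <-.
  have ae : rq a e <= 1.
    rewrite /a rqB rq_ecol mxE eqxx /= lerBlDr lerDl.
    by apply: psd_rq; exact: psd_gram.
  have g0 : 0 <= g by exact: psd_rq.
  have a0 : 0 <= rq a e by exact/psd_rq/pd_psd.
  rewrite normc1 expr1n => h; apply: le_trans h _.
  by rewrite ler_piMl.
have g0 : 0 < g by exact: lt_le_trans g1.
have Dg : Delta (1%:M - (P *m m0 *m P) *m (P *m m0 *m P)^h) = Delta a * g.
  by rewrite cE {1}/Delta det_corner // (pd_det pa).1 herm_form_real // -rmorphM.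
pose be := bf (invmx a) b e.
have CS : complex.Re be ^+ 2 + complex.Im be ^+ 2 <= rq (invmx a) b * g.
  have := psd_CS b e pia; rewrite -/be -/g.
  by case: (be) => p r /=; rewrite sqr_sqrtr // addr_ge0 // sqr_ge0.
(* Completing the square in z: the form of the inverse of a at b + z e equals g |z - z0|^2 +
   [rq (invmx a) b] - |be|^2 / g with z0 = -be^* / g; the last division moves g into the corner
   determinant. *)
exists ((1 - rq (invmx a) b + (complex.Re be ^+ 2 + complex.Im be ^+ 2) / g) / g).
exists (- complex.Re be / g), (complex.Im be / g); split.
  rewrite ler_pdivrMr // mul1r; apply: le_trans _ g1.
  rewrite -addrA gerDl addrC subr_le0 ler_pdivrMr //.
move=> x y; rewrite mE Dg {1}/Delta det_sub_outer //=.
rewrite -mulrA; congr (_ * _).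
rewrite rq_add // rq_scale bf_scaler -/g -/be.
have -> : normc (x +i* y) ^+ 2 = x ^+ 2 + y ^+ 2 by rewrite /= sqr_sqrtr // addr_ge0 // sqr_ge0.
case: (be) => p r /=; field; rewrite gt_eqF //.
Qed.
End Disc.

(** * Continuity in matrix entries *)

Section Continuity.
Variables (R : realType) (q : nat).
Local Notation C := (R[i]).
Local Notation M := ('M[C]_q).

Definition contC (f : M -> C) : Prop := forall v (e : R), 0 < e ->
  exists2 d : R, 0 < d & forall w, mN (w - v) < d -> normc (f w - f v) < e.

Lemma contC_cst a : contC (fun=> a).
Proof. by move=> v e e0; exists 1 => // w _; rewrite subrr normc0. Qed.

Lemma contC_entry i j : contC (fun v => v i j).
Proof.
move=> v e e0; exists e => // w h; apply: le_lt_trans h.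
by have := mN_entry (w - v) i j; rewrite addmxE oppmxE.
Qed.

Lemma contC_add f g : contC f -> contC g -> contC (fun v => f v + g v).
Proof.
move=> cf cg v e e0; have e2 : 0 < e / 2 by rewrite divr_gt0.
have [d1 d10 h1] := cf v _ e2; have [d2 d20 h2] := cg v _ e2.
exists (Num.min d1 d2); first by rewrite lt_min d10.
move=> w; rewrite lt_min => /andP[/h1 k1 /h2 k2]; rewrite opprD addrACA.
by apply: le_lt_trans (le_normcD _ _) _; rewrite [ltRHS]splitr ltrD.
Qed.

Lemma contC_mul f g : contC f -> contC g -> contC (fun v => f v * g v).
Proof.
move=> cf cg v e e0.
have F0 := normc_ge0 (f v); have G0 := normc_ge0 (g v).
have e1 : 0 < e / 2 / (normc (g v) + 1) by rewrite !divr_gt0 // ltr_wpDl.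
have e2 : 0 < Num.min 1 (e / 2 / (normc (f v) + 1)).
  by rewrite lt_min ltr01 !divr_gt0 // ltr_wpDl.
have [d1 d10 h1] := cf v _ e1; have [d2 d20 h2] := cg v _ e2.
exists (Num.min d1 d2); first by rewrite lt_min d10.
move=> w; rewrite lt_min => /andP[/h1 k1 /h2].
rewrite lt_min => /andP[k2 k3].
have -> : f w * g w - f v * g v = (f w - f v) * (g v + (g w - g v)) + f v * (g w - g v) by ring.
apply: le_lt_trans (le_normcD _ _) _; rewrite !normcM.
have k4 := le_normcD (g v) (g w - g v).
have n1 := normc_ge0 (f w - f v); have n2 := normc_ge0 (g w - g v).
have n3 := normc_ge0 (g v + (g w - g v)).
rewrite ltr_pdivlMr ?ltr_wpDl // in k1; rewrite ltr_pdivlMr ?ltr_wpDl // in k3.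
move: k1 k2 k3 k4 n1 n2 n3 F0 G0.
move: (normc (f w - f v)) (normc (g w - g v)) (normc (g v + _)) (normc (f v)) (normc (g v)).
move=> A B D F G k1 k2 k3 k4 n1 n2 n3 F0 G0.
have : A * D <= A * (G + 1) by rewrite ler_wpM2l // (le_trans k4) // lerD2l ltW.
have : F * B <= B * (F + 1) by rewrite mulrC ler_wpM2l // lerDl.
lra.
Qed.

Lemma contC_conj f : contC f -> contC (fun v => (f v)^*%C).
Proof.
move=> cf v e e0; have [d d0 h] := cf v e e0; exists d => // w /h.
by rewrite -(rmorphB (@conjc R)) normc_conj.
Qed.

Lemma contC_sum I (r : seq I) (P : pred I) (F : I -> M -> C) : (forall i, contC (F i)) ->
  contC (fun v => \sum_(i <- r | P i) F i v).
Proof.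
move=> cF; elim: r => [|i r IH].
  by move=> v e e0; exists 1 => // w _; rewrite !big_nil subrr normc0.
have : contC (fun v => (if P i then F i v else 0) + \sum_(i <- r | P i) F i v).
  by apply: contC_add => //; case: (P i) => //; exact: contC_cst.
move=> h v e e0; have [d d0 k] := h v e e0; exists d => // w /k.
by rewrite !big_cons; case: (P i); rewrite ?add0r.
Qed.

Lemma contC_prod I (r : seq I) (P : pred I) (F : I -> M -> C) : (forall i, contC (F i)) ->
  contC (fun v => \prod_(i <- r | P i) F i v).
Proof.
move=> cF; elim: r => [|i r IH].
  by move=> v e e0; exists 1 => // w _; rewrite !big_nil subrr normc0.
have : contC (fun v => (if P i then F i v else 1) * \prod_(i <- r | P i) F i v).
  by apply: contC_mul => //; case: (P i) => //; exact: contC_cst.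
move=> h v e e0; have [d d0 k] := h v e e0; exists d => // w /k.
by rewrite !big_cons; case: (P i); rewrite ?mul1r.
Qed.

Definition contM (A : M -> M) : Prop := forall i j, contC (fun v => A v i j).

Lemma contC_ext f g : f =1 g -> contC f -> contC g.
Proof. by move=> /funext ->. Qed.

Lemma contM_id : contM id. Proof. by move=> i j; exact: contC_entry. Qed.
Lemma contM_cst a : contM (fun=> a). Proof. by move=> i j; exact: contC_cst. Qed.

Lemma contM_add A B : contM A -> contM B -> contM (fun v => A v + B v).
Proof.
move=> cA cB i j; apply: (contC_ext (f := fun v => A v i j + B v i j)).
  by move=> v; rewrite addmxE.
exact: contC_add.
Qed.

Lemma contM_opp A : contM A -> contM (fun v => - A v).
Proof.
move=> cA i j; apply: (contC_ext (f := fun v => -1 * A v i j)).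
  by move=> v; rewrite oppmxE mulN1r.
by apply: contC_mul => //; exact: contC_cst.
Qed.

Lemma contM_mul A B : contM A -> contM B -> contM (fun v => A v *m B v).
Proof.
move=> cA cB i j; apply: (contC_ext (f := fun v => \sum_k A v i k * B v k j)).
  by move=> v; rewrite mxE.
by apply: contC_sum => k; exact: contC_mul.
Qed.

Lemma contM_adj A : contM A -> contM (fun v => (A v)^h).
Proof.
move=> cA i j; apply: (contC_ext (f := fun v => (A v j i)^*%C)).
  by move=> v; rewrite mxadjE.
exact: contC_conj.
Qed.

Lemma contC_det A : contM A -> contC (fun v => \det (A v)).
Proof.
move=> cA; apply: contC_sum => s; apply: contC_mul; first exact: contC_cst.
by apply: contC_prod => i; exact: cA.
Qed.

Lemma contM_mN A v (e : R) : contM A -> 0 < e ->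
  exists2 d : R, 0 < d & forall w, mN (w - v) < d -> mN (A w - A v) < e.
Proof.
move=> cA e0.
pose g w : C := \sum_i \sum_j (normc (A w i j - A v i j))%:C.
have cn f : contC f -> contC (fun w => (normc (f w - f v))%:C).
  move=> cf u e' e'0; have [d d0 h] := cf u e' e'0; exists d => // w /h.
  apply: le_lt_trans; rewrite -rmorphB normc_real ler_distlC; apply/andP; split.
    rewrite lerBlDr; have -> : f w - f v = (f u - f v) + (f w - f u) by ring.
    exact: le_normcD.
  have -> : f u - f v = (f w - f v) - (f w - f u) by ring.
  by apply: le_trans (le_normcD _ _) _; rewrite normcN.
have cg : contC g by apply: contC_sum => i; apply: contC_sum => j; exact: cn.
have gE w : g w = (mN (A w - A v))%:C.
  rewrite /g /mN rmorph_sum; apply: eq_bigr => i _; rewrite rmorph_sum; apply: eq_bigr => j _.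
  by rewrite addmxE oppmxE.
have [d d0 h] := cg v e e0; exists d => // w /h.
by rewrite !gE subrr mN0 subr0 normc_real ger0_norm // mN_ge0.
Qed.

Lemma Re_le_normc (z : C) : `|complex.Re z| <= normc z.
Proof. by case: z => a b /=; rewrite -sqrtr_sqr ler_wsqrtr // lerDl sqr_ge0. Qed.

Lemma Delta_cont A v (e : R) : contM A -> 0 < e ->
  exists2 d : R, 0 < d & forall w, mN (w - v) < d -> `|Delta (A w) - Delta (A v)| < e.
Proof.
move=> cA e0; have [d d0 h] := contC_det cA v e0; exists d => // w /h.
by apply: le_lt_trans; rewrite /Delta -raddfB; exact: Re_le_normc.
Qed.

Lemma sum_sqr_le (I : finType) (F : I -> R) : (\sum_i F i) ^+ 2 <= #|I|%:R * \sum_i F i ^+ 2.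
Proof.
have : 0 <= \sum_i \sum_j (F i - F j) ^+ 2 by apply: sumr_ge0 => i _; apply: sumr_ge0 => j _; exact: sqr_ge0.
have -> : \sum_i \sum_j (F i - F j) ^+ 2 =
  (#|I|%:R * \sum_i F i ^+ 2) + (#|I|%:R * \sum_i F i ^+ 2) - 2 * (\sum_i F i) ^+ 2.
  transitivity (\sum_i \sum_j (F i ^+ 2 + F j ^+ 2 - 2 * (F i * F j))).
    by apply: eq_bigr => i _; apply: eq_bigr => j _; ring.
  have S2 : \sum_i \sum_j F i * F j = (\sum_i F i) ^+ 2 by rewrite expr2 big_distrlr.
  have S3 : \sum_i \sum_j 2 * (F i * F j) = 2 * (\sum_i F i) ^+ 2.
    by rewrite -S2 mulr_sumr; apply: eq_bigr => i _; rewrite mulr_sumr.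
  under eq_bigr do rewrite sumrB big_split /=.
  rewrite sumrB big_split /= S3; congr (_ + _ - _).
    by rewrite mulr_sumr; apply: eq_bigr => i _; rewrite sumr_const mulr_natl.
  by rewrite sumr_const mulr_natl.
lra.
Qed.

Lemma mN_col_sqr (u : 'cV[C]_q) : mN u ^+ 2 <= q%:R * rq 1%:M u.
Proof.
rewrite rq1 /mN; under eq_bigr do rewrite big_ord1.
by apply: le_trans (sum_sqr_le _) _; rewrite card_ord.
Qed.

Lemma pd_lower (x : M) : pd x -> exists2 t : R, 0 < t & Psd (x - t%:C *: 1%:M).
Proof.
move=> px; have hx : x^h = x by case/pdP: px.
have [U [d [uU E]]] := herm_spectral hx.
have d0 : forall i, 0 < d i by apply: (pd_eig_gt0 uU); rewrite -E.
have s0 : 0 <= \sum_i (d i)^-1 by apply: sumr_ge0 => i _; rewrite invr_ge0 ltW.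
(* A number below all eigenvalues, chosen without a minimum, which an empty index set would lack. *)
exists (1 + \sum_i (d i)^-1)^-1; first by rewrite invr_gt0 ltr_pwDl.
set t := (_)^-1.
have -> : x - t%:C *: 1%:M = U *m rdiag (fun i => d i - t) *m U^h.
  have -> : rdiag (fun i => d i - t) = rdiag d - t%:C *: 1%:M.
    apply/matrixP => i j; rewrite !mxE; case: eqP => _; rewrite ?mulr1n ?mulr0n ?mulr0 ?subrr //.
    by rewrite mulr1 rmorphB.
  by rewrite mulmxBr mulmxBl -E -scalemxAr -scalemxAl mulmx1 uU.
apply: psd_conj; apply: rdiag_psd => i; rewrite subr_ge0 /t.
rewrite -[leRHS]invrK lef_pV2 ?posrE ?invr_gt0 ?ltr_pwDl //.
rewrite (bigD1 i) //= addrCA lerDl addr_ge0 // sumr_ge0 // => j _.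
by rewrite invr_ge0 ltW.
Qed.

Lemma pd_open (x : M) : pd x -> exists2 e : R, 0 < e & forall y, y^h = y -> mN (y - x) < e -> pd y.
Proof.
move=> px; have [t t0 lt] := pd_lower px.
have q1 : 0 < q%:R + 1 :> R by rewrite ltr_wpDl.
exists (t / (q%:R + 1)); first by rewrite divr_gt0.
move=> y hy; rewrite ltr_pdivlMr // => ny; apply/pdP; split=> // u u0.
have h1 := psd_rq u lt; rewrite rqB rqZ in h1.
have h2 := rq_le_mN (y - x) u; rewrite rqB in h2.
have h3 := ler_wpM2l (mN_ge0 (y - x)) (mN_col_sqr u).
have h4 := rq1_gt0 u0; have h5 := mN_ge0 (y - x).
have q0 : 0 <= q%:R :> R by [].
have := le_trans h2 h3; rewrite ler_norml => /andP[h6 _].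
have h7 : mN (y - x) * (q%:R * rq 1%:M u) <= t * rq 1%:M u.
  rewrite mulrA ler_wpM2r ?ltW //; lra.
have h8 : mN (y - x) * (q%:R * rq 1%:M u) < t * rq 1%:M u.
  rewrite mulrA ltr_pM2r //; apply: le_lt_trans ny; rewrite ler_wpM2l // lerDl //.
lra.
Qed.

Lemma inD_open A v : contM A -> inD (A v) -> exists2 d : R, 0 < d &
  forall w, mN (w - v) < d -> inD (A w).
Proof.
move=> cA dv; rewrite inDE in dv.
have [e e0 he] := pd_open dv.
have cB : contM (fun w => 1%:M - (A w)^h *m A w).
  apply: contM_add; first exact: contM_cst.
  by apply: contM_opp; apply: contM_mul => //; exact: contM_adj.
have [d d0 h] := contM_mN v cB e0; exists d => [//|w lw]; rewrite inDE.
apply: (he (1%:M - (A w)^h *m A w) _ (h w lw)).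
by rewrite mxadjB mxadj1 mxadjM mxadjK.
Qed.

Lemma powR_cont (p x : R) : 0 < x -> forall e : R, 0 < e -> exists2 d : R, 0 < d &
  forall y, `|y - x| < d -> `|y `^ p - x `^ p| < e.
Proof.
move=> x0 e e0.
have cp : {for x, continuous (@powR R ^~ p)}.
  apply: differentiable_continuous; apply/derivable1_diffP.
  by have [] := is_derive1_powR p x0.
have /cvgrPdist_lt /(_ e e0) := cp.
move=> /nbhs_ballP[d /= d0 hd]; exists d => // y yx.
by rewrite distrC; apply: hd; rewrite /ball /= distrC.
Qed.

Definition contD (D : M -> Prop) (h : M -> R) : Prop := forall v, D v -> forall e : R, 0 < e ->
  exists2 d : R, 0 < d & forall w, D w -> mN (w - v) < d -> `|h w - h v| < e.

Lemma contD_mul D f g : contD D f -> contD D g -> contD D (fun v => f v * g v).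
Proof.
move=> cf cg v Dv e e0.
have F0 := normr_ge0 (f v); have G0 := normr_ge0 (g v).
have e1 : 0 < e / 2 / (`|g v| + 1) by rewrite !divr_gt0 // ltr_wpDl.
have e2 : 0 < Num.min 1 (e / 2 / (`|f v| + 1)).
  by rewrite lt_min ltr01 !divr_gt0 // ltr_wpDl.
have [d1 d10 h1] := cf v Dv _ e1; have [d2 d20 h2] := cg v Dv _ e2.
exists (Num.min d1 d2); first by rewrite lt_min d10.
move=> w Dw; rewrite lt_min => /andP[/(h1 _ Dw) k1 /(h2 _ Dw)].
rewrite lt_min => /andP[k2 k3].
have -> : f w * g w - f v * g v = (f w - f v) * (g v + (g w - g v)) + f v * (g w - g v) by ring.
apply: le_lt_trans (ler_normD _ _) _; rewrite !normrM.
have k4 := ler_normD (g v) (g w - g v).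
have n1 := normr_ge0 (f w - f v); have n2 := normr_ge0 (g w - g v).
rewrite ltr_pdivlMr ?ltr_wpDl // in k1; rewrite ltr_pdivlMr ?ltr_wpDl // in k3.
move: k1 k2 k3 k4 n1 n2 F0 G0.
move: `|f w - f v| `|g w - g v| `|g v + _| `|f v| `|g v|.
move=> A B E F G k1 k2 k3 k4 n1 n2 F0 G0.
have : A * E <= A * (G + 1) by rewrite ler_wpM2l // (le_trans k4) // lerD2l ltW.
have : F * B <= B * (F + 1) by rewrite mulrC ler_wpM2l // lerDl.
lra.
Qed.

Lemma contD_Delta_pow A p : contM A ->
  contD (fun v => inD (A v)) (fun v => Delta (1%:M - A v *m (A v)^h) `^ p).
Proof.
move=> cA v dv e e0.
have D0 : 0 < Delta (1%:M - A v *m (A v)^h) by rewrite Delta_sylvester; exact: Delta_gt0.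
have [d1 d10 h1] := powR_cont p D0 e0.
have cB : contM (fun w => 1%:M - A w *m (A w)^h).
  apply: contM_add; first exact: contM_cst.
  by apply: contM_opp; apply: contM_mul => //; exact: contM_adj.
have [d d0 h] := Delta_cont v cB d10; exists d => // w _ /h; exact: h1.
Qed.

Local Notation N := (2 * q * q)%N.

Lemma vmat_close (c c' : nat -> R) (e : R) : 0 < e -> cclose N (e / (2 * (q * q)%:R + 1)) c c' ->
  mN (vmat q c' - vmat q c) < e.
Proof.
move=> e0 cl; set d := e / _ in cl.
have q0 : 0 <= (q * q)%:R :> R by [].
have dE : d * (2 * (q * q)%:R + 1) = e by rewrite /d divfK // gt_eqF // ltr_wpDl // mulr_ge0.
have d0 : 0 < d by rewrite divr_gt0 // ltr_wpDl // mulr_ge0.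
have ent i j : normc ((vmat q c' - vmat q c) i j) <= d + d.
  rewrite addmxE oppmxE !mxE /=.
  have ltN : ((2 * (i * q + j)).+1 < N)%N by have := ltn_ord i; have := ltn_ord j; nia.
  have h1 := cl _ ltN; have h2 := cl _ (ltnW ltN).
  apply: le_trans (_ : `|c' (2 * (i * q + j))%N - c (2 * (i * q + j))%N| + `|c' (2 * (i * q + j)).+1 - c (2 * (i * q + j)).+1| <= _); last by lra.
  move: (c' _ - c _) (c' _ - c _) => a b.
  rewrite -[leRHS]ger0_norm ?addr_ge0 // -sqrtr_sqr ler_wsqrtr //.
  rewrite sqrrD !real_normK ?num_real // addrAC lerDl.
  by rewrite mulrn_wge0 // mulr_ge0.
apply: le_lt_trans (_ : \sum_(i < q) \sum_(j < q) (d + d) < _).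
  by apply: ler_sum => i _; apply: ler_sum => j _; exact: ent.
rewrite !sumr_const !card_ord -mulrnA -mulr_natl -dE.
have : (q * q)%:R * (d + d) = d * (2 * (q * q)%:R) by ring.
move=> ->; rewrite ltr_pM2l // ltrDl //.
Qed.

(** The integrand of [intD] for a general domain, so that matrix corners are covered as well. *)
Definition on_D (D : M -> Prop) (h : M -> R) (c : nat -> R) : \bar R :=
  if `[< D (vmat q c) >] then (h (vmat q c))%:E else 0%E.

Definition mopen (D : M -> Prop) : Prop := forall v, D v -> exists2 d : R, 0 < d &
  forall w, mN (w - v) < d -> D w.

Lemma measurable_on_D (D : M -> Prop) (h : M -> R) : mopen D -> contD D h ->
  measurable_fun setT (on_D D h : coords R -> \bar R).
Proof.
move=> oD ch.
have K0 : 0 < 2 * (q * q)%:R + 1 :> R by rewrite ltr_wpDl // mulr_ge0.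
have -> : on_D D h = (fun c => (if `[< D (vmat q c) >] then h (vmat q c) else 0)%:E).
  by apply/funext => c; rewrite /on_D; case: ifP.
apply/measurable_EFinP.
apply: (@measurable_on_open R N (fun c : coords R => D (vmat q c)) (fun c => h (vmat q c))).
  move=> c Dc; have [d d0 hd] := oD _ Dc.
  exists (d / (2 * (q * q)%:R + 1)); first by rewrite divr_gt0.
  by move=> c' /(vmat_close d0) /hd.
move=> c Dc e e0; have [d d0 hd] := ch _ Dc _ e0.
exists (d / (2 * (q * q)%:R + 1)); first by rewrite divr_gt0.
by move=> c' /(vmat_close d0) cl Dc'; exact: hd.
Qed.

Lemma itint_on_D_gt0 (D : M -> Prop) (h : M -> R) c : mopen D -> contD D h ->
  (forall v, D v -> 0 <= h v) -> D (vmat q c) -> 0 < h (vmat q c) -> (0 < itint N (on_D D h))%E.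
Proof.
move=> oD ch h0 Dc hc.
have K0 : 0 < 2 * (q * q)%:R + 1 :> R by rewrite ltr_wpDl // mulr_ge0.
have e0 : 0 < h (vmat q c) / 2 by rewrite divr_gt0.
have [d1 d10 hd1] := oD _ Dc; have [d2 d20 hd2] := ch _ Dc _ e0.
have d0 : 0 < Num.min d1 d2 by rewrite lt_min d10.
apply: (@itint_gt0 R N _ c (Num.min d1 d2 / (2 * (q * q)%:R + 1)) (h (vmat q c) / 2)) => //.
- by rewrite divr_gt0.
- move=> c'; rewrite /on_D; case: asboolP => // D'; rewrite lee_fin; exact: h0.
- exact: measurable_on_D.
move=> c' /(vmat_close d0); rewrite lt_min => /andP[/hd1 D' l2].
rewrite /on_D asboolT // lee_fin; have := hd2 _ D' l2.
rewrite ltr_norml => /andP[h1 _]; lra.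
Qed.
End Continuity.

(** * Finiteness of kappa *)

Section Box.
Variable R : realType.
Local Notation leb := (@lebesgue_measure R).
Local Notation coords := (coords R).

Definition box1 (k : nat) (c : coords) : R := \1_(`[-1, 1]%classic : set R) (c k).
Fixpoint box (ks : seq nat) (c : coords) : R := if ks is k :: ks' then box1 k c * box ks' c else 1.

Lemma box1_ge0 k c : 0 <= box1 k c. Proof. by rewrite /box1 indicE. Qed.
Lemma box_ge0 ks c : 0 <= box ks c.
Proof. by elim: ks => //= k ks IH; rewrite mulr_ge0 // box1_ge0. Qed.

Lemma box_eq1 ks (c : coords) : (forall k, k \in ks -> `|c k| <= 1) -> box ks c = 1.
Proof.
elim: ks => //= k ks IH h; rewrite IH ?mulr1; last by move=> j jk; rewrite h // inE jk orbT.
rewrite /box1 indicE mem_set //= in_itv /=.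
by have := h k (mem_head _ _); rewrite ler_norml.
Qed.

Lemma measurable_box1 k : measurable_fun setT (box1 k).
Proof.
have mi : measurable_fun setT (\1_(`[-1, 1]%classic) : R -> R) by exact: measurable_indic.
exact: (measurableT_comp mi (measurable_coord k)).
Qed.

Lemma measurable_box ks : measurable_fun setT (box ks).
Proof.
elim: ks => [|k ks IH]; first exact: measurable_cst.
by apply: measurable_funM => //; exact: measurable_box1.
Qed.

Lemma box1_upd k c x : box1 k (upd c k x) = \1_(`[-1, 1]%classic : set R) x.
Proof. by rewrite /box1 /upd eqxx. Qed.

Lemma box1_upd_ne j k c x : j != k -> box1 j (upd c k x) = box1 j c.
Proof. by rewrite /box1 /upd => /negbTE ->. Qed.

Lemma integral_box1 k c : (E1 k (fun c => (box1 k c)%:E) c = 2%:E)%E.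
Proof.
rewrite /E1; under eq_integral do rewrite box1_upd.
rewrite integral_indic // setIT; have := @lebesgue_measure_itv R `[-1, 1]; rewrite /= lte_fin => ->.
by rewrite ifT; [congr (_%:E); lra | lra].
Qed.

(** g ignores the coordinates in ks, so each of them contributes only the length 2 of [-1, 1]. *)
Lemma Es_box ks (g : coords -> \bar R) c : uniq ks -> (forall c, 0 <= g c)%E ->
  measurable_fun setT g -> (forall k c x, k \in ks -> g (upd c k x) = g c) ->
  (Es ks (fun c => g c * (box ks c)%:E) c <= (2 ^+ size ks)%:E * g c)%E.
Proof.
elim: ks g c => [|k ks IH] g c /=; first by rewrite expr0 mule1 mul1e.
move=> /andP[kks uks] g0 mg gi.
pose g' c := (g c * (box1 k c)%:E)%E.
have g'0 c' : (0 <= g' c')%E by rewrite mule_ge0 // lee_fin box1_ge0.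
have mb j : measurable_fun setT (fun c => (box1 j c)%:E).
  by apply/measurable_EFinP; exact: measurable_box1.
have mg' : measurable_fun setT g' by apply: emeasurable_funM => //; exact: mb.
have mh : measurable_fun setT (fun c => (g' c * (box ks c)%:E)%E).
  by apply: emeasurable_funM => //; apply/measurable_EFinP; exact: measurable_box.
have h0 c' : (0 <= g' c' * (box ks c')%:E)%E by rewrite mule_ge0 // lee_fin box_ge0.
have e20 : (0 <= (2 ^+ size ks)%:E :> \bar R)%E by rewrite lee_fin exprn_ge0.
have IH' c' : (Es ks (fun c => g' c * (box ks c)%:E) c' <= (2 ^+ size ks)%:E * g' c')%E.
  apply: IH => // j d x jks; have jk : k != j by apply: contraNneq kks => ->.
  by rewrite /g' box1_upd_ne // gi // inE jks orbT.
have -> : Es ks (fun c => g c * (box1 k c * box ks c)%:E)%E = Es ks (fun c => g' c * (box ks c)%:E)%E.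
  by apply/funext => d; apply: Es_ext => b; rewrite /g' EFinM muleA.
apply: le_trans (_ : E1 k (fun c => (2 ^+ size ks)%:E * g' c)%E c <= _)%E.
  apply: le_E1 => //.
  - by move=> d; exact: Es_ge0.
  - by move=> d; rewrite mule_ge0.
  - exact: measurable_Es.
  - by apply: emeasurable_funM => //; exact: measurable_cst.
have hZ := @EsZl R [:: k] _ g' c e20 g'0 mg'; rewrite /= in hZ; rewrite hZ /E1 exprSr EFinM -muleA lee_wpmul2l //.
have -> : (\int[leb]_(x in [set: R]) g' (upd c k x))%E = (\int[leb]_(x in [set: R]) (g c * (box1 k (upd c k x))%:E))%E.
  by apply: eq_integral => x _; rewrite /g' gi // mem_head.
rewrite ge0_integralZl //.
- have h := integral_box1 k c; rewrite /E1 in h; by rewrite h muleC.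
- by apply: (@measurable_upd_section R (fun c => (box1 k c)%:E)); exact: mb.
- by move=> x _; rewrite lee_fin box1_ge0.
Qed.
End Box.

Section Kappa.
Variables (R : realType) (q : nat).
Local Notation C := (R[i]).
Local Notation M := ('M[C]_q).
Local Notation leb := (@lebesgue_measure R).
Local Notation coords := (coords R).
Local Notation N := (2 * q * q)%N.

(* Coordinate [n] of [vmat] is the real (even [n]) or imaginary part of the entry
   [(crow n, ccol n)]. *)
Definition crow (n : nat) : nat := (n./2 %/ q)%N.
Definition ccol (n : nat) : nat := (n./2 %% q)%N.

Lemma crow_idx (b : bool) i j : (j < q)%N -> crow (b + 2 * (i * q + j)) = i.
Proof.
move=> jq; rewrite /crow mul2n half_bit_double divnMDl ?divn_small ?addn0 //.
exact: leq_ltn_trans jq.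
Qed.

Lemma ccol_idx (b : bool) i j : (j < q)%N -> ccol (b + 2 * (i * q + j)) = j.
Proof. by move=> jq; rewrite /ccol mul2n half_bit_double modnMDl modn_small. Qed.

Lemma idx_row_col n : n = (odd n + 2 * (crow n * q + ccol n))%N.
Proof. by rewrite -divn_eq mul2n odd_double_half. Qed.

Lemma idx_lt (b : bool) i j : (i < q)%N -> (j < q)%N -> (b + 2 * (i * q + j) < N)%N.
Proof. by case: b; nia. Qed.

Lemma crow_lt n : (n < N)%N -> (crow n < q)%N.
Proof.
move=> h; have q0 : (0 < q)%N by case: q h => //; rewrite muln0.
rewrite /crow ltn_divLR // -ltn_double; apply: leq_ltn_trans (_ : n < _)%N; first by lia.
by rewrite -mul2n mulnA.
Qed.

Lemma ccol_lt n : (n < N)%N -> (ccol n < q)%N.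
Proof.
move=> h; have q0 : (0 < q)%N by case: q h => //; rewrite muln0.
by rewrite /ccol ltn_pmod.
Qed.

(** The leading corner of size k, padded with zeros: all corners keep the size q, and the padding
    adds only an identity block to 1 - m m^*. *)
Definition mask (k : nat) (v : M) : M := \matrix_(i, j) if (i < k)%N && (j < k)%N then v i j else 0.

Lemma contM_mask k : contM (mask k).
Proof.
move=> i j; case E : ((i < k)%N && (j < k)%N).
  by apply: contC_ext (contC_entry i j) => v; rewrite mxE E.
by apply: contC_ext (@contC_cst _ _ 0) => v; rewrite mxE E.
Qed.

Lemma maskE k v i j : mask k v i j = if (i < k)%N && (j < k)%N then v i j else 0.
Proof. by rewrite mxE. Qed.

Lemma mask_full v : mask q v = v.
Proof. by apply/matrixP => i j; rewrite mxE !ltn_ord. Qed.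

Lemma vmatE (c : nat -> R) i j :
  vmat q c i j = Complex (c (false + 2 * (i * q + j))%N) (c (true + 2 * (i * q + j))%N).
Proof. by rewrite mxE. Qed.

Lemma mask_upd k n (c : coords) x : ~~ ((crow n < k)%N && (ccol n < k)%N) ->
  mask k (vmat q (upd c n x)) = mask k (vmat q c).
Proof.
move=> h; apply/matrixP => i j; rewrite ![mask _ _ _ _]mxE; case: ifP => // ij.
rewrite !vmatE /upd.
have ne (b : bool) : (b + 2 * (i * q + j))%N == n = false.
  by apply: contraNF h => /eqP <-; rewrite crow_idx // ccol_idx.
by rewrite !ne.
Qed.

Lemma inD_entry (v : M) i j : inD v -> normc (v i j) <= 1.
Proof.
rewrite inDE => /pd_psd /(psd_rq (ecol R j)); rewrite rqB rq_ecol mxE eqxx /= rq_ecol subr_ge0.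
rewrite mxE => h; have : normc (v i j) ^+ 2 <= 1 ^+ 2.
  rewrite expr1n; apply: le_trans h; rewrite raddf_sum /= (bigD1 i) //=.
  have E k : complex.Re (v^h j k * v k j) = normc (v k j) ^+ 2.
    by rewrite mxadjE mulrC mul_conj_normc.
  rewrite E lerDl sumr_ge0 // => k _; rewrite E sqr_ge0 //.
by rewrite ler_pXn2r ?nnegrE ?normc_ge0.
Qed.

Lemma outer_ecolE (k a b : 'I_q) : (ecol R k *m (ecol R k)^h) a b = ((a == k) && (b == k))%:R.
Proof.
rewrite mxE big_ord1 mxadjE /ecol !deltamxE eqxx !andbT.
by rewrite conjc_nat; case: (a == k); case: (b == k); rewrite ?mulr0 ?mul0r ?mulr1.
Qed.

Lemma perp_mul (k : 'I_q) (m : M) i j :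
  (perp R k *m m *m perp R k) i j = if (i != k) && (j != k) then m i j else 0.
Proof.
have -> : perp R k = diag_mx (\row_l (l != k)%:R).
  apply/matrixP => a b; rewrite /perp /outer /ecol addmxE oppmxE outer_ecolE !mxE.
  by case: (a =P b) => [<-|ab]; case: (a =P k) => [ak|ak] /=; rewrite ?mulr1n ?mulr0n ?subrr ?subr0 //;
     case: (b =P k) => [bk|bk] /=; rewrite ?subrr ?subr0 //; case: ab; rewrite ak bk.
rewrite mul_diag_mx mul_mx_diag !mxE; case: (i =P k); case: (j =P k) => _ _ /=.
- by rewrite mul0r mul0r.
- by rewrite mul0r mul0r.
- by rewrite mulr0.
- by rewrite mul1r mulr1.
Qed.

Variable p : R.
Hypothesis p1 : -1 < p.

Definition corner (k : nat) : coords -> \bar R :=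
  on_D (fun v => inD (mask k v)) (fun v => Delta (1%:M - mask k v *m (mask k v)^h) `^ p).

Lemma corner_ge0 k c : (0 <= corner k c)%E.
Proof. by rewrite /corner /on_D; case: ifP => // _; rewrite lee_fin powR_ge0. Qed.

Lemma measurable_corner k : measurable_fun setT (corner k).
Proof.
apply: measurable_on_D; last by apply: contD_Delta_pow; exact: contM_mask.
by move=> v dv; apply: inD_open dv; exact: contM_mask.
Qed.

Lemma corner_upd k n (c : coords) x : ~~ ((crow n < k)%N && (ccol n < k)%N) ->
  corner k (upd c n x) = corner k c.
Proof. by move=> h; rewrite /corner /on_D mask_upd. Qed.

Lemma integral_pospow_disc0 (p' : R) : -1 < p' -> exists2 K : R, 0 <= K & forall s x0 : R,
  (\int[leb]_(x in [set: R]) (pospow p' (s - (x - x0) ^+ 2))%:E <= (K * pospow (p' + 2^-1) s)%:E)%E.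
Proof.
move=> p'1; have [K K0 h] := integral_pospow_disc p'1; exists K => // s x0.
rewrite {2}/pospow; case: ltP => s0; first exact: h.
rewrite mulr0 integral0_eq // => x _; rewrite /pospow ifF //.
by apply/negbTE; rewrite -leNgt subr_le0 (le_trans s0) // sqr_ge0.
Qed.

Definition border (k : nat) : seq nat := [seq n <- iota 0 N | [&& (crow n < k.+1)%N, (ccol n < k.+1)%N,
   ~~ ((crow n < k) && (ccol n < k))%N & ~~ ((crow n == k) && (ccol n == k))]].

Definition block (k : nat) : seq nat := [seq n <- iota 0 N | (crow n < k)%N && (ccol n < k)%N].

Definition didx (b : bool) (k : nat) : nat := (b + 2 * (k * q + k))%N.

(** By [disc] the integrand is D^p (s - |z - z0|^2)^p in the diagonal entry z. Two one-dimensional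
    integrations give a constant times D^p s^(p+1), and s <= 1 removes the radius since p + 1 >
    0. *)
Lemma corner_step : exists2 K : R, 0 <= K & forall (k : 'I_q) (c : coords),
  (E1 (didx false k) (E1 (didx true k) (corner k.+1)) c <= K%:E * (corner k c * (box (border k) c)%:E))%E.
Proof.
have [K1 K10 h1] := integral_pospow_disc0 p1.
have p2 : -1 < p + 2^-1 by apply: lt_trans p1 _; rewrite ltrDl.
have [K2 K20 h2] := integral_pospow_disc0 p2.
exists (K1 * K2); first exact: mulr_ge0.
move=> k c.
set f : coords -> \bar R := corner k.+1.
have f0 d : (0 <= f d)%E by exact: corner_ge0.
have mf : measurable_fun setT f by exact: measurable_corner.
pose m0 : M := \matrix_(i, j) if (i == k) && (j == k) then 0 else mask k.+1 (vmat q c) i j.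
pose cz x y : coords := upd (upd c (didx false k) x) (didx true k) y.
have idxE (b b' : bool) (i j i' j' : 'I_q) :
    ((b + 2 * (i * q + j))%N == (b' + 2 * (i' * q + j'))%N) = [&& b == b', i == i' & j == j'].
  apply/eqP/and3P => [e|[/eqP-> /eqP-> /eqP->]//].
  have := congr1 odd e; rewrite !mul2n !oddD !odd_double !addbF !oddb => ->.
  have := congr1 crow e; have := congr1 ccol e.
  by rewrite !ccol_idx // !crow_idx // => /val_inj-> /val_inj->.
have mz x y : mask k.+1 (vmat q (cz x y)) = m0 + (x +i* y) *: outer (ecol R k).
  apply/matrixP => i j; rewrite addmxE scalemxE /outer outer_ecolE /m0 [RHS]addrC maskE.
  rewrite [X in _ = _ + X]mxE maskE !vmatE /cz /upd /didx !idxE.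
  case: (i =P k) => [->|ik] /=; last by rewrite mulr0 add0r.
  case: (j =P k) => [->|jk] /=; last by rewrite mulr0 add0r.
  by rewrite !ltnSn /= mulr1 addr0.
have Pm : perp R k *m m0 *m perp R k = mask k (vmat q c).
  apply/matrixP => i j; rewrite perp_mul [m0 i j]mxE !maskE !ltnS.
  have E (a : 'I_q) : (a < k)%N = (a != k) && (a <= k)%N by rewrite ltn_neqAle.
  by rewrite !E; case: (i == k); case: (j == k); rewrite //= ?andbF.
(* If no diagonal entry completes m0 to a point of the ball, the left side is 0; otherwise [disc]
   applies and all border coordinates have modulus at most 1. *)
have [[z1 dz]|nz] := pselect (exists z1 : C, inD (m0 + z1 *: outer (ecol R k))); last first.
  have -> : E1 (didx false k) (E1 (didx true k) f) c = 0%E.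
    rewrite /E1 integral0_eq // => x _; rewrite integral0_eq // => y _.
    rewrite /f /corner /on_D asboolF // -/(cz x y) mz => h; apply: nz.
    by exists (x +i* y).
  apply: mule_ge0; first by rewrite lee_fin mulr_ge0.
  by apply: mule_ge0; [exact: corner_ge0 | rewrite lee_fin; exact: box_ge0].
have [dk [s [x0 [y0 [s1 hs]]]]] := disc dz; rewrite Pm in dk hs.
have D0 : 0 < Delta (1%:M - mask k (vmat q c) *m (mask k (vmat q c))^h).
  by rewrite Delta_sylvester; exact: Delta_gt0.
set D := Delta _ in hs D0.
have -> : box (border k) c = 1.
  apply: box_eq1 => n; rewrite mem_filter mem_iota add0n => /andP[/and4P[rn cn _ nk]] /= nN.
  have rq := crow_lt nN; have cq := ccol_lt nN.
  have := inD_entry (Ordinal rq) (Ordinal cq) dz.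
  rewrite addmxE scalemxE /outer outer_ecolE [m0 _ _]mxE maskE vmatE.
  have -> : (Ordinal rq == k) && (Ordinal cq == k) = false by apply: negbTE.
  rewrite mulr0 addr0 /= rn cn /=.
  apply: le_trans; rewrite {1}(idx_row_col n).
  case: (odd n); first by rewrite -sqrtr_sqr ler_wsqrtr // lerDr sqr_ge0.
  by rewrite -sqrtr_sqr ler_wsqrtr // lerDl sqr_ge0.
rewrite mule1.
have -> : corner k c = (D `^ p)%:E by rewrite /corner /on_D asboolT.
have mpp (p' t w : R) : measurable_fun setT (fun y : R => (pospow p' (t - (y - w) ^+ 2))%:E).
  apply/measurable_EFinP; apply: (measurableT_comp (@measurable_pospow R p')).
  apply: measurable_funB; first exact: measurable_cst.
  by apply: measurable_funX; apply: measurable_funB => //; exact: measurable_cst.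
have Dp0 : 0 <= D `^ p by exact: powR_ge0.
have inner x : (E1 (didx true k) f (upd c (didx false k) x) <=
    (D `^ p * K1)%:E * (pospow (p + 2^-1) (s - (x - x0) ^+ 2))%:E)%E.
  apply: le_trans (_ : (D `^ p)%:E * \int[leb]_(y in [set: R]) (pospow p (s - (x - x0) ^+ 2 - (y - y0) ^+ 2))%:E <= _)%E.
    rewrite -ge0_integralZl; [|exact: measurableT|exact: mpp|by move=> y _; rewrite lee_fin pospow_ge0|by rewrite lee_fin].
    apply: ge0_le_integral.
    - exact: measurableT.
    - by move=> y _; exact: f0.
    - by apply: measurable_upd_section; exact: mf.
    - by apply: emeasurable_funM; [exact: measurable_cst | exact: mpp].
    move=> y _; rewrite /f /corner /on_D -/(cz x y) mz; case: asboolP => [dxy|_]; last first.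
      by rewrite mule_ge0 // lee_fin pospow_ge0.
    rewrite hs -EFinM lee_fin.
    have : 0 < Delta (1%:M - (m0 + (x +i* y) *: outer (ecol R k)) *m (m0 + (x +i* y) *: outer (ecol R k))^h).
      by rewrite Delta_sylvester; exact: Delta_gt0.
    rewrite hs pmulr_rgt0 // => t0; rewrite /pospow t0 powRM //; exact: ltW.
  by rewrite EFinM -muleA lee_wpmul2l // -EFinM; exact: h1.
apply: le_trans (_ : (D `^ p * K1)%:E * \int[leb]_(x in [set: R]) (pospow (p + 2^-1) (s - (x - x0) ^+ 2))%:E <= _)%E.
  rewrite -ge0_integralZl.
  - apply: ge0_le_integral.
    + exact: measurableT.
    + by move=> x _; apply: E1_ge0.
    + by apply: (@measurable_upd_section R (E1 (didx true k) f)); exact: measurable_E1.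
    + by apply: emeasurable_funM; [exact: measurable_cst | exact: mpp].
    + by move=> x _; exact: inner.
  - exact: measurableT.
  - exact: mpp.
  - by move=> x _; rewrite lee_fin pospow_ge0.
  - by rewrite lee_fin mulr_ge0.
apply: le_trans (_ : (D `^ p * K1)%:E * (K2 * 1)%:E <= _)%E.
  rewrite lee_wpmul2l ?lee_fin ?mulr_ge0 //; apply: le_trans (h2 s x0) _.
  rewrite lee_fin ler_wpM2l // /pospow; case: ifP => // s0.
  have -> : p + 2^-1 + 2^-1 = p + 1 by lra.
  have e1 : 1 = (1 : R) `^ (p + 1) by rewrite powR1.
  have p0 : 0 <= p + 1 by rewrite -lerBlDr sub0r ltW.
  by rewrite [leRHS]e1 ge0_ler_powR // nnegrE; exact: ltW.
rewrite -EFinM; have -> : D `^ p * K1 * (K2 * 1) = K1 * K2 * D `^ p by ring.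
by rewrite -EFinM.
Qed.

Lemma uniq_filter_iota P n : uniq [seq k <- iota 0 n | P k].
Proof. by rewrite filter_uniq // iota_uniq. Qed.

Lemma block_step k : (k < q)%N ->
  perm_eq (block k.+1) (block k ++ border k ++ [:: didx false k; didx true k]).
Proof.
move=> kq; apply: uniq_perm; first exact: uniq_filter_iota.
  rewrite !cat_uniq !uniq_filter_iota /= inE andbT; apply/and3P; split; last by apply/eqP; rewrite /didx; lia.
    apply/hasPn => n; rewrite mem_cat !mem_filter; case/orP.
      by move=> /andP[/and4P[_ _ /negbTE-> _] _].
    by rewrite !inE => /orP[] /eqP->; rewrite /didx crow_idx // ltnn.
  by rewrite !mem_filter /didx !crow_idx // !ccol_idx // eqxx /= !andbF.
have din b : didx b k \in iota 0 N by rewrite mem_iota /didx idx_lt.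
move=> n; rewrite !mem_cat !mem_filter !inE.
have -> : (n == didx false k) || (n == didx true k) = [&& crow n == k, ccol n == k & n \in iota 0 N].
  apply/orP/and3P.
    by case=> /eqP ->; rewrite /didx crow_idx // ccol_idx // eqxx; split=> //; rewrite mem_iota idx_lt.
  move=> [/eqP rn /eqP cn _]; rewrite (idx_row_col n) rn cn /didx.
  by case: (odd n); rewrite eqxx; [right|left].
case: (n \in iota 0 N); rewrite ?andbF // !andbT !ltnS.
by move: (crow n) (ccol n) => a b; lia.
Qed.

Lemma Es_corner_finite k : (k <= q)%N -> exists2 K : R, 0 <= K &
  forall c, (Es (block k) (corner k) c <= K%:E)%E.
Proof.
elim: k => [|k IH] kq.
  exists 1 => // c; rewrite /block (eq_filter (a2 := pred0)) // filter_pred0 /=.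
  rewrite /corner /on_D; case: ifP => // _.
  have -> : mask 0 (vmat q c) = 0 by apply/matrixP => i j; rewrite !mxE.
  by rewrite mul0mx subr0 /Delta det1 powR1.
have [K K0 hK] := IH (ltnW kq); have [K' K'0 hs] := corner_step.
exists (K' * 2 ^+ size (border k) * K) => [|c]; first by rewrite !mulr_ge0 // exprn_ge0.
have mc := @measurable_corner; have c0 := corner_ge0.
have mb : measurable_fun setT (fun c : coords => (corner k c * (box (border k) c)%:E)%E).
  by apply: emeasurable_funM => //; apply/measurable_EFinP; exact: measurable_box.
have b0 d : (0 <= corner k d * (box (border k) d)%:E)%E.
  by rewrite mule_ge0 // lee_fin box_ge0.
have K'e : (0 <= K'%:E)%E by rewrite lee_fin.
(* By Tonelli the diagonal entry is integrated innermost and the border next, leaving the smaller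
   corner outermost. *)
rewrite (Es_perm _ (c0 _) (mc _) (uniq_filter_iota _ _) (block_step kq)) !Es_cat.
apply: le_trans (_ : Es (block k) (fun c => (K' * 2 ^+ size (border k))%:E * corner k c)%E c <= _)%E.
  apply: le_Es.
  - by move=> d; apply: Es_ge0 => e; exact: corner_ge0.
  - by move=> d; rewrite mule_ge0 // lee_fin mulr_ge0 // exprn_ge0.
  - exact: measurable_Es.
  - by apply: emeasurable_funM => //; exact: measurable_cst.
  move=> d; rewrite Es_cat; apply: le_trans (_ : Es (border k) (fun c => K'%:E * (corner k c * (box (border k) c)%:E))%E d <= _)%E.
    apply: le_Es => //.
    - by move=> e; apply: Es_ge0.
    - by move=> e; rewrite mule_ge0.
    - exact: measurable_Es.
    - by apply: emeasurable_funM => //; exact: measurable_cst.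
    by move=> e; exact: (hs (Ordinal kq)).
  rewrite (EsZl _ _ K'e b0 mb) EFinM -muleA; apply: (lee_wpmul2l K'e).
  apply: (Es_box _ (uniq_filter_iota _ _) (c0 k) (mc k)).
  by move=> n e x; rewrite mem_filter => /andP[/and4P[_ _ h _] _]; exact: corner_upd.
have e0 : (0 <= (K' * 2 ^+ size (border k))%:E)%E by rewrite lee_fin mulr_ge0 // exprn_ge0.
rewrite (EsZl _ _ e0 (c0 k) (mc k)) [X in (_ <= X)%E]EFinM.
exact: lee_wpmul2l.
Qed.

Lemma itint_Delta_pow_finite :
  (itint N (on_D (@inD R q) (fun v => (Delta (1%:M - v *m v^h) `^ p)%R)) < +oo)%E.
Proof.
have [K K0 h] := Es_corner_finite (leqnn q).
rewrite itint_Es; apply: le_lt_trans (ltry K).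
have -> : on_D (@inD R q) (fun v => Delta (1%:M - v *m v^h) `^ p) = corner q.
  by apply/funext => c; rewrite /corner /on_D mask_full.
have E : block q = iota 0 N.
  apply/all_filterP/allP => n; rewrite mem_iota => /andP[_ nN].
  by rewrite crow_lt ?ccol_lt.
by rewrite -E; exact: h.
Qed.
End Kappa.

(** * Polar decomposition *)

Section Polar.
Variables (R : realType) (q : nat).
Local Notation C := (R[i]).
Local Notation M := ('M[C]_q).
Implicit Types (A B P : M).

Lemma rdiag_mulE (d : 'I_q -> R) B i j : (rdiag d *m B) i j = (d i)%:C * B i j.
Proof. by rewrite /rdiag mul_diag_mx !mxE. Qed.

Lemma rdiagE (d : 'I_q -> R) i j : rdiag d i j = (d i)%:C * (i == j)%:R.
Proof. by rewrite -[rdiag d]mulmx1 rdiag_mulE mxE. Qed.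

(* The zero rows of [B] are replaced one at a time by vectors orthogonal to all rows. *)
Lemma complete_rows B e : B *m B^h = rdiag e -> (forall i, 0 <= e i) ->
  exists B' e', [/\ B' *m B'^h = rdiag e', forall i, 0 < e' i & rdiag e *m B' = rdiag e *m B].
Proof.
elim/ltn_ind: #|_| {-2}e B (erefl #|[set i | e i == 0%R]|%SET) => n IH {}e B En BB e0.
have [/existsP[i /eqP ei]|] := boolP [exists i, e i == 0]; last first.
  rewrite negb_exists => /forallP en; exists B, e; split=> // i.
  by rewrite lt_neqAle eq_sym en e0.
have [u u0 Bu] : exists2 u : 'cV[C]_q, u != 0 & B *m u = 0.
  apply: contrapT => h; have uB : B \in unitmx.
    apply: unit_ker => u Bu; apply/eqP; apply: contrapT => /negP u0; apply: h; by exists u.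
  have : rdiag e \in unitmx by rewrite -BB unitmx_mul uB mxadj_unit.
  rewrite unitmxE /rdiag det_diag (bigD1 i) //= mxE ei mul0r unitr0 //.
pose B1 := B + ecol R i *m u^h.
pose e1 j := if j == i then rq 1%:M u else e j.
have r0 := rq1_gt0 u0.
have BB1 : B1 *m B1^h = rdiag e1.
  have uu : u^h *m u = (rq 1%:M u)%:C%:M.
    have := herm_form_real u (mxadj1 _ q); rewrite mulmx1 => h.
    by apply/matrixP => a b; rewrite !ord1 h [RHS]mxE eqxx mulr1n.
  rewrite /B1 mxadjD mxadjM mxadjK mulmxDl !mulmxDr BB [B *m _]mulmxA Bu mul0mx addr0.
  rewrite -[_ *m u^h *m B^h]mulmxA -mxadjM Bu mxadj0 mulmx0 add0r.
  rewrite -mulmxA (mulmxA u^h) uu mul_scalar_mx -scalemxAr.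
  apply/matrixP => a b; rewrite addmxE scalemxE outer_ecolE !rdiagE /e1.
  case: (a =P i) => [->|ai] /=; last by rewrite mulr0 addr0.
  by rewrite ei mul0r add0r eq_sym.
have lt1 : (#|[set j | e1 j == 0%R]|%SET < n)%N.
  rewrite -En; apply: proper_card; apply/properP; split.
    apply/fintype.subsetP => j; rewrite !inE /e1; case: (j =P i) => [->|//]; by rewrite ei.
  by exists i; rewrite !inE ?ei // /e1 eqxx gt_eqF.
have e10 j : 0 <= e1 j by rewrite /e1; case: ifP => // _; exact: ltW.
have [B' [e' [h1 h2 h3]]] := IH _ lt1 e1 B1 (erefl _) BB1 e10.
exists B', e'; split=> //.
apply/matrixP => a b; rewrite !rdiag_mulE; case: (a =P i) => [->|ai]; first by rewrite ei !mul0r.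
have := congr1 (fun X : M => X a b) h3; rewrite /= !rdiag_mulE /e1; move/eqP/negbTE: (ai) => ->.
move=> ->; congr (_ * _); rewrite /B1 addmxE mxE big_ord1 /ecol deltamxE.
by move/eqP/negbTE: ai => ->; rewrite mul0r addr0.
Qed.

(** P may be singular, so u cannot be found by inversion. In an eigenbasis of P the rows of A are
    orthogonal with lengths d i; zero rows are filled up and all rows normalised. *)
Lemma polar A P : Psd P -> A *m A^h = P *m P -> exists2 u, unitary u & A = P *m u.
Proof.
move=> pP AA; have [U [d [uU E]]] := herm_spectral (psd_herm pP).
have d0 i : 0 <= d i by rewrite -(rq_spectral d i uU) -E; exact: psd_rq.
have UU := unitaryC uU.
pose B := U^h *m A.
have BB : B *m B^h = rdiag (fun i => d i * d i).
  rewrite /B mxadjM mxadjK mulmxA -[U^h *m A *m _]mulmxA AA E -rdiagM !mulmxA UU mul1mx.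
  by rewrite -[_ *m U^h *m U]mulmxA UU mulmx1 -[_ *m U^h *m U]mulmxA UU mulmx1.
have [C [e [CC e0 h]]] := complete_rows BB (fun i => mulr_ge0 (d0 i) (d0 i)).
have hij i j : (d i * d i)%:C * C i j = (d i * d i)%:C * B i j.
  by have := congr1 (fun X : M => X i j) h; rewrite /= !rdiag_mulE.
pose W := rdiag (fun i => (Num.sqrt (e i))^-1) *m C.
have uW : unitary W.
  rewrite /unitary /W mxadjM rdiag_adj mulmxA -[_ *m C *m _]mulmxA CC !rdiagM.
  apply/matrixP => i j; rewrite rdiagE [in RHS]mxE.
  have -> : (Num.sqrt (e i))^-1 * e i * (Num.sqrt (e i))^-1 = 1.
    rewrite mulrAC -invfM -expr2 sqr_sqrtr ?ltW // mulVf // gt_eqF //.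
  by rewrite mul1r.
have DW : rdiag d *m W = B.
  apply/matrixP => i j; rewrite /W mulmxA rdiagM rdiag_mulE.
  (* For d i = 0 the i-th row of B has length 0, and the factor d i removes the filler row;
     otherwise C and B agree in row i and e i = d i ^ 2. *)
  have [di|di] := eqVneq (d i) 0.
    rewrite di mul0r mul0r.
    have : complex.Re ((B *m B^h) i i) = 0 by rewrite BB rdiagE di mul0r mul0r.
    have Ek k : complex.Re (B i k * B^h k i) = normc (B i k) ^+ 2 by rewrite mxadjE mul_conj_normc.
    rewrite mxE raddf_sum /= => /eqP; rewrite psumr_eq0; last by move=> k _; rewrite Ek sqr_ge0.
    move=> /allP /(_ j (mem_index_enum _)); rewrite /= Ek sqrf_eq0 => /eqP /eq0_normc ->.
    by [].
  have dd : (d i * d i)%:C != 0 by rewrite (fmorph_eq0) mulf_neq0.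
  have CB k : C i k = B i k by apply: (mulfI dd); exact: hij.
  have ei : e i = d i * d i.
    have : (C *m C^h) i i = (B *m B^h) i i.
      by rewrite !mxE; apply: eq_bigr => k _; rewrite !mxadjE CB.
    by rewrite CC BB !rdiagE eqxx !mulr1 => /(congr1 (@complex.Re R)).
  rewrite ei -expr2 sqrtr_sqr ger0_norm // divff // mul1r; exact: CB.
exists (U *m W).
  by rewrite /unitary mxadjM mulmxA -[U *m W *m _]mulmxA uW mulmx1.
by rewrite E mulmxA -[_ *m U^h *m U]mulmxA UU mulmx1 -mulmxA DW /B mulmxA uU mul1mx.
Qed.
End Polar.

(** * Convolution integrals and changes of variables *)

Lemma pmule_cancel (R : realType) (k : R) (a b : \bar R) : 0 < k ->
  (k%:E * a = b * k%:E)%E -> a = b.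
Proof.
move=> k0; rewrite muleC => e.
have h (x : \bar R) : (x * k%:E * (k^-1)%:E = x)%E.
  by rewrite -muleA -EFinM mulfV ?mule1 // gt_eqF.
by rewrite -(h a) e h.
Qed.

Lemma funepos_compr (R : realType) T U (f : U -> \bar R) (g : T -> U) :
  ((f \o g)^\+ = f^\+ \o g)%E.
Proof. by apply/funext => x; rewrite /comp !funeposE. Qed.

Lemma funeneg_compr (R : realType) T U (f : U -> \bar R) (g : T -> U) :
  ((f \o g)^\- = f^\- \o g)%E.
Proof. by apply/funext => x; rewrite /comp !funenegE. Qed.

Lemma itint_posneg (R : realType) N (f : coords R -> \bar R) : measurable_fun setT f ->
  (itint N (fun c => `|f c|) < +oo)%E -> itint N f = (itint N f^\+ - itint N f^\-)%E.
Proof. by move=> mf; rewrite !itint_Es => h; exact: Es_posneg. Qed.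

Section Convolution.
Variables (R : realType) (q : nat) (mu : R).
Local Notation C := (R[i]).
Local Notation M := ('M[C]_q).
Local Notation coords := (coords R).
Local Notation N := (2 * q * q)%N.
Hypothesis mu1 : rho R q - 1 < mu.
Local Notation p := (mu - rho R q).
Implicit Types (r s v : M) (f g : M -> R).

Definition carg r s v : M := r *m r + s *m s + s *m v *m r + r *m v^h *m s.
Definition wt v : R := Delta (1%:M - v *m v^h) `^ p.

Lemma carg_conv_arg r s v : Psd r -> Psd s -> carg r s v = conv_arg (r *m r) (s *m s) v.
Proof. by move=> pr ps; rewrite /conv_arg !sqr_msqrtK. Qed.

Lemma carg_psd r s v : Psd r -> Psd s -> inD v -> Psd (carg r s v).
Proof.
move=> pr ps dv; rewrite carg_conv_arg //.
by apply: conv_arg_psd => //; apply: psd_sqr; exact: psd_herm.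
Qed.

Lemma convE r s f : conv mu r s f =
  (fine (kappa q mu))^-1 * fine (itint N (on_D (@inD R q) (fun v => f (msqrt (carg r s v)) * wt v))).
Proof. by []. Qed.

Lemma kappaE : kappa q mu = itint N (on_D (@inD R q) wt).
Proof.
have -> : wt = fun v => Delta (1%:M - v^h *m v) `^ p.
  by apply/funext => v; rewrite /wt Delta_sylvester.
by [].
Qed.

Lemma p_gt : -1 < p. Proof. by rewrite ltrBrDl. Qed.

Lemma kappa_lty : (kappa q mu < +oo)%E.
Proof. by rewrite kappaE; exact: itint_Delta_pow_finite p_gt. Qed.

Lemma mopen_inD : mopen (@inD R q).
Proof. by move=> v dv; have := inD_open (@contM_id R q) dv. Qed.

Lemma contD_wt : contD (@inD R q) wt.
Proof. exact: (contD_Delta_pow p (@contM_id R q)). Qed.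

Lemma wt_ge0 v : 0 <= wt v. Proof. exact: powR_ge0. Qed.

Lemma wt_gt0 v : inD v -> 0 < wt v.
Proof. by move=> dv; rewrite powR_gt0 // Delta_sylvester; exact: Delta_gt0. Qed.

(** A section of [vmat], with value 0 at the indices that belong to no matrix entry. *)
Definition mcoord v (n : nat) : R :=
  match insub (crow q n), insub (ccol q n) with
  | Some i, Some j => if odd n then complex.Im (v i j) else complex.Re (v i j)
  | _, _ => 0 end.

Lemma mcoord_idx v (b : bool) (i j : 'I_q) :
  mcoord v (b + 2 * (i * q + j)) = if b then complex.Im (v i j) else complex.Re (v i j).
Proof.
rewrite /mcoord crow_idx // ccol_idx // !valK mul2n oddD odd_double addbF oddb.
by case: b.
Qed.

Lemma vmat_mcoord v : vmat q (mcoord v) = v.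
Proof.
apply/matrixP => i j; rewrite vmatE (mcoord_idx v false) (mcoord_idx v true).
by case: (v i j).
Qed.

Lemma kappa_gt0 : (0 < kappa q mu)%E.
Proof.
rewrite kappaE; have d0 : inD (0 : M).
  by rewrite inDE mulmx0 subr0; exact: pd1.
apply: (@itint_on_D_gt0 R q _ _ (mcoord 0)).
- exact: mopen_inD.
- exact: contD_wt.
- by move=> v _; exact: wt_ge0.
- by rewrite vmat_mcoord.
- by rewrite vmat_mcoord; exact: wt_gt0.
Qed.

Definition kap : R := fine (kappa q mu).
Lemma kapE : kappa q mu = kap%:E.
Proof. by rewrite fineK // ge0_fin_numE ?kappa_lty // ltW // kappa_gt0. Qed.
Lemma kap_gt0 : 0 < kap.
Proof. by have := kappa_gt0; rewrite kapE lte_fin. Qed.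

Lemma vmat_ext (c c' : nat -> R) : (forall k, (k < N)%N -> c k = c' k) -> vmat q c = vmat q c'.
Proof. by move=> h; apply/matrixP => i j; rewrite !vmatE !h // idx_lt. Qed.

Lemma on_D_eq (D : M -> Prop) h h' c c' : (D (vmat q c) <-> D (vmat q c')) ->
  h (vmat q c) = h' (vmat q c') -> on_D D h c = on_D D h' c'.
Proof. by rewrite /on_D => /asbool_equiv_eq -> ->. Qed.

Lemma on_D_finitary (D : M -> Prop) h : finitary N (on_D D h : coords -> \bar R).
Proof. by move=> c c' /vmat_ext e; rewrite /on_D e. Qed.

Lemma itint_le (F G : coords -> \bar R) : (forall c, 0 <= F c)%E -> measurable_fun setT F ->
  measurable_fun setT G -> (forall c, F c <= G c)%E -> (itint N F <= itint N G)%E.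
Proof.
move=> F0 mF mG FG; rewrite !itint_Es; apply: le_Es => //.
by move=> c; apply: le_trans (FG c).
Qed.

Section Weighted.
Variables (h : M -> R) (B : R).
Hypothesis ch : contD (@inD R q) h.
Hypothesis hB : forall v, inD v -> `|h v| <= B.
Local Notation F := (on_D (@inD R q) (fun v => h v * wt v) : coords -> \bar R).

Lemma measurable_weighted : measurable_fun setT F.
Proof.
apply: measurable_on_D; first exact: mopen_inD.
by apply: contD_mul => //; exact: contD_wt.
Qed.

Lemma measurable_wt : measurable_fun setT (on_D (@inD R q) wt : coords -> \bar R).
Proof. by apply: measurable_on_D; [exact: mopen_inD | exact: contD_wt]. Qed.

Lemma on_wt_ge0 (c : coords) : (0 <= on_D (@inD R q) wt c)%E.
Proof. by rewrite /on_D; case: ifP => // _; rewrite lee_fin wt_ge0. Qed.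

Lemma measurable_abs_weighted : measurable_fun setT (fun c => `|F c|%E).
Proof. by apply: measurableT_comp => //; exact: measurable_weighted. Qed.

Lemma itint_abs_weighted : (itint N (fun c => `|F c|) < +oo)%E.
Proof.
have B0 : 0 <= Num.max B 0 by rewrite le_max lexx orbT.
have B0e : (0 <= (Num.max B 0)%:E :> \bar R)%E by rewrite lee_fin.
apply: le_lt_trans (_ : itint N (fun c => (Num.max B 0)%:E * on_D (@inD R q) wt c)%E < _)%E.
  apply: itint_le.
  - by move=> c; exact: abse_ge0.
  - exact: measurable_abs_weighted.
  - by apply: emeasurable_funM; [exact: measurable_cst | exact: measurable_wt].
  move=> c; rewrite /on_D; case: asboolP => [dv|_]; last by rewrite abse0 mule0.
  rewrite -EFinM lee_fin normrM (ger0_norm (wt_ge0 _)) ler_wpM2r ?wt_ge0 //.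
  by rewrite le_max hB.
rewrite itint_Es (EsZl _ _ B0e on_wt_ge0 measurable_wt) -itint_Es -kappaE kapE -EFinM.
exact: ltry.
Qed.

Lemma weighted_gt0 v : (forall v, inD v -> 0 <= h v) -> inD v -> 0 < h v -> 0 < fine (itint N F).
Proof.
move=> h0 dv hv.
have F0 c : (0 <= F c)%E.
  by rewrite /on_D; case: asboolP => // d; rewrite lee_fin mulr_ge0 ?wt_ge0 ?h0.
apply: fine_gt0; apply/andP; split.
  apply: (@itint_on_D_gt0 R q _ _ (mcoord v)).
  - exact: mopen_inD.
  - by apply: contD_mul => //; exact: contD_wt.
  - by move=> w dw; rewrite mulr_ge0 ?wt_ge0 ?h0.
  - by rewrite vmat_mcoord.
  - by rewrite vmat_mcoord mulr_gt0 // wt_gt0.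
have := itint_abs_weighted; rewrite (_ : (fun c => `|F c|%E) = F) //.
by apply/funext => c; rewrite gee0_abs.
Qed.

Variable L : M -> M.
Hypothesis Ladd : forall v w, L (v + w) = L v + L w.
Hypothesis Lsurj : forall v, exists w, L w = v.
Hypothesis Lcont : contM L.
Hypothesis LD : forall v, inD (L v) <-> inD v.
Hypothesis Lwt : forall v, wt (L v) = wt v.

Let Lc (c : coords) : coords := mcoord (L (vmat q c)).

Lemma Lc_vmat (c : coords) : vmat q (Lc c) = L (vmat q c). Proof. exact: vmat_mcoord. Qed.

Lemma measurable_Lc : measurable_fun setT Lc.
Proof.
apply: measurable_to_coords => n; rewrite /Lc /mcoord.
case: insubP => [i _ _|_]; last exact: measurable_cst.
case: insubP => [j _ _|_]; last exact: measurable_cst.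
have part (P : C -> R) : (forall z w, `|P z - P w| <= normc (z - w)) ->
    measurable_fun setT (fun c : coords => P (L (vmat q c) i j)).
  move=> hP; apply/measurable_EFinP.
  have := @measurable_on_D R q (fun=> True) (fun v => P (L v i j)).
  rewrite (_ : on_D _ _ = fun c => (P (L (vmat q c) i j))%:E); last first.
    by apply/funext => c; rewrite /on_D asboolT.
  apply; first by move=> v _; exists 1.
  move=> v _ e e0; have [d d0 hd] := Lcont i j v e0; exists d => // w _ /hd.
  by apply: le_lt_trans; exact: hP.
case: (odd n); apply: part => z w.
  by case: z w => [a b] [a' b'] /=; rewrite -sqrtr_sqr ler_wsqrtr // lerDr sqr_ge0.
by case: z w => [a b] [a' b'] /=; rewrite -sqrtr_sqr ler_wsqrtr // lerDl sqr_ge0.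
Qed.

Lemma vmat_cadd (c d : nat -> R) : vmat q (cadd c d) = vmat q c + vmat q d.
Proof. by apply/matrixP => i j; rewrite addmxE !vmatE. Qed.

Lemma vmat_copp (c : nat -> R) : vmat q (copp c) = - vmat q c.
Proof. by apply/matrixP => i j; rewrite oppmxE !vmatE. Qed.

Lemma mcoordD v w n : mcoord (v + w) n = mcoord v n + mcoord w n.
Proof.
rewrite /mcoord; case: insubP => [i _ _|_]; last by rewrite addr0.
case: insubP => [j _ _|_]; last by rewrite addr0.
by rewrite addmxE; case: (odd n); rewrite raddfD.
Qed.

Lemma mcoord_vmat (c : nat -> R) n : (n < N)%N -> mcoord (vmat q c) n = c n.
Proof.
move=> nN; rewrite [in LHS](idx_row_col q n).
have -> : crow q n = Ordinal (crow_lt nN) by []. have -> : ccol q n = Ordinal (ccol_lt nN) by [].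
rewrite mcoord_idx vmatE /= [in RHS](idx_row_col q n).
by case: (odd n).
Qed.

Lemma itint_inv_ge0 (g : coords -> \bar R) : (forall c, 0 <= g c)%E -> measurable_fun setT g ->
  finitary N g -> itint N (g \o Lc) = itint N g.
Proof.
move=> g0 mg fg.
pose k : coords -> \bar R := on_D (@inD R q) wt.
have kL : k \o Lc = k.
  apply/funext => c; apply: on_D_eq; rewrite Lc_vmat; [exact: LD | exact: Lwt].
have := @itint_linear_mul R N Lc k g measurable_Lc.
rewrite kL -kappaE kapE => mul.
suff : (kap%:E * itint N g = itint N (g \o Lc) * kap%:E)%E.
  by move=> e; symmetry; exact: pmule_cancel kap_gt0 e.
apply: mul.
- by move=> n _ c d; rewrite /Lc vmat_cadd Ladd mcoordD.
- move=> d; have [w hw] := Lsurj (vmat q d); exists (mcoord w) => n nN.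
  by rewrite /Lc vmat_mcoord hw mcoord_vmat.
- exact: on_wt_ge0.
- exact: measurable_wt.
- exact: on_D_finitary.
- exact: g0.
- exact: mg.
- exact: fg.
- move=> c; apply: on_D_eq; rewrite vmat_copp.
    by split=> [/inD_opp|/inD_opp //]; rewrite opprK.
  by rewrite /wt mxadjN mulNmx mulmxN opprK.
- by move=> n _ c c' /vmat_ext e; rewrite /Lc e.
Qed.

(** As h may change sign, invariance is applied to the positive and negative parts; boundedness of h
    and finiteness of kappa make the iterated integral their difference. *)
Lemma itint_inv : itint N (on_D (@inD R q) (fun v => h (L v) * wt v)) = itint N F.
Proof.
have -> : on_D (@inD R q) (fun v => h (L v) * wt v) = F \o Lc.
  apply/funext => c; apply: on_D_eq; rewrite Lc_vmat; last by rewrite Lwt.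
  exact: (iff_sym (LD (vmat q c))).
have mF := measurable_weighted.
have fF := on_D_finitary (@inD R q) (fun v => h v * wt v).
have mFL : measurable_fun setT (F \o Lc) by apply: measurableT_comp => //; exact: measurable_Lc.
have aF := itint_abs_weighted.
have inv := itint_inv_ge0.
have aFL : (itint N (fun c => `|(F \o Lc) c|) < +oo)%E.
  have -> : itint N (fun c => `|(F \o Lc) c|%E) = itint N (fun c => `|F c|%E); last exact: aF.
  apply: (inv (fun c => `|F c|%E)).
  - by move=> c; exact: abse_ge0.
  - exact: measurable_abs_weighted.
  - by move=> c c' /fF ->.
apply: (etrans (itint_posneg mFL aFL)); apply: etrans (esym (itint_posneg mF aF)).
have ep : (itint N (F \o Lc)^\+ = itint N F^\+)%E.
  apply: (etrans (congr1 (itint N) (funepos_compr F Lc))).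
  apply: (inv (F^\+)%E).
  - by move=> c; exact: funepos_ge0.
  - exact: (measurable_funepos mF).
  - by move=> c c' /fF e; rewrite !funeposE e.
have en : (itint N (F \o Lc)^\- = itint N F^\-)%E.
  apply: (etrans (congr1 (itint N) (funeneg_compr F Lc))).
  apply: (inv (F^\-)%E).
  - by move=> c; exact: funeneg_ge0.
  - exact: (measurable_funeneg mF).
  - by move=> c c' /fF e; rewrite !funenegE e.
exact: (f_equal2 (fun a b => a - b)%E ep en).
Qed.
End Weighted.
End Convolution.

(** * Automorphisms act on the cone *)

Section Continuous.
Variables (R : realType) (q : nat).
Local Notation C := (R[i]).
Local Notation M := ('M[C]_q).
Implicit Types (x y w : M) (T : M -> M) (f : M -> R).

Lemma mN_small (d : R) x : 0 < d -> mnorm x < d / ((q * q)%:R + 1) -> mN x < d.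
Proof.
move=> d0; have q0 : 0 <= (q * q)%:R :> R by [].
rewrite ltr_pdivlMr ?ltr_wpDl // => h; apply: le_lt_trans (mN_le_mnorm x) _.
apply: le_lt_trans h; rewrite mulrDr mulr1 mulrC lerDl.
by rewrite mnormE sqrtr_ge0.
Qed.

Lemma contPiE T : contPi T <-> forall x, Psd x -> forall e : R, 0 < e -> exists2 d : R, 0 < d &
  forall y, Psd y -> mN (y - x) < d -> mN (T y - T x) < e.
Proof.
rewrite /contPi PsdE; have q0 : 0 < (q * q)%:R + 1 :> R by rewrite ltr_wpDl.
split=> h x px e e0.
  have e1 : 0 < e / ((q * q)%:R + 1) by rewrite divr_gt0.
  have [d d0 hd] := h x px _ e1; exists d => // y py yx; apply: mN_small => //.
  by apply: hd => //; exact: le_lt_trans (mnorm_le_mN _) yx.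
have [d d0 hd] := h x px _ e0; exists (d / ((q * q)%:R + 1)); first by rewrite divr_gt0.
move=> y py yx; apply: le_lt_trans (mnorm_le_mN _) _.
by apply: hd => //; exact: mN_small.
Qed.

Lemma contPiRE f : contPiR f <-> forall x, Psd x -> forall e : R, 0 < e -> exists2 d : R, 0 < d &
  forall y, Psd y -> mN (y - x) < d -> `|f y - f x| < e.
Proof.
rewrite /contPiR PsdE; have q0 : 0 < (q * q)%:R + 1 :> R by rewrite ltr_wpDl.
split=> h x px e e0.
  have [d d0 hd] := h x px _ e0; exists d => // y py yx.
  by apply: hd => //; exact: le_lt_trans (mnorm_le_mN _) yx.
have [d d0 hd] := h x px _ e0; exists (d / ((q * q)%:R + 1)); first by rewrite divr_gt0.
by move=> y py yx; apply: hd => //; exact: mN_small.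
Qed.

Lemma contPiR_comp f T : (forall x, Psd x -> Psd (T x)) -> contPi T -> contPiR f -> contPiR (f \o T).
Proof.
move=> pT cT cf x; rewrite PsdE => px e e0.
have pTx : psd (T x) by rewrite PsdE; exact: pT.
have [d1 d10 h1] := cf _ pTx e e0.
have px' : psd x by rewrite PsdE.
have [d d0 h] := cT x px' d1 d10; exists d => // y py yx.
have py' : psd y by rewrite PsdE.
by apply: (h1 _ _ (h y py' yx)); rewrite PsdE; exact: pT.
Qed.

Lemma contPi_comp T T' : (forall x, Psd x -> Psd (T x)) -> contPi T -> contPi T' -> contPi (T' \o T).
Proof.
move=> pT cT cf x; rewrite PsdE => px e e0.
have pTx : psd (T x) by rewrite PsdE; exact: pT.
have [d1 d10 h1] := cf _ pTx e e0.
have px' : psd x by rewrite PsdE.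
have [d d0 h] := cT x px' d1 d10; exists d => // y py yx.
have py' : psd y by rewrite PsdE.
by apply: (h1 _ _ (h y py' yx)); rewrite PsdE; exact: pT.
Qed.

Lemma msqrt_contPi : contPi (@msqrt R q).
Proof.
apply/contPiE => x px e e0; have q0 : 0 <= q%:R ^+ 4 :> R by rewrite exprn_ge0.
have d0 : 0 < e / (q%:R ^+ 4 + 1) by rewrite divr_gt0 // ltr_wpDl.
exists ((e / (q%:R ^+ 4 + 1)) ^+ 2); first by rewrite exprn_gt0.
move=> y py yx; apply: le_lt_trans (msqrt_cont px py) _.
have : Num.sqrt (mN (y - x)) < e / (q%:R ^+ 4 + 1).
  by rewrite -[ltRHS]ger0_norm ?(ltW d0) // -sqrtr_sqr ltr_sqrt // exprn_gt0.
rewrite ltr_pdivlMr ?ltr_wpDl // => h; apply: le_lt_trans h.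
by rewrite mulrDr mulr1 mulrC lerDl sqrtr_ge0.
Qed.

Lemma contM_contPi T : contM T -> contPi T.
Proof.
move=> cT; apply/contPiE => x _ e e0; have [d d0 h] := contM_mN x cT e0.
by exists d => // y _; exact: h.
Qed.

Lemma sqr_contPi : contPi (fun x : M => x *m x).
Proof. by apply: contM_contPi; apply: contM_mul; exact: contM_id. Qed.

Lemma contPi_ext T T' : (forall x, Psd x -> T x = T' x) -> contPi T -> contPi T'.
Proof.
move=> e cT x px e' e'0; have [d d0 h] := cT x px e' e'0; exists d => // y py yx.
by rewrite -!e -?PsdE //; exact: h.
Qed.

Lemma contM_carg (r s : M) : contM (carg r s).
Proof.
have c0 := @contM_cst R q.
by apply: contM_add; [apply: contM_add; [exact: c0 | apply: contM_mul; [apply: contM_mul|]] |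
  apply: contM_mul; [apply: contM_mul|]]; rewrite ?/id;
  first [exact: c0 | exact: contM_id | apply: contM_adj; exact: contM_id].
Qed.

Lemma contD_carg (r s : M) f : Psd r -> Psd s -> contPiR f ->
  contD (@inD R q) (fun v => f (msqrt (carg r s v))).
Proof.
move=> pr ps cf v dv e e0.
have /contPiRE cfs := contPiR_comp (@msqrt_psd R q) msqrt_contPi cf.
have [d1 d10 h1] := cfs _ (carg_psd pr ps dv) e e0.
have [d d0 h] := contM_mN v (contM_carg r s) d10.
by exists d => // w dw /h; apply: h1; exact: carg_psd.
Qed.

Definition bump (w0 : M) (d : R) : M -> R := fun w => Num.max 0 (d - mN (w - w0)).

Lemma bump_ge0 w0 d w : 0 <= bump w0 d w. Proof. by rewrite le_max lexx. Qed.

Lemma bump_le w0 d w : 0 < d -> `|bump w0 d w| <= d.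
Proof.
move=> d0; rewrite ger0_norm ?bump_ge0 // ge_max ltW //= lerBlDr lerDl; exact: mN_ge0.
Qed.

Lemma bump_center w0 d : 0 < d -> bump w0 d w0 = d.
Proof. by move=> d0; rewrite /bump subrr mN0 subr0; apply/max_idPr/ltW. Qed.

Lemma bump_eq0 w0 d w : d <= mN (w - w0) -> bump w0 d w = 0.
Proof. by move=> h; apply/max_idPl; rewrite subr_le0. Qed.

Lemma bump_Cc w0 d : Cc (bump w0 d).
Proof.
split.
  apply/contPiRE => x _ e e0; exists e => // y _ yx; apply: le_lt_trans yx.
  have h1 := mN_tri x y w0; have h2 := mN_tri y x w0.
  rewrite (mNB x y) in h2; rewrite /bump.
  move: h1 h2 (mN_ge0 (y - x)); move: (mN (y - w0)) (mN (x - w0)) (mN (y - x)) => a b c h1 h2 c0.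
  by rewrite ler_distlC /Order.max; case: ifP => h3; case: ifP => h4; apply/andP; split; lra.
exists (mN w0 + d) => x _ hx; apply: bump_eq0.
have := le_lt_trans (mnorm_le_mN x) (le_lt_trans (lexx _) _).
move=> _; have h := mnorm_le_mN x; have h2 := mN_tri w0 x 0; rewrite !subr0 in h2; lra.
Qed.
End Continuous.

Section Support.
Variables (R : realType) (q : nat) (mu : R).
Local Notation C := (R[i]).
Local Notation M := ('M[C]_q).
Hypothesis mu1 : rho R q - 1 < mu.
Implicit Types (x y r s v w : M) (T : M -> M) (f : M -> R).

Lemma fine_itint_eq0 (D : M -> Prop) h : (forall v, D v -> h v = 0) ->
  itint (2 * q * q) (on_D D h) = 0%E.
Proof.
move=> h0; have -> : on_D D h = (fun=> 0%E).
  by apply/funext => c; rewrite /on_D; case: asboolP => // /h0 ->.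
by elim: (2 * q * q)%N => //= n ->; rewrite integral0.
Qed.

Lemma conv_eq0 r s f : (forall v, inD v -> f (msqrt (carg r s v)) = 0) -> conv mu r s f = 0.
Proof.
move=> h; rewrite convE fine_itint_eq0 ?mulr0 // => v dv.
by rewrite h // mul0r.
Qed.

Lemma conv_gt0 r s f B v : Psd r -> Psd s -> contPiR f -> (forall w, Psd w -> 0 <= f w <= B) ->
  inD v -> 0 < f (msqrt (carg r s v)) -> 0 < conv mu r s f.
Proof.
move=> pr ps cf fB dv fv; rewrite convE mulr_gt0 ?invr_gt0 //; first exact: kap_gt0 mu1.
have pc w : inD w -> Psd (msqrt (carg r s w)).
  by move=> dw; apply: msqrt_psd; exact: carg_psd.
have ch := contD_carg pr ps cf.
have hB w : inD w -> `|f (msqrt (carg r s w))| <= B.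
  by move=> dw; have /andP[f0 f1] := fB _ (pc w dw); rewrite ger0_norm.
have h0 w : inD w -> 0 <= f (msqrt (carg r s w)).
  by move=> dw; have /andP[] := fB _ (pc w dw).
exact: (weighted_gt0 mu1 ch hB h0 dv fv).
Qed.

Lemma conv_ext r s f f' : Psd r -> Psd s -> (forall x, Psd x -> f x = f' x) ->
  conv mu r s f = conv mu r s f'.
Proof.
move=> pr ps e; rewrite !convE; congr (_ * fine (itint _ _)).
apply/funext => c; rewrite /on_D; case: asboolP => // dv; rewrite e //.
by apply: msqrt_psd; exact: carg_psd.
Qed.

Definition sq_conj T x : M := T (msqrt x) *m T (msqrt x).

Section Forward.
Variable T : M -> M.
Hypothesis Tpsd : forall x, Psd x -> Psd (T x).
Hypothesis Tcont : contPi T.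
Hypothesis Tconv : forall x y, Psd x -> Psd y -> forall f, Cc f ->
  conv mu x y (f \o T) = conv mu (T x) (T y) f.

Lemma sq_conj_psd x : Psd x -> Psd (sq_conj T x).
Proof. by move=> px; apply: psd_sqr; apply: psd_herm; apply: Tpsd; exact: msqrt_psd. Qed.

Lemma sq_conj_cont : contPi (sq_conj T).
Proof.
have h1 : contPi (T \o @msqrt R q).
  by apply: contPi_comp Tcont; [exact: msqrt_psd | exact: msqrt_contPi].
have h2 x : Psd x -> Psd ((T \o @msqrt R q) x) by move=> px; apply: Tpsd; exact: msqrt_psd.
exact: (contPi_comp h2 h1 (@sqr_contPi R q)).
Qed.

(** Otherwise a bump about the image under T of the support point, narrow enough that squares stay
    within e, integrates to a positive number against one side and to 0 against the other. *)
Lemma sq_conj_supp x y v : Psd x -> Psd y -> inD v -> forall e : R, 0 < e ->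
  exists2 v', inD v' & mN (sq_conj T (conv_arg x y v) - conv_arg (sq_conj T x) (sq_conj T y) v') < e.
Proof.
move=> px py dv e e0; apply: contrapT => nv.
pose r := msqrt x; pose s := msqrt y; pose w0 := T (msqrt (conv_arg x y v)).
have pr : Psd r by exact: msqrt_psd. have ps : Psd s by exact: msqrt_psd.
have pTr := Tpsd pr; have pTs := Tpsd ps.
have cE : conv_arg x y v = carg r s v by rewrite carg_conv_arg // !msqrtK.
have [d d0 hd] : exists2 d : R, 0 < d & forall w, mN (w - w0) < d -> mN (w *m w - w0 *m w0) < e.
  by apply: (contM_mN w0 _ e0); apply: contM_mul; exact: contM_id.
pose f := bump w0 d; have cf : Cc f by exact: bump_Cc.
have : 0 < conv mu r s (f \o T).
  apply: (@conv_gt0 r s (f \o T) d v) => //.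
  - by apply: contPiR_comp Tcont (proj1 cf).
  - move=> w _; rewrite bump_ge0 /=; apply: le_trans (ler_norm _) _; exact: bump_le.
  - by rewrite /f /= -cE -/w0 bump_center.
rewrite Tconv // conv_eq0 ?ltxx // => v' dv'; apply: bump_eq0; rewrite leNgt; apply/negP => /hd.
rewrite msqrtK; last exact: carg_psd.
move=> h; apply: nv; exists v' => //; rewrite mNB; move: h.
by rewrite carg_conv_arg // /sq_conj.
Qed.

Lemma trace_mono (y z : M) : Psd (y - z) -> complex.Re (\tr z) <= complex.Re (\tr y).
Proof.
move=> h; rewrite -subr_ge0 -raddfB -raddfB /= /mxtrace raddf_sum sumr_ge0 // => i _.
by have := psd_rq (ecol R i) h; rewrite rq_ecol.
Qed.

Lemma sqr_le_scalar (x : M) : x^h = x -> Psd ((mN x ^+ 2 * q%:R)%:C *: 1%:M - x *m x).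
Proof.
move=> hx; apply/psdP; split.
  by rewrite mxadjB mxadjZr mxadj1 mxadjM hx.
move=> u; rewrite rqB rqZ subr_ge0.
apply: le_trans (ler_norm _) _; apply: le_trans (rq_le_mN _ _) _.
rewrite -mulrA; apply: ler_pM; [exact: mN_ge0 | exact: sqr_ge0 | | exact: mN_col_sqr].
by rewrite expr2 mNM.
Qed.

(** A norm bound gives x^2 <= t 1, hence (T x)^2 = S (x^2) <= 4 S ((t/4) 1) by [cone_step], and
    traces compare the norms. Nothing about the inverse of T is used. *)
Lemma aut_bounded (K : R) : exists K' : R, forall x, Psd x -> mnorm x <= K -> mnorm (T x) <= K'.
Proof.
have S_step := cone_step sq_conj_psd ((contPiE _).1 sq_conj_cont) sq_conj_supp.
pose t := ((q * q)%:R * K) ^+ 2 * q%:R.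
have q0 : 0 <= q%:R :> R by [].
have t0 : 0 <= t by rewrite mulr_ge0 // sqr_ge0.
have pt : Psd ((t / 4)%:C *: 1%:M : M) by apply: psdZ (psd1 _ _); rewrite divr_ge0.
exists (Num.sqrt (complex.Re (\tr ((4 : R)%:C *: sq_conj T ((t / 4)%:C *: 1%:M))))).
move=> x px xK; rewrite /mnorm ler_wsqrtr //; apply: trace_mono.
rewrite (psd_herm (Tpsd px)).
have -> : T x *m T x = sq_conj T (x *m x) by rewrite /sq_conj sqr_msqrtK.
apply: S_step => //; first exact: psd_sqr (psd_herm px).
rewrite scalerA -rmorphM mulrCA mulfV // mulr1.
have -> : t%:C *: 1%:M - x *m x = (t - mN x ^+ 2 * q%:R)%:C *: 1%:M +
   ((mN x ^+ 2 * q%:R)%:C *: 1%:M - x *m x).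
  by rewrite rmorphB scalerBl addrA subrK.
apply: psdD; last exact: sqr_le_scalar (psd_herm px).
apply: psdZ (psd1 _ _); rewrite subr_ge0 ler_wpM2r // ler_sqr ?nnegrE ?mN_ge0 //.
  apply: le_trans (mN_le_mnorm x) _; by rewrite ler_wpM2l.
apply: mulr_ge0 => //; apply: le_trans xK; by rewrite mnormE sqrtr_ge0.
Qed.
End Forward.

(** The identity for T is tested against f \o U, whose support is bounded by [aut_bounded]. *)
Lemma aut_inv T : hypergroup_aut mu T -> exists2 U, hypergroup_aut mu U &
  (forall x, Psd x -> U (T x) = x) /\ (forall x, Psd x -> T (U x) = x).
Proof.
rewrite /hypergroup_aut /homeoPi PsdE.
move=> [[pT [cT [U [pU cU UT TU]]]] hT]; exists U => //.
split; first by split=> //; split=> //; exists T.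
move=> x y px py f [cf [K hK]].
have [K' hK'] := aut_bounded pT cT hT K.
have cfU : Cc (f \o U).
  split; first exact: contPiR_comp.
  exists K'; rewrite PsdE => z pz Kz /=; apply: hK; first by rewrite PsdE; exact: pU.
  rewrite ltNge; apply/negP => h; have := hK' _ (pU _ pz) h.
  by rewrite TU // leNgt Kz.
have := hT _ _ (pU _ px) (pU _ py) _ cfU; rewrite !TU // => <-.
by apply: conv_ext; [exact: pU | exact: pU | move=> z pz; rewrite /= UT].
Qed.

Lemma aut_form T : (0 < q)%N -> hypergroup_aut mu T -> exists2 a : M, a \in unitmx &
  (forall r, Psd r -> T r = Ta a r) \/ (forall r, Psd r -> T r = msqrt (a *m (r *m r)^T *m a^h)).
Proof.
move=> q0 aT; have [U aU [UT TU]] := aut_inv aT.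
move: aT aU; rewrite /hypergroup_aut /homeoPi PsdE.
move=> [[pT [cT _]] hT] [[pU [cU _]] hU].
have Spsd := sq_conj_psd pT; have Upsd := sq_conj_psd pU.
have Scont := (contPiE _).1 (sq_conj_cont pT cT).
have Ucont := (contPiE _).1 (sq_conj_cont pU cU).
have Ssupp := sq_conj_supp pT cT hT; have Usupp := sq_conj_supp pU cU hU.
have SU x : Psd x -> sq_conj T (sq_conj U x) = x.
  by move=> px; rewrite /sq_conj sqr_msqrtK ?TU ?msqrtK //; [exact: msqrt_psd | apply: pU; exact: msqrt_psd].
have US x : Psd x -> sq_conj U (sq_conj T x) = x.
  by move=> px; rewrite /sq_conj sqr_msqrtK ?UT ?msqrtK //; [exact: msqrt_psd | apply: pT; exact: msqrt_psd].
have Smono := order_mono Spsd Upsd SU US Scont Ucont Ssupp Usupp.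
have Umono := order_mono Upsd Spsd US SU Ucont Scont Usupp Ssupp.
have Shom := order_hom Spsd Upsd SU US Scont Ssupp Usupp Smono.
have [a ua h] := cone_iso q0 Spsd Upsd SU US Smono Umono Shom Scont.
have TE r : Psd r -> T r = msqrt (sq_conj T (r *m r)).
  by move=> pr; rewrite /sq_conj sqr_msqrtK // sqr_msqrtK //; exact: pT.
exists a => //; case: h => h; [left|right] => r pr; rewrite TE // h //; exact: psd_sqr (psd_herm pr).
Qed.
End Support.

(** * The maps T_a and transposition are automorphisms *)

(** Only n coordinates matter, so g factors through row vectors, where a closed cube is compact. *)
Lemma cont_bounded (R : realType) n (g : (nat -> R) -> R) (K : R) :
  (forall c (e : R), 0 < e -> exists2 d : R, 0 < d & forall c', cclose n d c c' -> `|g c' - g c| < e) ->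
  exists B : R, forall c, (forall k, (k < n)%N -> `|c k| <= K) -> `|g c| <= B.
Proof.
move=> cg.
pose cv (v : 'rV[R]_n) : nat -> R := fun k => if insub k is Some i then v ord0 i else 0.
have cvE v (i : 'I_n) : cv v i = v ord0 i by rewrite /cv valK.
have cG : continuous (g \o cv).
  move=> v; apply/(@cvgrPdist_lt _ _ _ _ (nbhs_filter v)) => e e0; have [d d0 hd] := cg (cv v) e e0.
  apply/nbhs_ballP; exists d => // w vw; rewrite distrC; apply: hd => k kn.
  by have := vw.2 ord0 (Ordinal kn); rewrite /ball /= distrC -!cvE.
have cK : compact [set v : 'rV[R]_n | forall i, `[- K, K]%classic (v ord0 i)].
  by apply: (@rV_compact _ _ (fun=> `[- K, K]%classic)) => _; exact: segment_compact.
have cI := continuous_compact (continuous_subspaceT cG) cK.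
have [B [_ hB]] := compact_bounded cI.
exists (B + 1) => c cK'.
pose v : 'rV[R]_n := \row_i c i.
have vc k : (k < n)%N -> cv v k = c k by move=> kn; rewrite (cvE v (Ordinal kn)) mxE.
(* The two sequences agree below n, hence are close at every scale, and continuity forces equal
   values. *)
have -> : g c = g (cv v).
  apply/eqP; rewrite -subr_eq0 -normr_le0 leNgt; apply/negP => h.
  have [d d0 hd] := cg (cv v) _ h.
  have /hd : cclose n d (cv v) c by move=> k kn; rewrite vc // subrr normr0.
  by rewrite ltxx.
apply: (hB (B + 1)); first by rewrite ltrDl.
exists v => // i; rewrite /= mxE in_itv /= -ler_norml; exact: cK'.
Qed.

Section Backward.
Variables (R : realType) (q : nat) (mu : R).
Local Notation C := (R[i]).
Local Notation M := ('M[C]_q).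
Hypothesis mu1 : rho R q - 1 < mu.
Implicit Types (x y r s v w a u : M) (T : M -> M) (f : M -> R).

Lemma Cc_bounded f : Cc f -> exists B : R, forall w, Psd w -> `|f w| <= B.
Proof.
move=> [cf [K hK]].
have cx : contM (fun x : M => x *m x^h) by apply: contM_mul; [exact: contM_id | apply: contM_adj; exact: contM_id].
have cfs := (contPiRE _).1 (contPiR_comp (@msqrt_psd R q) (@msqrt_contPi R q) cf).
have q0 : 0 <= (q * q)%:R :> R by [].
have [B hB] : exists B : R, forall c, (forall k, (k < 2 * q * q)%N -> `|c k| <= (q * q)%:R * K) ->
    `|f (msqrt (vmat q c *m (vmat q c)^h))| <= B.
  apply: cont_bounded => c e e0.
  have [d1 d10 h1] := cfs _ (psd_gram (vmat q c)) e e0.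
  have [d2 d20 h2] := contM_mN (vmat q c) cx d10.
  exists (d2 / (2 * (q * q)%:R + 1)); first by rewrite divr_gt0 // ltr_wpDl // mulr_ge0.
  move=> c' /(vmat_close d20) /h2 h; apply: h1 => //; exact: psd_gram.
exists (Num.max B 0) => w pw.
have [wK|Kw] := leP (mnorm w) K; last first.
  by rewrite hK ?PsdE // normr0 le_max lexx orbT.
have E : w = msqrt (vmat q (mcoord w) *m (vmat q (mcoord w))^h).
  by rewrite vmat_mcoord (psd_herm pw) sqr_msqrtK.
rewrite le_max {1}E hB // => k _; rewrite /mcoord.
have mK i j : normc (w i j) <= (q * q)%:R * K.
  apply: le_trans (mN_entry w i j) _; apply: le_trans (mN_le_mnorm w) _.
  by rewrite ler_wpM2l.
have K0 : 0 <= (q * q)%:R * K.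
  by rewrite mulr_ge0 //; apply: le_trans wK; rewrite mnormE sqrtr_ge0.
case: insubP => [i _ _|_]; last by rewrite normr0.
case: insubP => [j _ _|_]; last by rewrite normr0.
apply: le_trans (mK i j).
case: (w i j) => a b; case: (odd k); rewrite /= -sqrtr_sqr ler_wsqrtr //.
  by rewrite lerDr sqr_ge0.
by rewrite lerDl sqr_ge0.
Qed.

Lemma conv_change f r s r' s' (L : M -> M) g : Psd r -> Psd s -> Psd r' -> Psd s' ->
  contPiR g -> (exists B : R, forall w, Psd w -> `|g w| <= B) ->
  (forall v w, L (v + w) = L v + L w) -> (forall v, exists w, L w = v) -> contM L ->
  (forall v, inD (L v) <-> inD v) -> (forall v, wt mu (L v) = wt mu v) ->
  (forall v, inD v -> f (msqrt (carg r s v)) = g (msqrt (carg r' s' (L v)))) ->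
  conv mu r s f = conv mu r' s' g.
Proof.
move=> pr ps pr' ps' cg [B hB] Ladd Lsurj Lcont LD Lwt fg; rewrite !convE.
have ch := contD_carg pr' ps' cg.
have hB' v : inD v -> `|g (msqrt (carg r' s' v))| <= B.
  by move=> dv; apply: hB; apply: msqrt_psd; exact: carg_psd.
rewrite -(itint_inv mu1 ch hB' Ladd Lsurj Lcont LD Lwt).
congr (_ * fine (itint _ _)); apply/funext => c; rewrite /on_D; case: asboolP => // dv.
by rewrite fg.
Qed.

Lemma Ta_psd a r : Psd r -> Psd (Ta a r).
Proof.
move=> pr; apply: msqrt_psd; apply: psd_conj; exact: psd_sqr (psd_herm pr).
Qed.

Lemma Ta_sqr a r : Psd r -> Ta a r *m Ta a r = a *m (r *m r) *m a^h.
Proof. by move=> pr; rewrite msqrtK //; apply: psd_conj; exact: psd_sqr (psd_herm pr). Qed.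

Lemma TaK a b r : b *m a = 1%:M -> Psd r -> Ta b (Ta a r) = r.
Proof.
move=> ba pr; rewrite {1}/Ta Ta_sqr // !mulmxA ba mul1mx -!mulmxA -mxadjM ba mxadj1 mulmx1.
exact: sqr_msqrtK.
Qed.

Lemma Ta_cont a : contPi (Ta a).
Proof.
have cx : contM (fun x : M => a *m (x *m x) *m a^h).
  apply: contM_mul; last exact: contM_cst.
  by apply: contM_mul; [exact: contM_cst | apply: contM_mul; exact: contM_id].
have px x : Psd x -> Psd (a *m (x *m x) *m a^h).
  by move=> px; apply: psd_conj; exact: psd_sqr (psd_herm px).
exact: (contPi_comp px (contM_contPi cx) (@msqrt_contPi R q)).
Qed.

Lemma pd_congr a x : a \in unitmx -> pd x -> pd (a *m x *m a^h).
Proof.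
move=> ua px; apply: psd_unit_pd; first by apply: psd_conj; exact: pd_psd.
by rewrite !unitmx_mul ua (pd_unit px) mxadj_unit.
Qed.

Lemma unitary_unit u : unitary u -> u \in unitmx.
Proof. by move=> uu; case/mulmx1_unit: uu. Qed.

Lemma unitary_adj u : unitary u -> unitary u^h.
Proof. by move=> uu; rewrite /unitary mxadjK; exact: unitaryC. Qed.

Lemma inD_unitary u w v : unitary u -> unitary w -> inD v -> inD (w *m v *m u^h).
Proof.
move=> uu uw dv; rewrite inDE !mxadjM mxadjK.
have -> : 1%:M - u *m (v^h *m w^h) *m (w *m v *m u^h) = u *m (1%:M - v^h *m v) *m u^h.
  rewrite mulmxBr mulmxBl mulmx1 uu; congr (_ - _).
  by rewrite !mulmxA -[_ *m w^h *m w]mulmxA unitaryC // mulmx1.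
by apply: pd_congr => //; exact: unitary_unit.
Qed.

Lemma wt_unitary u w v : unitary u -> unitary w -> wt mu (w *m v *m u^h) = wt mu v.
Proof.
move=> uu uw.
have e : 1%:M - w *m v *m u^h *m (w *m v *m u^h)^h = w *m (1%:M - v *m v^h) *m w^h.
  rewrite !mxadjM mxadjK mulmxBr mulmxBl mulmx1 uw; congr (_ - _).
  by rewrite !mulmxA -[_ *m u^h *m u]mulmxA unitaryC // mulmx1.
by rewrite /wt /Delta e !det_mulmx mulrAC -det_mulmx uw det1 mul1r.
Qed.

Lemma polar_carg a r s (P Q u w v : M) : r^h = r -> s^h = s -> P^h = P -> Q^h = Q ->
  a *m r = P *m u -> a *m s = Q *m w ->
  P *m P = a *m (r *m r) *m a^h -> Q *m Q = a *m (s *m s) *m a^h ->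
  a *m carg r s v *m a^h = carg P Q (w *m v *m u^h).
Proof.
move=> hr hs hP hQ ru sw PP QQ.
have ru' : r *m a^h = u^h *m P.
  by have := congr1 (@mxadj R q q) ru; rewrite !mxadjM hr hP.
have sw' : s *m a^h = w^h *m Q.
  by have := congr1 (@mxadj R q q) sw; rewrite !mxadjM hs hQ.
have e1 : a *m (s *m v *m r) *m a^h = Q *m (w *m v *m u^h) *m P.
  by rewrite -[LHS]mulmxA -[s *m v *m r *m _]mulmxA ru' !mulmxA sw.
have e2 : a *m (r *m v^h *m s) *m a^h = P *m (w *m v *m u^h)^h *m Q.
  by rewrite -[LHS]mulmxA -[r *m _ *m s *m _]mulmxA sw' !mxadjM mxadjK !mulmxA ru.
by rewrite /carg !mulmxDr !mulmxDl PP QQ e1 e2.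
Qed.

Lemma conv_Ta a r s f : Psd r -> Psd s -> contPiR f ->
  (exists B : R, forall w, Psd w -> `|f w| <= B) ->
  conv mu r s (f \o Ta a) = conv mu (Ta a r) (Ta a s) f.
Proof.
move=> pr ps cf bf.
have gramE x : Psd x -> (a *m x) *m (a *m x)^h = Ta a x *m Ta a x.
  by move=> px; rewrite Ta_sqr // mxadjM (psd_herm px) !mulmxA.
have [u uu ru] := polar (Ta_psd a pr) (gramE r pr).
have [w uw sw] := polar (Ta_psd a ps) (gramE s ps).
apply: (conv_change (L := fun v => w *m v *m u^h) pr ps (Ta_psd a pr) (Ta_psd a ps) cf bf).
- by move=> v v'; rewrite mulmxDr mulmxDl.
- move=> v; exists (w^h *m v *m u).
  by rewrite !mulmxA uw mul1mx -mulmxA uu mulmx1.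
- by apply: contM_mul; [apply: contM_mul; [exact: contM_cst | exact: contM_id] | exact: contM_cst].
- move=> v; split; last exact: inD_unitary.
  move=> /(inD_unitary (unitary_adj uu) (unitary_adj uw)).
  have -> : w^h *m (w *m v *m u^h) *m u^h^h = v; last by [].
  by rewrite mxadjK !mulmxA (unitaryC uw) mul1mx -mulmxA (unitaryC uu) mulmx1.
- by move=> v; exact: wt_unitary.
move=> v dv /=; rewrite /Ta -/(Ta a r) -/(Ta a s) msqrtK; last exact: carg_psd.
congr (f (msqrt _)).
exact: (polar_carg v (psd_herm pr) (psd_herm ps) (psd_herm (Ta_psd a pr)) (psd_herm (Ta_psd a ps))
  ru sw (Ta_sqr a pr) (Ta_sqr a ps)).
Qed.

Lemma psd_tr x : Psd x -> Psd x^T.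
Proof.
move=> px; rewrite -(msqrtK px) trmx_mul; apply: psd_sqr.
by rewrite mxadj_tr (psd_herm (msqrt_psd px)).
Qed.

Lemma msqrt_tr x : Psd x -> msqrt x^T = (msqrt x)^T.
Proof.
move=> px; apply: msqrt_eq; first by apply: psd_tr; exact: msqrt_psd.
by rewrite -trmx_mul msqrtK.
Qed.

Lemma pd_tr x : pd x -> pd x^T.
Proof.
move=> px; apply: psd_unit_pd; first by apply: psd_tr; exact: pd_psd.
by rewrite unitmx_tr pd_unit.
Qed.

Lemma conj_sqr_tr v : 1%:M - v^h^T^h *m v^h^T = (1%:M - v^h *m v)^T.
Proof. by rewrite raddfB /= trmx1 trmx_mul mxadj_tr mxadjK. Qed.

Lemma conj_sqr_tr' v : 1%:M - v^h^T *m v^h^T^h = (1%:M - v *m v^h)^T.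
Proof. by rewrite raddfB /= trmx1 trmx_mul mxadj_tr mxadjK. Qed.

Lemma conj_mxK v : v^h^T^h^T = v.
Proof. by rewrite mxadj_tr mxadjK trmxK. Qed.

Lemma inD_conj v : inD v -> inD v^h^T.
Proof. by rewrite !inDE conj_sqr_tr; exact: pd_tr. Qed.

Lemma carg_tr r s v : (carg r s v)^T = carg r^T s^T v^h^T.
Proof.
rewrite /carg !raddfD /= !trmx_mul mxadj_tr mxadjK !mulmxA -!addrA; congr (_ + (_ + _)).
by rewrite addrC.
Qed.

(** The substitution is entrywise conjugation of v, which is only real linear; [conv_change] asks no
    more than additivity and continuity of this kind. *)
Lemma conv_tau r s f : Psd r -> Psd s -> contPiR f ->
  (exists B : R, forall w, Psd w -> `|f w| <= B) ->
  conv mu r s (f \o @tau R q) = conv mu r^T s^T f.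
Proof.
move=> pr ps cf bf.
apply: (conv_change (L := fun v => v^h^T) pr ps (psd_tr pr) (psd_tr ps) cf bf).
- by move=> v v'; rewrite mxadjD raddfD.
- by move=> v; exists v^h^T; rewrite conj_mxK.
- move=> i j; apply: contC_ext (contC_conj (contC_entry i j)) => v.
  by rewrite mxE mxadjE.
- by move=> v; split=> [/inD_conj|/inD_conj //]; rewrite conj_mxK.
- by move=> v; rewrite /wt conj_sqr_tr' /Delta det_tr.
by move=> v dv /=; rewrite /tau -msqrt_tr ?carg_tr //; exact: carg_psd.
Qed.

Lemma tau_cont : contPi (@tau R q).
Proof.
by apply: contM_contPi => i j; apply: contC_ext (contC_entry j i) => v; rewrite mxE.
Qed.

Lemma aut_of a (sigma : M -> M) T : a \in unitmx -> sigma = id \/ sigma = @tau R q ->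
  (forall r, Psd r -> T r = sigma (Ta a r)) -> hypergroup_aut mu T.
Proof.
move=> ua hs TE.
have sp x : Psd x -> Psd (sigma x) by case: hs => -> //; exact: psd_tr.
have ss x : sigma (sigma x) = x by case: hs => -> //; exact: trmxK.
have sc : contPi sigma.
  by case: hs => ->; [apply: contM_contPi; exact: contM_id | exact: tau_cont].
have sconv r s f : Psd r -> Psd s -> contPiR f ->
    (exists B : R, forall w, Psd w -> `|f w| <= B) ->
    conv mu r s (f \o sigma) = conv mu (sigma r) (sigma s) f.
  by case: hs => -> // pr ps cf bf; exact: conv_tau.
rewrite /hypergroup_aut /homeoPi PsdE; split; last first.
  move=> x y px py f cf; have [B hB] := Cc_bounded cf; have [cf0 _] := cf.
  rewrite (conv_ext mu (f' := (f \o sigma) \o Ta a) px py); last by move=> z pz /=; rewrite TE.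
  rewrite conv_Ta //.
  - by rewrite sconv ?TE //; [exact: Ta_psd | exact: Ta_psd | exists B].
  - exact: contPiR_comp.
  - by exists B => w pw; apply: hB; exact: sp.
split; first by move=> x px; rewrite TE //; apply: sp; exact: Ta_psd.
split.
  apply: (contPi_ext (T := sigma \o Ta a)); first by move=> x px; rewrite TE.
  by apply: contPi_comp sc; [move=> x; exact: Ta_psd | exact: Ta_cont].
exists (Ta (invmx a) \o sigma); split.
- by move=> x px; apply: Ta_psd; exact: sp.
- exact: (contPi_comp sp sc (@Ta_cont _)).
- by move=> x px; rewrite /= TE // ss TaK // mulVmx.
move=> x px; rewrite /= TE; last by apply: Ta_psd; exact: sp.
by rewrite TaK ?ss ?mulmxV //; exact: sp.
Qed.
End Backward.

Theorem mainTheorem2 (R : realType) (q : nat) (mu : R) :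
  (0 < q)%N -> rho R q - 1 < mu ->
  forall T : 'M[R[i]]_q -> 'M[R[i]]_q,
    hypergroup_aut mu T <->
    exists a : 'M[R[i]]_q, a \in unitmx /\
      exists sigma : 'M[R[i]]_q -> 'M[R[i]]_q,
        (sigma = id \/ sigma = @tau R q) /\
        forall r, psd r -> T r = sigma (Ta a r).
Proof.
move=> q0 mu1 T; rewrite PsdE; split; last first.
  by move=> [a [ua [sigma [hs TE]]]]; exact: (aut_of mu1 ua hs TE).
move=> /(aut_form mu1 q0)[a ua [h|h]].
  by exists a; split=> //; exists id; split; [left|].
(* The entrywise conjugate of a: transposing its action on r^2 gives a (r^2)^T a^*. *)
exists a^h^T; split; first by rewrite unitmx_tr mxadj_unit.
exists (@tau R q); split; first by right.
move=> r pr; rewrite h // /tau /Ta -msqrt_tr.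
  by rewrite !trmx_mul mxadj_tr mxadjK !trmxK mulmxA.
by apply: psd_conj; exact: psd_sqr (psd_herm pr).
Qed.
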